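(* Let $N\ge 2$ be an integer, let $1<p<N$, let $p_*=\frac{p(N-1)}{N-p}$, and let $$K_p^{-1}=\inf_{u\in W^{1,p}(\mathbb{R}^N_+)\setminus W^{1,p}_0(\mathbb{R}^N_+)} \frac{\int_{\mathbb{R}^N_+}|\nabla u|^p\,dx}{\left(\int_{\partial\mathbb{R}^N_+}|u|^{p_*}\,dS\right)^{p/p_*}}.$$ Then $$K_p^{-1}=\left(\frac{N-p}{p-1}\right)^{p-1}\pi^{\frac{p-1}{2}}\left(\frac{\Gamma\left(\frac{N-1}{2(p-1)}\right)}{\Gamma\left(\frac{p(N-1)}{2(p-1)}\right)}\right)^{\frac{p-1}{N-1}}.$$
   Context: $\mathbb{R}^N_+=\{(y,t): y\in\mathbb{R}^{N-1},\ t>0\}$ is the open half-space, with boundary $\partial\mathbb{R}^N_+=\mathbb{R}^{N-1}\times\{0\}$ and surface measure $dS$ (Lebesgue measure on $\mathbb{R}^{N-1}$). $W^{1,p}$ is the usual Sobolev space of functions in $L^p$ with weak gradient in $L^p$, and $W^{1,p}_0$ is the closure in the $W^{1,p}$-norm of the smooth functions with compact support in the open set; the values of $u$ on the boundary are understood in the sense of traces. $\Gamma$ is the Euler Gamma function. *)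

(* Defs.v *)
From HB Require Import structures.
From mathcomp Require Import all_boot all_order all_algebra.
From mathcomp Require Import all_classical all_reals all_analysis.
Set Implicit Arguments.
Unset Strict Implicit.
Unset Printing Implicit Defensive.
Import Order.TTheory GRing.Theory Num.Theory.
Import numFieldNormedType.Exports.
Local Open Scope classical_set_scope.
Local Open Scope ring_scope.

Definition rV_display : measure_display -> measure_display.
Proof. exact. Qed.

Section measurable_rV.
Context d (T : measurableType d) (n : nat).

Let coords (i : 'I_n) (x : 'rV[T]_n) : T := x ord0 i.

Let rV_set0 : g_sigma_preimage coords set0.
Proof. exact: sigma_algebra0. Qed.

Let rV_setC A : g_sigma_preimage coords A -> g_sigma_preimage coords (~` A).
Proof. exact: sigma_algebraC. Qed.

Let rV_bigcup (F : _^nat) : (forall i, g_sigma_preimage coords (F i)) ->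
  g_sigma_preimage coords (\bigcup_i (F i)).
Proof. exact: sigma_algebra_bigcup. Qed.

(* For T = R this is the Borel sigma-algebra of R^n. *)
HB.instance Definition _ := @isMeasurable.Build (rV_display d)
  'rV[T]_n (g_sigma_preimage coords) rV_set0 rV_setC rV_bigcup.

Lemma measurable_coord (i : 'I_n) :
  measurable_fun [set: 'rV[T]_n] (fun x : 'rV[T]_n => x ord0 i).
Proof.
move=> _ Y mY; rewrite setTI; apply: sub_sigma_algebra => /=.
rewrite -bigcup_seq/=; exists i => /=; first by rewrite mem_index_enum.
by exists Y => //; rewrite setTI.
Qed.

Lemma measurable_fun_coordP d' (S : measurableType d') (f : S -> 'rV[T]_n) :
  (forall i, measurable_fun [set: S] (fun s => f s ord0 i)) ->
  measurable_fun [set: S] f.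
Proof.
move=> mf; apply: (@measurability _ _ _ _ setT f
  (\big[setU/set0]_(i < n) preimage_set_system setT (coords i) measurable)) => //.
move=> _ [B mB <-]; move: mB; rewrite -bigcup_seq => -[i _ [Y mY <-]].
by rewrite setTI -comp_preimage; exact: mf.
Qed.

End measurable_rV.

Section lebesgue_rV.
Context (R : realType).
Local Open Scope ereal_scope.

Definition cons_rV n (z : measurableTypeR R * 'rV[R]_n) : 'rV[R]_n.+1 :=
  \row_(i < n.+1) oapp (z.2 ord0) z.1 (unlift ord0 i).

Lemma measurable_cons_rV n : measurable_fun setT (@cons_rV n).
Proof.
apply: measurable_fun_coordP => i.
case: (unliftP ord0 i) => [j|] ->.
  rewrite (_ : (fun _ => _) = (fun x : 'rV[R]_n => x ord0 j) \o snd).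
    exact: measurableT_comp (measurable_coord j) measurable_snd.
  by apply/funext => z /=; rewrite mxE liftK.
rewrite (_ : (fun _ => _) = fst); first exact: measurable_fst.
by apply/funext => z /=; rewrite mxE unlift_none.
Qed.

Section product_cons.
Context n (mu : {sigma_finite_measure set 'rV[R]_n -> \bar R}).

Definition product_cons : set 'rV[R]_n.+1 -> \bar R :=
  pushforward (@lebesgue_measure R \x mu) (@cons_rV n).

Let product_cons0 : product_cons set0 = 0.
Proof. by rewrite /product_cons /pushforward preimage_set0 measure0. Qed.

Let product_cons_ge0 A : 0 <= product_cons A.
Proof. exact: (measure_ge0 (@lebesgue_measure R \x mu)). Qed.

Let product_cons_sigma_additive : semi_sigma_additive product_cons.
Proof.
have mc := @measurable_cons_rV n.
move=> F mF tF mUF; rewrite /product_cons /pushforward preimage_bigcup.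
apply: measure_semi_sigma_additive.
- by move=> k; rewrite -[X in measurable X]setTI; exact: mc.
- apply/trivIsetP => /= i j _ _ ij; rewrite -preimage_setI.
  by move/trivIsetP : tF => /(_ _ _ _ _ ij) ->//; rewrite preimage_set0.
- by rewrite -preimage_bigcup -[X in measurable X]setTI; exact: mc.
Qed.

HB.instance Definition _ := isMeasure.Build _ _ _ product_cons
  product_cons0 product_cons_ge0 product_cons_sigma_additive.

Let product_cons_sigma_finite : sigma_finite setT product_cons.
Proof.
have /sigma_finiteP[F [TF ndF Foo]] := sigma_finiteT (@lebesgue_measure R).
have /sigma_finiteP[G [TG ndG Goo]] := sigma_finiteT mu.
pose tail (x : 'rV[R]_n.+1) : 'rV[R]_n := \row_(j < n) x ord0 (lift ord0 j).
have mtail : measurable_fun setT tail.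
  apply: measurable_fun_coordP => j.
  rewrite (_ : (fun _ => _) = (fun x : 'rV[R]_n.+1 => x ord0 (lift ord0 j))).
    exact: measurable_coord.
  by apply/funext => x; rewrite mxE.
pose head (x : 'rV[R]_n.+1) : R := x ord0 ord0.
have mhead : measurable_fun setT head by exact: measurable_coord.
exists (fun k => head @^-1` F k `&` tail @^-1` G k).
  rewrite predeqE => x; split=> // _.
  have : (\bigcup_k F k) (head x) by rewrite -TF.
  move=> [i _ Fi]; have : (\bigcup_k G k) (tail x) by rewrite -TG.
  move=> [j _ Gj]; exists (maxn i j) => //; split => /=.
    by move: (head x) Fi; exact/subsetPset/ndF/leq_maxl.
  by move: (tail x) Gj; exact/subsetPset/ndG/leq_maxr.
move=> k; have [mFk Fk] := Foo k; have [mGk Gk] := Goo k; split.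
  apply: measurableI; rewrite -[X in measurable X]setTI;
    [exact: mhead|exact: mtail].
rewrite /product_cons /pushforward (_ : _ @^-1` _ = F k `*` G k); last first.
  apply/seteqP; split => -[t y]; rewrite /head /tail /= mxE unlift_none /=;
    rewrite (_ : \row_j _ = y)//; by apply/rowP => j; rewrite !mxE liftK.
by rewrite product_measure1E// lte_mul_pinfty// ge0_fin_numE.
Qed.

HB.instance Definition _ := Measure_isSigmaFinite.Build _ _ _ product_cons
  product_cons_sigma_finite.

End product_cons.

(* R^0 is a single point, of measure 1. *)
Fixpoint leb (n : nat) : {sigma_finite_measure set 'rV[R]_n -> \bar R} :=
  match n with
  | 0 => \d_(0%R : 'rV[R]_0)
  | m.+1 => product_cons (leb m)
  end.

End lebesgue_rV.
Arguments leb : clear implicits.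

Section sobolev.
Context (R : realType) (N : nat).
Implicit Types (Omega : set 'rV[R]_N) (p : R) (u phi : 'rV[R]_N -> R).
Implicit Types (G : 'rV[R]_N -> 'rV[R]_N).

Definition enorm (x : 'rV[R]_N) : R := Num.sqrt (\sum_i x ord0 i ^+ 2).

Definition partial (i : 'I_N) u : 'rV[R]_N -> R :=
  fun x => 'D_(delta_mx ord0 i) u x.

Definition grad u : 'rV[R]_N -> 'rV[R]_N := fun x => \row_i partial i u x.

Definition smooth u : Prop := forall s : seq 'I_N,
  continuous (foldr partial u s) /\
  forall i x, derivable (foldr partial u s) x (delta_mx ord0 i).

Definition test_fun Omega phi : Prop :=
  [/\ smooth phi, compact (closure [set x | phi x != 0]) &
      closure [set x | phi x != 0] `<=` Omega].

Definition Lp Omega p u : Prop := u \_ Omega \in Lfun (leb R N) p%:E.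

Definition weak_grad Omega u G : Prop :=
  forall phi, test_fun Omega phi -> forall i : 'I_N,
    \int[leb R N]_(x in Omega) (u x * partial i phi x) =
    - \int[leb R N]_(x in Omega) (G x ord0 i * phi x).

Definition W1p_grad Omega p u G : Prop :=
  [/\ Lp Omega p u, forall i, Lp Omega p (fun x => G x ord0 i) &
      weak_grad Omega u G].

Definition W1p Omega p : set ('rV[R]_N -> R) :=
  [set u | exists G, W1p_grad Omega p u G].

(* The W^{1,p}(Omega)-norm of a function u with weak gradient G. *)
Definition W1p_norm Omega p u G : \bar R :=
  ((\int[leb R N]_(x in Omega) (`|u x| `^ p)%:E +
    \int[leb R N]_(x in Omega) (enorm (G x) `^ p)%:E) `^ p^-1)%E.

Definition W1p_cvg Omega p (phi : nat -> 'rV[R]_N -> R) u : Prop :=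
  exists2 G, W1p_grad Omega p u G &
    (fun n => W1p_norm Omega p (fun x => u x - phi n x)
                               (fun x => G x - grad (phi n) x))
      @ \oo --> 0%E.

Definition W1p0 Omega p : set ('rV[R]_N -> R) :=
  [set u | exists2 phi : nat -> 'rV[R]_N -> R,
     (forall n, test_fun Omega (phi n)) & W1p_cvg Omega p phi u].

End sobolev.

Section trace.
Context (R : realType) (N : nat).

Definition half_space : set 'rV[R]_N :=
  [set x | forall i : 'I_N, i.+1 = N -> 0 < x ord0 i].

(* y |-> (y, 0), for N > 0: insub i is defined iff i is not the last index. *)
Definition bdry (y : 'rV[R]_N.-1) : 'rV[R]_N :=
  \row_(i < N) oapp (y ord0) 0 (insub (val i)).

(* g is the trace of u: the trace operator is the continuous extension from
   W^{1,p}(R^N_+) to L^p(R^(N-1)) of the restriction to the boundary, defined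
   on the dense subspace of (restrictions to the half-space of) functions in
   C_c^infty(R^N). *)
Definition is_trace (p : R) (u : 'rV[R]_N -> R) (g : 'rV[R]_N.-1 -> R) : Prop :=
  g \in Lfun (leb R N.-1) p%:E /\
  exists phi : nat -> 'rV[R]_N -> R,
    [/\ forall n, test_fun setT (phi n), W1p_cvg half_space p phi u &
        (fun n => 'N[leb R N.-1]_(p%:E)
                    [EFin \o (fun y => g y - phi n (bdry y))%R]%E)
          @ \oo --> 0%E].

Definition pstar (p : R) : R := p * N.-1%:R / (N%:R - p).

Definition trace_quotient (p : R) (G : 'rV[R]_N -> 'rV[R]_N)
    (g : 'rV[R]_N.-1 -> R) : \bar R :=
  (\int[leb R N]_(x in half_space) (enorm (G x) `^ p)%:E /
   (\int[leb R N.-1]_y (`|g y| `^ pstar p)%:E) `^ (p / pstar p))%E.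

(* The infimum denoted K_p^{-1}.  Every u in W^{1,p}(R^N_+) has a trace, and weak
   gradients and traces are unique up to null sets, so each u contributes
   exactly one quotient. *)
Definition Kp_inv (p : R) : \bar R :=
  ereal_inf [set q | exists u G g,
    [/\ (W1p half_space p `\` W1p0 half_space p) u,
        W1p_grad half_space p u G, is_trace p u g &
        q = trace_quotient p G g]].

End trace.
Arguments Kp_inv : clear implicits.

Definition Gamma (R : realType) (x : R) : R :=
  \int[lebesgue_measure]_(t in `]0, +oo[) (t `^ (x - 1) * expR (- t)).

(* Main.v *)
(** Write n = N - 1, beta = (N - p)/(p - 1) and a = p n/(p - 1), and let K be
    the integral of (1 + |z|^2)^(-a/2) over R^n; then a - n = beta + 1.

    Lower bound.  Let u be C^1 with bounded support and f = |u(., 0)|.  Send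
    from every boundary point y the ray (y + t theta(y), t), t > 0, where theta
    is the triangular (Knothe) map transporting f^pstar dy, made positive by
    a small multiple of an integrable weight, to a multiple of
    (1 + |z|^2)^(-a/2) dz.  With d_i the diagonal entries of D theta, the map
    (y, t) -> (y + t theta(y), t) has Jacobian prod (1 + t d_i), which is at
    least (1 + t d)^n for d = (prod d_i)^(1/n).  Young's inequality applied to
    f(y) <= int_t |grad u| sqrt(1 + |theta|^2) along each ray, with this weight,
    integrated in y and optimized over one scalar, gives
    beta^(p-1) K^((p-1)/n) (int f^pstar)^(p/pstar) <= int |grad u|^p.
    Fatou's lemma along an almost everywhere convergent subsequence extends it
    to W^{1,p}.  If int |grad u|^p = 0, then the inequality on the slices
    {x_N = t} shows u = 0, so such a u lies in W^{1,p}_0.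

    Upper bound.  Smooth truncations of |x + e_N|^(-beta) at height delta have
    energy at most beta^(p-1) K, and their boundary integrals tend to K as
    delta tends to 0.

    Finally K is computed one coordinate at a time: the Gaussian integral gives
    Gamma(b/2) int (1 + s^2)^(-b/2) ds = sqrt(pi) Gamma((b-1)/2), and the
    product over b = a, a - 1, .., a - n + 1 telescopes. *)
From HB Require Import structures.
From mathcomp Require Import all_boot all_order all_algebra.
From mathcomp Require Import all_classical all_reals all_analysis.
From mathcomp Require Import measurable_realfun ring lra.
Require Import Defs.
Set Implicit Arguments.
Unset Strict Implicit.
Unset Printing Implicit Defensive.
Import Order.TTheory GRing.Theory Num.Theory.
Import numFieldNormedType.Exports.
Local Open Scope classical_set_scope.
Local Open Scope ring_scope.

(** * Integration over products of coordinates *)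

Section row_vectors.
Context (R : realType).
Local Open Scope ereal_scope.
Local Notation mu := (@lebesgue_measure R).

(** Rays and exponents are read off from the extremal |x + e_N|^(-beta). Its gradient points along
    the rays from the pole -e_N, which leave the boundary at y with theta(y) = y, and its boundary
    value to the power pstar is (1 + |z|^2)^(-a/2); hence the target density. For a general f, up to
    the perturbation, this target makes d a power of f times (1 + |theta|^2)^(p/(2(p - 1))), the
    very factor that Young's inequality produces, so that theta drops out of the remainder. A
    triangular map involves one-dimensional changes of variables only, and no regularity theory. Its
    price is a density that is continuous, positive and dominated by an integrable product, so that
    the marginals are continuous and positive as well; hence the perturbation of f^pstar. Two
    features of the infimum call for separate arguments: G is an arbitrary weak gradient of u, so
    weak gradients must be shown unique almost everywhere, and a vanishing trace puts 0 in the
    denominator, so zero energy must be excluded. Truncating the extremal in height and not in space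
    contracts its values, so that no gradient of a cut-off enters the energy. *)

Definition snoc_rV n (y : 'rV[R]_n) (t : R) : 'rV[R]_n.+1 :=
  \row_(i < n.+1) oapp (y ord0) t (insub (val i)).

Lemma snoc_rV_lt n (y : 'rV[R]_n) t (i : 'I_n.+1) (h : (i < n)%N) :
  snoc_rV y t ord0 i = y ord0 (Ordinal h).
Proof. by rewrite mxE insubT. Qed.

Lemma snoc_rV_widen n (y : 'rV[R]_n) t (i : 'I_n) :
  snoc_rV y t ord0 (widen_ord (leqnSn n) i) = y ord0 i.
Proof.
rewrite (@snoc_rV_lt _ _ _ (widen_ord (leqnSn n) i) (ltn_ord i)).
by congr (y ord0 _); exact: val_inj.
Qed.

Lemma snoc_rV_max n (y : 'rV[R]_n) t : snoc_rV y t ord0 ord_max = t.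
Proof. by rewrite mxE insubF//= ltnn. Qed.

Lemma snoc_rV_last n (y : 'rV[R]_n) t (i : 'I_n.+1) : i.+1 = n.+1 ->
  snoc_rV y t ord0 i = t.
Proof.
by move=> [h]; rewrite (_ : i = ord_max) ?snoc_rV_max//; exact: val_inj.
Qed.

Lemma cons_rV0 n (z : R) (y : 'rV[R]_n) : cons_rV (z, y) ord0 ord0 = z.
Proof. by rewrite mxE unlift_none. Qed.

Lemma cons_rV_lift n (z : R) (y : 'rV[R]_n) (i : 'I_n) :
  cons_rV (z, y) ord0 (lift ord0 i) = y ord0 i.
Proof. by rewrite mxE liftK. Qed.

Lemma snoc_cons_rV n (z : R) (y : 'rV[R]_n) t :
  snoc_rV (cons_rV (z, y)) t = cons_rV (z, snoc_rV y t).
Proof.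
apply/rowP => i; case: (unliftP ord0 i) => [j|] ->.
  case: (ltnP j n) => jn; first rewrite cons_rV_lift.
    rewrite (@snoc_rV_lt _ _ _ _ (jn : (lift ord0 j < n.+1)%N)).
    rewrite (snoc_rV_lt _ _ jn) (_ : Ordinal _ = lift ord0 (Ordinal jn)).
      by rewrite cons_rV_lift.
    exact: val_inj.
  have jE : j = n :> nat by apply/eqP; rewrite eqn_leq jn -ltnS ltn_ord.
  by rewrite cons_rV_lift !snoc_rV_last//= ?lift0 jE.
rewrite cons_rV0 snoc_rV_lt (_ : Ordinal _ = ord0) ?cons_rV0//.
exact: val_inj.
Qed.

Lemma measurable_cons_rVP d (T : measurableType d) n (f : T -> R)
    (g : T -> 'rV[R]_n) :
  measurable_fun setT f -> measurable_fun setT g ->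
  measurable_fun setT (fun x => cons_rV (f x, g x)).
Proof.
move=> mf mg; apply: (measurableT_comp (@measurable_cons_rV R n)).
exact/measurable_fun_pairP.
Qed.

Lemma measurable_snoc_rVP d (T : measurableType d) n (f : T -> 'rV[R]_n)
    (g : T -> R) :
  measurable_fun setT f -> measurable_fun setT g ->
  measurable_fun setT (fun x => snoc_rV (f x) (g x)).
Proof.
move=> mf mg; apply: measurable_fun_coordP => i.
under eq_fun do rewrite mxE.
case: insubP => [j _ _|_] //=.
exact: measurableT_comp (measurable_coord j) mf.
Qed.

Lemma ge0_integral_leb0 (f : 'rV[R]_0 -> \bar R) : (forall x, 0 <= f x) ->
  measurable_fun setT f -> \int[leb R 0]_x f x = f 0%R.
Proof. by move=> f0 mf; rewrite /= integral_dirac// diracT mul1e. Qed.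

Lemma ge0_integral_cons n (f : 'rV[R]_n.+1 -> \bar R) :
  measurable_fun setT f -> (forall x, 0 <= f x) ->
  \int[leb R n.+1]_x f x = \int[mu]_z \int[leb R n]_y f (cons_rV (z, y)).
Proof.
move=> mf f0.
rewrite [LHS](@ge0_integral_pushforward _ _ _ _ _ _ (@measurable_cons_rV R n)
  (mu \x leb R n) setT f)//.
rewrite preimage_setT fubini_tonelli1//=.
exact: (measurableT_comp mf (@measurable_cons_rV R n)).
Qed.

Lemma tonelli_swap d1 d2 (T1 : measurableType d1) (T2 : measurableType d2)
    (m1 : {sigma_finite_measure set T1 -> \bar R})
    (m2 : {sigma_finite_measure set T2 -> \bar R}) (f : T1 -> T2 -> \bar R) :
  measurable_fun setT (fun w : T1 * T2 => f w.1 w.2) ->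
  (forall x y, 0 <= f x y) ->
  \int[m1]_x \int[m2]_y f x y = \int[m2]_y \int[m1]_x f x y.
Proof.
by move=> mf f0; exact: (@fubini_tonelli _ _ _ _ _ m1 m2 (fun w => f w.1 w.2)).
Qed.

Lemma measurable_integral_section d1 d2 (T1 : measurableType d1)
    (T2 : measurableType d2) (m2 : {sigma_finite_measure set T2 -> \bar R})
    (f : T1 -> T2 -> \bar R) :
  measurable_fun setT (fun w : T1 * T2 => f w.1 w.2) ->
  (forall x y, 0 <= f x y) ->
  measurable_fun setT (fun x => \int[m2]_y f x y).
Proof.
move=> mf f0.
exact: (@measurable_fun_fubini_tonelli_F _ _ _ _ _ m2 (fun w => f w.1 w.2)
  mf (fun w => f0 w.1 w.2)).
Qed.

(** [leb] splits off the first coordinate, whereas the half-space and its boundary single out the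
    last one. The first coordinate is peeled off, the induction hypothesis treats the others, and
    Tonelli exchanges the first coordinate with the last. *)
Lemma ge0_integral_snoc n (f : 'rV[R]_n.+1 -> \bar R) :
  measurable_fun setT f -> (forall x, 0 <= f x) ->
  \int[leb R n.+1]_x f x = \int[mu]_t \int[leb R n]_y f (snoc_rV y t).
Proof.
elim: n => [|n IH] in f * => mf f0.
  rewrite (ge0_integral_cons mf f0); apply: eq_integral => t _.
  apply: eq_integral => y _; congr f; apply/rowP => i.
  by rewrite (ord1 i) snoc_rV_last// mxE unlift_none.
rewrite (ge0_integral_cons mf f0).
transitivity (\int[mu]_z \int[mu]_t \int[leb R n]_y
    f (cons_rV (z, snoc_rV y t))).
  apply: eq_integral => z _; apply: (IH (fun x => f (cons_rV (z, x)))) => //.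
  by apply: (measurableT_comp mf); exact: measurable_cons_rVP.
have mF : measurable_fun setT
    (fun w : (measurableTypeR R * measurableTypeR R) * 'rV[R]_n =>
      f (cons_rV (w.1.1, snoc_rV w.2 w.1.2))).
  apply: (measurableT_comp mf); apply: measurable_cons_rVP.
    exact: measurableT_comp measurable_fst measurable_fst.
  apply: measurable_snoc_rVP; first exact: measurable_snd.
  exact: measurableT_comp measurable_snd measurable_fst.
rewrite (@tonelli_swap _ _ _ _ mu mu
  (fun z t => \int[leb R n]_y f (cons_rV (z, snoc_rV y t)))).
- apply: eq_integral => t _.
  have mft : measurable_fun setT (fun x => f (snoc_rV x t)).
    by apply: (measurableT_comp mf); exact: measurable_snoc_rVP.
  rewrite (ge0_integral_cons mft (fun=> f0 _)).
  by apply: eq_integral => z _; apply: eq_integral => y _; rewrite snoc_cons_rV.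
- exact: (@measurable_integral_section _ _ _ _ (leb R n)
    (fun (w : measurableTypeR R * measurableTypeR R) (y : 'rV[R]_n) =>
      f (cons_rV (w.1, snoc_rV y w.2))) mF (fun _ _ => f0 _)).
- by move=> *; exact: integral_ge0.
Qed.

End row_vectors.

(** * The topology of row vectors and its Borel sets *)

Section rV_topology.
Context (R : realType).

Lemma ball_rVP n (x y : 'rV[R]_n) e : 0 < e ->
  ball x e y <-> forall i, `|x ord0 i - y ord0 i| < e.
Proof.
move=> e0; split=> [[_ h] i|h]; first exact: h.
by split => // i j; rewrite (ord1 i); exact: h.
Qed.

Lemma cvg_rV (T : Type) (F : set_system T) (FF : Filter F) n (f : T -> 'rV[R]_n)
  (l : 'rV[R]_n) :
  (forall i, f x ord0 i @[x --> F] --> l ord0 i) -> f x @[x --> F] --> l.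
Proof.
move=> h; apply/cvg_ballP => e e0.
have : \forall x \near F, forall i, `|l ord0 i - f x ord0 i| < e.
  by apply: filter_forall => i; move/cvgrPdist_lt : (h i) => /(_ e e0).
by apply: filterS => x hx; apply/ball_rVP.
Qed.

Lemma continuous_rV (T : topologicalType) n (f : T -> 'rV[R]_n) :
  (forall i, continuous (fun x => f x ord0 i)) -> continuous f.
Proof. by move=> h x; apply: cvg_rV => i; exact: h. Qed.

(** The sigma-algebra is generated by the coordinates and not by the topology. The two meet because
    an open set is the countable union of the cubes with rational centre and radius 1/(k + 1) that
    it contains. *)
Lemma open_measurable_rV n (U : set 'rV[R]_n) : open U -> measurable U.
Proof.
move=> oU.
pose box (w : 'rV[rat]_n * nat) : set 'rV[R]_n :=
  [set x | forall i, `|ratr (w.1 ord0 i) - x ord0 i| < w.2.+1%:R^-1].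
have mbox w : measurable (box w).
  rewrite (_ : box w = \bigcap_(i in [set: 'I_n])
    [set x : 'rV[R]_n | `|ratr (w.1 ord0 i) - x ord0 i| < w.2.+1%:R^-1]).
    apply: fin_bigcap_measurable; first exact: finite_finset.
    move=> i _; rewrite -[X in measurable X]setTI.
    rewrite (_ : [set x : 'rV[R]_n | _] =
        (fun x : 'rV[R]_n => x ord0 i) @^-1` ball (ratr (w.1 ord0 i) : R) w.2.+1%:R^-1) //.
    apply: measurable_coord => //.
    exact: measurable_ball.
  by apply/seteqP; split => x h i; [move=> _|]; exact: h.
have -> : U = \bigcup_(w in [set w | box w `<=` U]) box w.
  apply/seteqP; split => [x Ux|x [w /= wU xw]]; last exact: wU.
  have := open_nbhs_nbhs (conj oU Ux) => /nbhs_ballP[e /= e0 exU].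
  have [k ke] : exists k : nat, k.+1%:R^-1 < e / 2.
    have /cvgrPdist_lt/(_ (e/2)) := @cvg_harmonic R.
    rewrite divr_gt0// => /(_ isT)[k _ /(_ k (leqnn k))] /=.
    by rewrite sub0r normrN ger0_norm// => hk; exists k.
  have hq i : exists q : rat, `|ratr q - x ord0 i| < k.+1%:R^-1.
    have : x ord0 i - k.+1%:R^-1 < x ord0 i + k.+1%:R^-1.
      by rewrite ltrBlDr -addrA ltrDl addr_gt0// invr_gt0.
    move=> /rat_in_itvoo[q]; rewrite in_itv/= => /andP[q1 q2]; exists q.
    by rewrite ltr_norml ltrBrDr ltrBlDr addrC q1 addrC q2.
  have [q qP] := choice hq.
  exists (\row_i q i, k) => /=; last by move=> i /=; rewrite mxE.
  move=> y hy; apply: exU; apply/ball_rVP => // i.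
  rewrite (splitr e) -(subrKA (ratr (q i))).
  apply: (le_lt_trans (ler_normD _ _)); apply: ltrD.
    by rewrite distrC; exact: (lt_trans (qP i)).
  by have := hy i; rewrite /= mxE => /lt_trans; exact.
rewrite bigcup_mkcond; apply: countable_bigcupT_measurable => // w.
by case: ifP.
Qed.

Lemma continuous_measurable_rV n (f : 'rV[R]_n -> R) :
  continuous f -> measurable_fun setT f.
Proof.
move=> /continuousP cf; apply: (measurability _ (RGenOpens.measurableE R)).
move=> _ [_ [a [b ->] <-]]; rewrite setTI; apply: open_measurable_rV.
exact/cf/interval_open.
Qed.

End rV_topology.

(** * Change of variables on the line *)

Section density_measure.
Context d (T : measurableType d) (R : realType).
Variables (m : {measure set T -> \bar R}) (g : T -> R).
Local Open Scope ereal_scope.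

(** The proofs [mg] and [g0] are arguments so that the instance below turns every such term into a
    measure. *)
Definition density_measure (mg : measurable_fun setT g)
    (g0 : forall x, (0 <= g x)%R) : set T -> \bar R :=
  fun A => \int[m]_(x in A) (g x)%:E.

Variables (mg : measurable_fun setT g) (g0 : forall x, (0 <= g x)%R).
Local Notation nu := (density_measure mg g0).

Let density_measure0 : nu set0 = 0.
Proof. exact: integral_set0. Qed.

Let density_measure_ge0 A : 0 <= nu A.
Proof. by apply: integral_ge0 => x _; rewrite lee_fin. Qed.

Let density_measure_sigma_additive : semi_sigma_additive nu.
Proof.
move=> F mF tF mUF; rewrite /density_measure; apply: cvg_toP.
  apply: ereal_nondecreasing_is_cvgn => a b ab.
  apply: lee_sum_nneg_natr => // k _ _; exact: density_measure_ge0.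
rewrite ge0_integral_bigcup//=.
- exact/measurable_funTS/measurableT_comp.
- by move=> x _; rewrite lee_fin.
Qed.

HB.instance Definition _ := isMeasure.Build _ _ _ nu
  density_measure0 density_measure_ge0 density_measure_sigma_additive.

Let mEg : measurable_fun setT (EFin \o g).
Proof. exact/measurable_EFinP. Qed.

Import HBNNSimple.

Let integral_density_nnsfun (f : {nnsfun T >-> R}) :
  \int[nu]_x (f x)%:E = \int[m]_x ((f x)%:E * (g x)%:E).
Proof.
under [LHS]eq_integral do rewrite fimfunE -fsumEFin//.
rewrite [LHS]ge0_integral_fsum//; last 2 first.
  - by move=> r; exact/measurable_EFinP/measurableT_comp.
  - by move=> n x _; rewrite EFinM nnfun_muleindic_ge0.
under [RHS]eq_integral.
  move=> x xD; rewrite fimfunE -fsumEFin// ge0_mule_fsuml; last first.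
    by move=> r; rewrite EFinM nnfun_muleindic_ge0.
  over.
rewrite [RHS]ge0_integral_fsum//; last 2 first.
  - move=> r; apply: emeasurable_funM => //.
    exact/measurable_EFinP/measurableT_comp.
  - move=> n x _; apply: mule_ge0; last by rewrite lee_fin.
    by rewrite EFinM nnfun_muleindic_ge0.
apply: eq_fsbigr => r _.
rewrite integralZl_indic_nnsfun// integral_indic// setIT.
have mA : measurable (f @^-1` [set r]) by [].
transitivity (\int[m]_x (r%:E * ((\1_(f @^-1` [set r]) x)%:E * (g x)%:E))).
  have [r0|r0] := leP 0%R r.
    rewrite ge0_integralZl//.
    - congr (_ * _).
      transitivity (\int[m]_(x in f @^-1` [set r]) (g x)%:E) => //.
      rewrite [LHS]integral_mkcond; apply: eq_integral => x _.
      by rewrite patchE indicE; case: ifP => _; rewrite ?mul1e ?mul0e.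
    - by apply: emeasurable_funM => //; apply/measurable_EFinP.
    - by move=> x _; rewrite mule_ge0// lee_fin.
  rewrite (_ : f @^-1` [set r] = set0); last exact: preimage_nnfun0.
  rewrite measure0 mule0 integral0_eq// => x _.
  by rewrite indic0 mul0e mule0.
by apply: eq_integral => x _; rewrite EFinM muleA.
Qed.

Lemma ge0_integral_density (f : T -> \bar R) :
  measurable_fun setT f -> (forall x, 0 <= f x) ->
  \int[nu]_x f x = \int[m]_x (f x * (g x)%:E).
Proof.
move=> mf f0; pose f_ := nnsfun_approx measurableT mf.
have f_f x : f x = limn (fun n => (f_ n x)%:E).
  by apply/esym/cvg_lim => //; exact: cvg_nnsfun_approx.
transitivity (limn (fun n => \int[nu]_x (f_ n x)%:E)).
  rewrite -monotone_convergence//=.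
  - by apply: eq_integral => x _; exact: f_f.
  - by move=> n; exact/measurable_EFinP/measurable_funTS.
  - by move=> n x _; rewrite lee_fin.
  - by move=> x _ a b ab; rewrite lee_fin; exact/lefP/nd_nnsfun_approx.
transitivity (limn (fun n => \int[m]_x ((f_ n x)%:E * (g x)%:E))).
  by apply: congr_lim; apply/funext => n; exact: integral_density_nnsfun.
rewrite -monotone_convergence//=.
- apply: eq_integral => x _; rewrite f_f; apply/cvg_lim => //.
  by apply: cvgeZr => //; rewrite -f_f; exact: cvg_nnsfun_approx.
- move=> n; apply: emeasurable_funM => //.
  exact/measurable_EFinP/measurable_funTS.
- by move=> n x _; rewrite mule_ge0// lee_fin.
- move=> x _ a b ab; rewrite lee_wpmul2r ?lee_fin//.
  exact/lefP/nd_nnsfun_approx.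
Qed.

End density_measure.

Section line_change_of_variables.
Context (R : realType).
Local Notation mu := (@lebesgue_measure R).

Lemma derivable_continuous (f : R -> R) :
  (forall x : R, derivable f x 1) -> continuous f.
Proof. by move=> df x; exact/differentiable_continuous/derivable1_diffP. Qed.

Lemma pos_derive_increasing (f g : R -> R) :
  (forall x : R, is_derive x 1 f (g x)) -> (forall x, 0 < g x) ->
  {homo f : x y / x < y}.
Proof.
move=> df g0 x y xy.
have cf : continuous f by apply: derivable_continuous => z; case: (df z).
have [|c _ fE] := MVT xy (fun z _ => df z); first exact: continuous_subspaceT.
by rewrite -subr_gt0 fE mulr_gt0// subr_gt0.
Qed.

Lemma integral_itv_derive (f g : R -> R) (a b : R) :
  (forall x : R, is_derive x 1 f (g x)) -> continuous g -> a < b ->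
  (\int[mu]_(x in `]a, b]) (g x)%:E = (f b - f a)%:E)%E.
Proof.
move=> df cg ab.
have cf : continuous f by apply: derivable_continuous => z; case: (df z).
rewrite integral_itv_obnd_cbnd; last first.
  by apply/measurable_EFinP; apply: measurable_funTS;
    exact: continuous_measurable_fun.
rewrite (@continuous_FTC2 _ _ f)//.
- exact: continuous_subspaceT.
- split; first by move=> x _; case: (df x).
    by apply: cvg_at_right_filter; exact: cf.
  by apply: cvg_at_left_filter; exact: cf.
- by move=> x _; rewrite derive1E; case: (df x).
Qed.

Lemma continuous_unbounded_surjective (f : R -> R) : continuous f ->
  (forall M, exists x, M <= f x) -> (forall M, exists x, f x <= M) ->
  forall y, exists x, f x = y.
Proof.
move=> cf up dn y; have [b fb] := up y; have [a fa] := dn y.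
have [ab|ba] := leP a b.
  have [||c _ <-] := @IVT _ f a b y ab; last by exists c.
    exact: continuous_subspaceT.
  by rewrite ge_min fa le_max fb orbT.
have [||c _ <-] := @IVT _ f b a y (ltW ba); last by exists c.
  exact: continuous_subspaceT.
by rewrite ge_min fa orbT le_max fb.
Qed.

(** By the fundamental theorem of calculus the measure of density g, pushed forward by f, has the
    right value on half-open intervals, so it is Lebesgue measure by uniqueness. [H] is merely
    measurable because it will be an inner integral over the other coordinates. *)
Lemma ge0_integral_line_substitution (f g : R -> R) (H : R -> \bar R) :
  (forall x : R, is_derive x 1 f (g x)) -> continuous g -> (forall x, 0 < g x) ->
  (forall M, exists x, M <= f x) -> (forall M, exists x, f x <= M) ->
  measurable_fun [set: R] H -> (forall x, 0 <= H x)%E ->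
  (\int[mu]_x H x = \int[mu]_y (H (f y) * (g y)%:E))%E.
Proof.
move=> df cg g0 up dn mH H0.
have cf : continuous f by apply: derivable_continuous => z; case: (df z).
have fi := pos_derive_increasing df g0.
have fle := le_mono fi.
have flt := leW_mono fle.
have mf : measurable_fun setT (f : measurableTypeR R -> measurableTypeR R).
  exact: continuous_measurable_fun.
have mg : measurable_fun setT (g : measurableTypeR R -> R).
  exact: continuous_measurable_fun.
have g0' x : 0 <= g x by exact: ltW.
have surj := continuous_unbounded_surjective cf up dn.
pose nu : {measure set (measurableTypeR R) -> \bar R} := density_measure mu mg g0'.
pose nuf : {measure set (measurableTypeR R) -> \bar R} :=
  measure_function_pushforward__canonical__measure_function_Measure nu mf.
have E : forall A, measurable A -> mu A = nuf A.
  apply: lebesgue_measure_unique => _ [[a b] _ <-] /=.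
  have [a' fa] := surj a; have [b' fb] := surj b; rewrite -fa -fb.
  rewrite /pushforward /density_measure /=.
  rewrite (_ : f @^-1` _ = `]a', b']%classic); last first.
    by apply/seteqP; split => x /=; rewrite !in_itv/= flt fle.
  rewrite lebesgue_measure_itv/= lte_fin flt.
  have [ab|ab] := ltP a' b'.
    by rewrite (integral_itv_derive df cg ab) EFinB.
  by rewrite set_itv_ge ?integral_set0// -leNgt.
transitivity (\int[nuf]_x H x)%E.
  by apply: eq_measure_integral => A mA _; exact: E.
rewrite [LHS](@ge0_integral_pushforward _ _ _ _ _ _ mf nu setT H)//.
rewrite preimage_setT [LHS](@ge0_integral_density _ _ _ mu g mg g0')//.
  exact: (measurableT_comp mH).
by move=> x; exact: H0.
Qed.

End line_change_of_variables.

(** * Cumulative distributions and quantiles *)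

Section cumulative_distribution.
Context (R : realType).
Local Notation mu := (@lebesgue_measure R).

Definition cumul (f : R -> R) (y : R) : R := \int[mu]_(t in `]-oo, y]) f t.

Variable f : R -> R.
Hypotheses (cf : continuous f) (f0 : forall x, 0 < f x).
Hypothesis intf : mu.-integrable setT (EFin \o f).
Let m := \int[mu]_t f t.

Let mf : measurable_fun setT (f : measurableTypeR R -> R).
Proof. exact: continuous_measurable_fun. Qed.

Let f0' x : 0 <= f x. Proof. exact: ltW. Qed.

Lemma is_derive_cumul (y : R) : is_derive y 1 (cumul f) (f y).
Proof.
have yy1 : y < y + 1 by rewrite ltrDl.
have [||H1 H2] := @continuous_FTC1 R f -oo%O y (y + 1) yy1 _ _ (@cf y).
- by apply: integrableS intf.
- by rewrite ltNyr.
- by split; [exact: H1|rewrite -derive1E; exact: H2].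
Qed.

Lemma cumul_increasing : {homo cumul f : x y / x < y}.
Proof. by apply: (@pos_derive_increasing _ _ f) => // x; exact: is_derive_cumul. Qed.

Let nu : {measure set (measurableTypeR R) -> \bar R} := density_measure mu mf f0'.

Let nu_cumul y : nu `]-oo, y]%classic = (cumul f y)%:E.
Proof.
rewrite /cumul /Rintegral fineK//; apply: integrable_fin_num => //.
exact: integrableS intf.
Qed.

Let nu_setT : nu setT = m%:E.
Proof. by rewrite /m /Rintegral fineK//; exact: integrable_fin_num. Qed.

Let cvg_nu (F : (set R)^nat) e : (forall n, measurable (F n)) ->
  nondecreasing_seq F -> \bigcup_n F n = setT -> 0 < e ->
  exists n, (m%:E - e%:E < nu (F n))%E.
Proof.
move=> mF ndF UF e0; have := @nondecreasing_cvg_mu _ _ _ nu F mF _ ndF.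
rewrite UF nu_setT => /(_ measurableT) h.
have me : (m%:E - e%:E < m%:E)%E by rewrite -EFinB lte_fin ltrBlDr ltrDl.
by have [n _ /(_ n (leqnn n)) /=] := h _ (open_ereal_gt' me); exists n.
Qed.

Lemma cumul_gt (e : R) : 0 < e -> exists y, m - e < cumul f y.
Proof.
move=> e0; have [|||n] := cvg_nu (F := fun n => `]-oo, n%:R]%classic) _ _ _ e0.
- by [].
- by move=> a b ab; apply/subsetPset => x /=; rewrite !in_itv/= => /le_trans; apply; rewrite ler_nat.
- apply/seteqP; split => // x _; exists (Num.truncn x).+1 => //=.
  by rewrite in_itv/= ltW// truncnS_gt.
- by rewrite nu_cumul -EFinB lte_fin => h; exists n%:R.
Qed.

Lemma cumul_lt (e : R) : 0 < e -> exists y, cumul f y < e.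
Proof.
move=> e0; have [|||n] := cvg_nu (F := fun n => `](- n%:R), +oo[%classic) _ _ _ e0.
- by [].
- move=> a b ab; apply/subsetPset => x /=; rewrite !in_itv/= !andbT.
  by apply: le_lt_trans; rewrite lerN2 ler_nat.
- apply/seteqP; split => // x _; exists (Num.truncn (- x)).+1 => //=.
  by rewrite in_itv/= andbT ltrNl truncnS_gt.
move=> h; exists (- n%:R); rewrite -lte_fin -nu_cumul.
have : (m%:E = nu `]-oo, (- n%:R)%R]%classic + nu `](- n%:R)%R, +oo[%classic)%E.
  rewrite -nu_setT -measureU//.
    by congr (nu _); apply/seteqP; split => // x _ /=; rewrite !in_itv/= andbT;
      have [|] := leP x (- n%:R); [left|right].
  by apply/seteqP; split => // x /= []; rewrite !in_itv/= andbT leNgt => /negP.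
move=> mE; move: h; rewrite mE.
have : (nu `](- n%:R)%R, +oo[%classic <= nu setT)%E by apply: le_measure; rewrite ?inE.
rewrite nu_setT nu_cumul.
have : (0 <= nu `](- n%:R)%R, +oo[%classic)%E by [].
case: (nu _) => [r| |] //= _ _.
by rewrite -!EFinD !lte_fin; lra.
Qed.

Lemma cumul_bounds y : 0 < cumul f y < m.
Proof.
have ge0 z : 0 <= cumul f z.
  by apply: Rintegral_ge0 => x _; exact: f0'.
have lem z : cumul f z <= m.
  by rewrite -lee_fin -nu_cumul -nu_setT; apply: le_measure; rewrite ?inE.
apply/andP; split.
  apply: (le_lt_trans (ge0 (y - 1))); apply: cumul_increasing; lra.
apply: (lt_le_trans _ (lem (y + 1))); apply: cumul_increasing; lra.
Qed.

Lemma cumul_surj q : 0 < q < m -> exists y, cumul f y = q.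
Proof.
move=> /andP[q0 qm]; have [a ha] := cumul_lt q0.
have [|b hb] := @cumul_gt (m - q); first by rewrite subr_gt0.
have {}hb : q < cumul f b by lra.
have cC : continuous (cumul f).
  by apply: derivable_continuous => y; case: (is_derive_cumul y).
have ab : a <= b.
  by rewrite -(le_mono cumul_increasing) (ltW (lt_trans ha hb)).
have [||c _ cE] := @IVT _ (cumul f) a b q ab; last by exists c.
  exact: continuous_subspaceT.
by rewrite ge_min (ltW ha) le_max (ltW hb) orbT.
Qed.

(** The inverse of [cumul f] on its range []0, m[], with the default value 0 elsewhere. *)
Definition quantile (q : R) : R := xget 0 [set y | cumul f y = q].

Lemma cumulK y : quantile (cumul f y) = y.
Proof.
rewrite /quantile; case: xgetP => [z _ /= zE|/(_ y) /= h]; last by case: h.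
exact: (inc_inj (le_mono cumul_increasing)).
Qed.

Lemma quantileK q : 0 < q < m -> cumul f (quantile q) = q.
Proof. by move=> /cumul_surj[y <-]; rewrite cumulK. Qed.

Lemma is_derive_quantile q : 0 < q < m ->
  is_derive q 1 quantile (f (quantile q))^-1.
Proof.
move=> qm; rewrite -{1}(quantileK qm).
apply: (@is_derive_inverse _ (cumul f)).
- by near=> y; exact: cumulK.
- near=> y; apply: derivable_continuous => z.
  by case: (is_derive_cumul z).
- exact: is_derive_cumul.
- by rewrite gt_eqF.
Unshelve. all: by end_near. Qed.

Lemma measurable_quantile : measurable_fun setT (quantile : measurableTypeR R -> R).
Proof.
have cmono : {mono cumul f : x y / x < y}.
  exact: leW_mono (le_mono cumul_increasing).
apply: (measurability _ (RGenOInfty.measurableE R)) => _ [_ [z ->] <-].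
rewrite setTI.
(* Outside []0, m[] the quantile has its default value 0, which exceeds z exactly when z < 0. *)
rewrite (_ : _ @^-1` _ =
    (`]0, m[ `&` `]cumul f z, +oo[) `|` (if z < 0 then ~` `]0, m[ else set0)).
  by apply: measurableU; [exact: measurableI|case: ifP => // _; exact: measurableC].
have Q0 q : ~ (`]0, m[%classic q) -> quantile q = 0.
  move=> h; rewrite /quantile; case: xgetP => // y _ /= yq; exfalso; apply: h.
  by rewrite /= in_itv/= -yq cumul_bounds.
apply/seteqP; split => q /=; rewrite !in_itv/= !andbT.
  have [qm|qm] := boolP (0 < q < m).
    by move=> zq; left; rewrite -{1}(quantileK qm) cmono.
  move=> zq; right; rewrite Q0 /= ?in_itv/= in zq *; last exact/negP.
  by rewrite zq /= in_itv/=; exact/negP.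
case=> [[qm]|].
  by rewrite -{1}(quantileK qm) cmono.
by case: ifPn => // z0 /= h; rewrite Q0.
Qed.

End cumulative_distribution.

(** * Real powers and the densities (1 + z^2)^(-b/2) *)

Section powR_facts.
Context (R : realType).
Implicit Types (x y a e d : R).

Lemma powR_lower x y e : 0 < x -> x <= y -> 0 <= e -> y `^ (- e) <= x `^ (- e).
Proof.
move=> x0 xy e0; have y0 := lt_le_trans x0 xy.
rewrite !powRN lef_pV2 ?posrE ?powR_gt0//.
by rewrite ge0_ler_powR// nnegrE ltW.
Qed.

Lemma is_derive_powR_comp (u : R -> R) x du a : 0 < u x ->
  is_derive x 1 u du ->
  is_derive x 1 (fun t => u t `^ a) (a * u x `^ (a - 1) * du).
Proof.
move=> u0 hu.
have := is_derive1_powR a u0 => h.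
by have := @is_derive1_comp R (fun y => y `^ a) u x _ _ h hu.
Qed.

Lemma cvg_powR_pinfty e : 0 < e -> x `^ (- e) @[x --> +oo] --> (0 : R).
Proof.
move=> e0; apply/cvgrPdist_le => eps eps0; near=> x.
have hx : eps `^ (- e^-1) <= x by near: x; exact: nbhs_pinfty_ge.
rewrite sub0r normrN ger0_norm ?powR_ge0//.
apply: (le_trans (powR_lower _ hx (ltW e0))); first exact: powR_gt0.
by rewrite -powRrM mulrNN mulVf ?gt_eqF// powRr1// ltW.
Unshelve. all: by end_near. Qed.

Lemma continuous_powR_comp (T : topologicalType) (u : T -> R) a (x : T) :
  0 < u x -> {for x, continuous u} -> {for x, continuous (fun t => u t `^ a)}.
Proof.
move=> u0 cu; apply: (@continuous_comp _ _ _ u (fun y => y `^ a)) => //.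
apply/differentiable_continuous/derivable1_diffP.
by case: (is_derive1_powR a u0).
Qed.

End powR_facts.

Section profile.
Context (R : realType).
Local Notation mu := (@lebesgue_measure R).
Implicit Types (b d g A : R).

Lemma integral_affine_powR d g : 0 < d -> 1 < g ->
  (\int[mu]_(t in `[0%R, +oo[) ((1 + d * t) `^ (- g))%:E =
   ((d * (g - 1))^-1)%:E)%E.
Proof.
move=> d0 g1; have g0 : 0 < g - 1 by rewrite subr_gt0.
have dg0 : d * (g - 1) != 0 by rewrite gt_eqF// mulr_gt0.
pose F (t : R) : R := - (d * (g - 1))^-1 * (1 + d * t) `^ (- (g - 1)).
have pos (t : R) : 0 <= t -> 0 < 1 + d * t.
  by move=> t0; rewrite ltr_wpDr// mulr_ge0// ltW.
have daff (t : R) : is_derive t 1 (fun t => 1 + d * t) d.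
  by apply: is_derive_eq; rewrite /GRing.scale/=; ring.
have dF (t : R) : 0 <= t -> is_derive t 1 F ((1 + d * t) `^ (- g)).
  move=> t0; have := is_derive_powR_comp (u := fun t : R => 1 + d * t) (- (g - 1)) (pos _ t0) (daff t).
  move=> h; apply: is_derive_eq.
  rewrite /GRing.scale/= (_ : - (g - 1) - 1 = - g); last by ring.
  by field; rewrite !gt_eqF.
have cF (t : R) : 0 <= t -> {for t, continuous F}.
  by move=> t0; apply/differentiable_continuous/derivable1_diffP; case: (dF _ t0).
have aff : (1 + d * t) @[t --> +oo] --> +oo.
  apply/cvgryPge => M; exists ((M - 1) / d); split; first exact: num_real.
  by move=> t; rewrite ltr_pdivrMr// mulrC => /ltW; rewrite lerBlDl.
rewrite (@ge0_continuous_FTC2y _ _ F _ 0).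
- rewrite /F mulr0 addr0 powR1 mulr1 -EFinB; congr (_%:E); ring.
- by move=> x x0; exact: powR_ge0.
- apply: continuous_in_subspaceT => x; rewrite inE/= in_itv/= andbT => x0.
  apply: (@continuous_powR_comp _ _ (fun t : R => 1 + d * t)); first exact: pos.
  by apply/differentiable_continuous/derivable1_diffP; case: (daff x).
- rewrite -[X in _ --> X](mulr0 (- (d * (g - 1))^-1)).
  by apply: cvgMr; exact: (cvg_comp _ _ aff (cvg_powR_pinfty g0)).
- by move=> x x0; case: (dF _ (ltW x0)).
- by apply: cvg_at_right_filter; exact: cF.
- move=> x; rewrite in_itv/= andbT => x0.
  by rewrite derive1E; case: (dF _ (ltW x0)).
Qed.

(** A Student density up to its mass. The exponent is halved so that b is the rate of decay at
    infinity; integrating one coordinate out of a radial density of this kind lowers b by one. *)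
Definition profile b (z : R) : R := (1 + z ^+ 2) `^ (- (b / 2)).

Definition profile_mass b : R := \int[mu]_z profile b z.

Lemma sqr1_gt0 (z : R) : 0 < 1 + z ^+ 2.
Proof. by rewrite ltr_wpDr// sqr_ge0. Qed.

Lemma profile_gt0 b z : 0 < profile b z.
Proof. exact/powR_gt0/sqr1_gt0. Qed.

Lemma continuous_sqr1 : continuous (fun z : R => 1 + z ^+ 2).
Proof.
by move=> z; apply: cvgD; [exact: cvg_cst|exact: exprn_continuous].
Qed.

Lemma continuous_profile b : continuous (profile b).
Proof.
by move=> z; apply: (@continuous_powR_comp _ _ (fun z : R => 1 + z ^+ 2));
  [exact: sqr1_gt0|exact: continuous_sqr1].
Qed.

Lemma integrable_profile b : 1 < b -> mu.-integrable setT (EFin \o profile b).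
Proof.
move=> b1; have mp : measurable_fun setT (profile b : measurableTypeR R -> R).
  by apply: continuous_measurable_fun; exact: continuous_profile.
apply/integrableP; split; first by apply/measurable_EFinP.
under eq_integral => x _ do rewrite /= ger0_norm ?(ltW (profile_gt0 _ _))//.
rewrite ge0_symfun_integralT; last 3 first.
- by move=> x; exact/ltW/profile_gt0.
- exact: continuous_profile.
- by move=> x; rewrite /profile /= sqrrN.
rewrite (_ : [set x | _] = `[0, +oo[%classic); last first.
  by apply/seteqP; split => x /=; rewrite in_itv/= andbT.
apply: lte_mul_pinfty => //.
(* The comparison rests on (1 + x)^2 <= 2 (1 + x^2), which brings in an explicit integral of a power
   of 1 + x. *)
apply: (@le_lt_trans _ _ (\int[mu]_(t in `[0%R, +oo[)
  ((2 `^ (b / 2))%:E * ((1 + 1 * t) `^ (- b))%:E))%E).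
  apply: ge0_le_integral => //.
  - by move=> x _; rewrite lee_fin ltW// profile_gt0.
  - by apply/measurable_EFinP; exact: measurable_funTS.
  - apply: emeasurable_funM; first exact: measurable_cst.
    apply/measurable_EFinP; apply: measurable_funTS.
    apply: (measurableT_comp (measurable_powR _)).
    by apply: measurable_funD; [exact: measurable_cst|exact: measurable_funM].
  - move=> x /=; rewrite in_itv/= andbT => x0; rewrite -EFinM lee_fin /profile mul1r.
    have x1 : 0 < 1 + x by rewrite ltr_wpDr.
    rewrite (_ : (1 + x) `^ (- b) = ((1 + x) ^+ 2) `^ (- (b / 2))); last first.
      by rewrite -powR_mulrn ?ltW// -powRrM; congr (_ `^ _); field.
    have h : 1 + x ^+ 2 >= (1 + x) ^+ 2 / 2.
      by rewrite -subr_ge0 (_ : _ - _ = (1 - x) ^+ 2 / 2); [rewrite divr_ge0// sqr_ge0|field].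
    apply: (le_trans (powR_lower _ h _)).
    + by rewrite divr_gt0// exprn_gt0.
    + by rewrite divr_ge0// ltW// (lt_trans _ b1).
    rewrite powRM ?invr_ge0 ?sqr_ge0// mulrC ler_wpM2r ?powR_ge0//.
    by rewrite -[X in X `^ _](@powR_inv1 R 2)// -powRrM mulrNN mul1r.
rewrite ge0_integralZl//.
- by rewrite integral_affine_powR// -EFinM ltry.
- apply/measurable_EFinP; apply: measurable_funTS.
  apply: (measurableT_comp (measurable_powR _)).
  by apply: measurable_funD; [exact: measurable_cst|exact: measurable_funM].
- by move=> x _; rewrite lee_fin powR_ge0.
Qed.

Lemma integral_profile b : 1 < b ->
  (\int[mu]_z (profile b z)%:E = (profile_mass b)%:E)%E.
Proof.
move=> b1; rewrite /profile_mass /Rintegral fineK//.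
exact: integrable_fin_num (integrable_profile b1).
Qed.

Lemma profile_mass_gt0 b : 1 < b -> 0 < profile_mass b.
Proof.
move=> b1; have := cumul_bounds (@continuous_profile b) (profile_gt0 b)
  (integrable_profile b1) 0.
by move=> /andP[/lt_trans]; apply.
Qed.

End profile.

(** * One-dimensional and triangular transport *)

Section monotone_transport.
Context (R : realType).
Local Notation mu := (@lebesgue_measure R).
Implicit Types (b A m t : R) (rho : R -> R).

Lemma ge0_integral_scale A (H : R -> \bar R) : 0 < A ->
  measurable_fun [set: R] H -> (forall x, 0 <= H x)%E ->
  (\int[mu]_x H x = \int[mu]_y (H (A * y)%R * A%:E))%E.
Proof.
move=> A0 mH H0.
apply: (@ge0_integral_line_substitution _ (fun y => A * y) (fun=> A)) => //.
- by move=> x; apply: is_derive_eq; rewrite /GRing.scale/=; ring.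
- by move=> x; exact: cvg_cst.
- by move=> M; exists (M / A); rewrite mulrCA divff ?gt_eqF// mulr1.
- by move=> M; exists (M / A); rewrite mulrCA divff ?gt_eqF// mulr1.
Qed.

Lemma integral_scaled_profile b A : 1 < b -> 0 < A ->
  (\int[mu]_z ((A ^+ 2 + z ^+ 2) `^ (- (b / 2)))%:E =
   (A `^ (1 - b) * profile_mass b)%:E)%E.
Proof.
move=> b1 A0; rewrite (ge0_integral_scale A0); last 2 first.
- apply/measurable_EFinP; apply: (measurableT_comp (measurable_powR _)).
  by apply: measurable_funD => //; exact: measurable_funX.
- by move=> x; rewrite lee_fin powR_ge0.
rewrite EFinM -(integral_profile b1) -ge0_integralZl//.
- apply: eq_integral => z _; rewrite -!EFinM; congr (_%:E); rewrite /profile.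
  rewrite (_ : A ^+ 2 + _ = A ^+ 2 * (1 + z ^+ 2)); last by ring.
  rewrite powRM ?sqr_ge0 ?(ltW (sqr1_gt0 _))// mulrAC; congr (_ * _).
  rewrite -powR_mulrn ?ltW// -powRrM -[X in _ * X](powRr1 (ltW A0)) -powRD.
    by congr (_ `^ _); field.
  by rewrite (gt_eqF A0) implybT.
- apply/measurable_EFinP; apply: continuous_measurable_fun.
  exact: continuous_profile.
- by move=> z _; rewrite lee_fin ltW// profile_gt0.
- by rewrite lee_fin powR_ge0.
Qed.

(** The monotone map carrying rho/m to the probability density proportional to (A^2 + z^2)^(-b/2):
    the proportions of mass to the left of y and of its image agree, and A rescales the standard
    profile. *)
Definition transport b A m rho (y : R) : R :=
  A * quantile (profile b) (profile_mass b * (cumul rho y / m)).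

(** The mass balance rho/m = (target density at theta) theta', solved for theta'; the normalized
    target is (A^2 + z^2)^(-b/2) divided by A^(1 - b) [profile_mass b]. *)
Definition transport_deriv b A m rho (y : R) : R :=
  rho y / m * profile_mass b * A `^ (1 - b) *
  (A ^+ 2 + transport b A m rho y ^+ 2) `^ (b / 2).

Variables (b A : R) (rho : R -> R).
Hypotheses (b1 : 1 < b) (A0 : 0 < A).
Hypotheses (crho : continuous rho) (rho0 : forall x, 0 < rho x).
Hypothesis irho : mu.-integrable setT (EFin \o rho).
Let m : R := \int[mu]_y rho y.
Local Notation theta := (transport b A m rho).
Local Notation dtheta := (transport_deriv b A m rho).

Let m0 : 0 < m.
Proof. by have /andP[/lt_trans] := cumul_bounds crho rho0 irho 0; apply. Qed.

Let c0 : 0 < profile_mass b.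
Proof. exact: profile_mass_gt0. Qed.

Let inside y : 0 < profile_mass b * (cumul rho y / m) < \int[mu]_z profile b z.
Proof.
have /andP[h1 h2] := cumul_bounds crho rho0 irho y.
rewrite mulr_gt0 ?divr_gt0//=.
by rewrite -[X in _ < X]mulr1 ltr_pM2l// ltr_pdivrMr// mul1r.
Qed.

Lemma is_derive_transport (y : R) : is_derive y 1 theta (dtheta y).
Proof.
have h1 := is_derive_cumul crho irho y.
have h2 := is_derive_quantile (@continuous_profile _ b) (profile_gt0 b)
  (integrable_profile b1) (inside y).
have h3 : is_derive y 1 (fun y => profile_mass b * (cumul rho y / m))
    (profile_mass b * (rho y / m)).
  by apply: is_derive_eq; rewrite /GRing.scale/=; ring.
have h4 := @is_derive1_comp R (quantile (profile b))
  (fun y => profile_mass b * (cumul rho y / m)) _ _ _ h2 h3.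
have h5 := @is_deriveM R R (cst A) _ y 1 _ _ (is_derive_cst A y 1) h4.
rewrite /transport_deriv.
apply: (is_derive_eq h5).
rewrite /GRing.scale/= mulr0 addr0 /transport.
set q := quantile _ _.
rewrite (_ : A ^+ 2 + _ = A ^+ 2 * (1 + q ^+ 2)); last by ring.
rewrite powRM ?sqr_ge0 ?(ltW (sqr1_gt0 _))// /profile powRN invrK.
rewrite -(@powR_mulrn _ A 2) ?ltW// -powRrM (_ : 2 * (b / 2) = b); last by field.
rewrite (_ : A `^ (1 - b) = A / A `^ b); last first.
  by rewrite powRB ?powRr1 ?ltW// (gt_eqF A0) implybT.
by field; rewrite !gt_eqF// powR_gt0.
Qed.

Lemma transport_deriv_gt0 y : 0 < dtheta y.
Proof.
rewrite /transport_deriv !mulr_gt0 ?invr_gt0// ?powR_gt0//.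
by rewrite ltr_wpDr ?sqr_ge0// exprn_gt0.
Qed.

Lemma continuous_transport_deriv : continuous dtheta.
Proof.
have ct : continuous theta.
  by apply: derivable_continuous => z; case: (is_derive_transport z).
move=> y; apply: cvgM.
  by apply: cvgMl; apply: cvgMl; apply: cvgMl; exact: crho.
apply: (@continuous_powR_comp _ _ (fun y => A ^+ 2 + theta y ^+ 2)).
  by rewrite ltr_wpDr ?sqr_ge0// exprn_gt0.
apply: cvgD; first exact: cvg_cst.
by apply: (@continuous_comp _ _ _ theta (fun x => x ^+ 2)); [exact: ct|exact: exprn_continuous].
Qed.

Lemma ge0_integral_transport t (H : R -> \bar R) : 0 <= t ->
  measurable_fun [set: R] H -> (forall x, 0 <= H x)%E ->
  (\int[mu]_x H x =
   \int[mu]_y (H (y + t * theta y)%R * (1 + t * dtheta y)%:E))%E.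
Proof.
move=> t0 mH H0.
have dt (y : R) : is_derive y 1 (fun y => y + t * theta y) (1 + t * dtheta y).
  have h := is_derive_transport y.
  by apply: is_derive_eq; rewrite /GRing.scale/=; ring.
have incr := pos_derive_increasing is_derive_transport transport_deriv_gt0.
apply: (@ge0_integral_line_substitution _ (fun y => y + t * theta y)) => //.
- move=> y; apply: cvgD; first exact: cvg_cst.
  by apply: cvgMr; exact: continuous_transport_deriv.
- move=> y; rewrite ltr_wpDr// mulr_ge0// ltW//; exact: transport_deriv_gt0.
(* Since theta is increasing, t theta(y) >= t theta(0) for y >= 0, so y = M - t theta(0) is large
   enough, unless it is negative, when 0 serves. The minimum below is the mirror image. *)
- move=> M; exists (Num.max 0 (M - t * theta 0)).
  rewrite -lerBlDr.
  have h : t * theta 0 <= t * theta (Num.max 0 (M - t * theta 0)).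
    by apply: ler_wpM2l => //; rewrite (le_mono incr) le_max lexx.
  rewrite (le_trans (lerB (lexx M) h))// le_max lexx orbT//.
- move=> M; exists (Num.min 0 (M - t * theta 0)).
  rewrite -lerBrDr.
  have h : t * theta (Num.min 0 (M - t * theta 0)) <= t * theta 0.
    by apply: ler_wpM2l => //; rewrite (le_mono incr) ge_min lexx.
  by rewrite (le_trans _ (lerB (lexx M) h))// ge_min lexx orbT.
Qed.

End monotone_transport.

(** * Sections, marginals and an integrable weight *)

Section section_integrals.
Context d1 d2 (T1 : measurableType d1) (T2 : measurableType d2) (R : realType).
Variable m2 : {sigma_finite_measure set T2 -> \bar R}.

Lemma measurable_Rintegral_section (f : T1 -> T2 -> R) :
  measurable_fun setT (fun w : T1 * T2 => f w.1 w.2) ->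
  (forall x y, 0 <= f x y) ->
  measurable_fun setT (fun x => \int[m2]_y f x y).
Proof.
move=> mf f0; apply: (measurableT_comp (fine_measurable measurableT)).
apply: (@measurable_integral_section R _ _ _ _ m2 (fun x y => (f x y)%:E)).
  by apply/measurable_EFinP.
by move=> x y; rewrite lee_fin.
Qed.

End section_integrals.

Section row_vector_continuity.
Context (R : realType).
Local Notation mu := (@lebesgue_measure R).

Definition behead_rV n (x : 'rV[R]_n.+1) : 'rV[R]_n :=
  \row_j x ord0 (lift ord0 j).

Lemma behead_cons_rV n z (y : 'rV[R]_n) : behead_rV (cons_rV (z, y)) = y.
Proof. by apply/rowP => j; rewrite mxE cons_rV_lift. Qed.

Lemma cons_behead_rV n (x : 'rV[R]_n.+1) :
  cons_rV (x ord0 ord0, behead_rV x) = x.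
Proof.
apply/rowP => i; case: (unliftP ord0 i) => [j|] ->.
  by rewrite cons_rV_lift mxE.
by rewrite cons_rV0.
Qed.

Lemma measurable_behead_rV n :
  measurable_fun setT (@behead_rV n : 'rV[R]_n.+1 -> 'rV[R]_n).
Proof.
apply: measurable_fun_coordP => i; under eq_fun do rewrite mxE.
exact: measurable_coord.
Qed.

Lemma cons_rVD n z z' (y y' : 'rV[R]_n) t :
  cons_rV (z, y) + t *: cons_rV (z', y') = cons_rV (z + t * z', y + t *: y').
Proof.
apply/rowP => i; rewrite !mxE; case: (unliftP ord0 i) => [j|] _ //=.
by rewrite !mxE.
Qed.

Lemma continuous_consl n (y : 'rV[R]_n) : continuous (fun z : R => cons_rV (z, y)).
Proof.
apply: continuous_rV => i; case: (unliftP ord0 i) => [j|] -> z.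
  by under eq_fun do rewrite cons_rV_lift; exact: cvg_cst.
by under eq_fun do rewrite cons_rV0; exact: cvg_id.
Qed.

Lemma continuous_consr n (z : R) : continuous (fun y : 'rV[R]_n => cons_rV (z, y)).
Proof.
apply: continuous_rV => i; case: (unliftP ord0 i) => [j|] -> y.
  rewrite (_ : (fun _ => _) = fun y : 'rV[R]_n => y ord0 j).
    exact: coord_continuous.
  by apply/funext => x; rewrite cons_rV_lift.
rewrite (_ : (fun _ => _) = cst z); first exact: cst_continuous.
by apply/funext => x; rewrite cons_rV0.
Qed.

Lemma measurable_rVD d (T : measurableType d) n (f g : T -> 'rV[R]_n) t :
  measurable_fun setT f -> measurable_fun setT g ->
  measurable_fun setT (fun x => f x + t *: g x).
Proof.
move=> mf mg; apply: measurable_fun_coordP => i; under eq_fun do rewrite !mxE.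
apply: measurable_funD; first exact: measurableT_comp (measurable_coord i) mf.
by apply: measurable_funM; [exact: measurable_cst|exact: measurableT_comp (measurable_coord i) mg].
Qed.

Lemma measurable_prod_ord d (T : measurableType d) n (f : 'I_n -> T -> R) :
  (forall i, measurable_fun setT (f i)) ->
  measurable_fun setT (fun x => \prod_i f i x).
Proof.
elim: n f => [|n IH] f mf.
  by under eq_fun do rewrite big_ord0; exact: measurable_cst.
under eq_fun do rewrite big_ord_recl.
by apply: measurable_funM => //; exact: IH.
Qed.

Lemma continuous_prod_ord (T : topologicalType) n (f : 'I_n -> T -> R) :
  (forall i, continuous (f i)) -> continuous (fun x => \prod_i f i x).
Proof.
elim: n f => [|n IH] f cf x.
  by under eq_fun do rewrite big_ord0; exact: cst_continuous.
under eq_fun do rewrite big_ord_recl.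
by apply: cvgM; [exact: cf|exact: IH].
Qed.

Lemma integral_gt0_line (f : R -> \bar R) : measurable_fun [set: R] f ->
  (forall x, 0 < f x)%E -> (0 < \int[mu]_x f x)%E.
Proof.
move=> mf f0; rewrite lt_neqAle integral_ge0 ?andbT; last by move=> x _; exact/ltW.
apply/eqP => h.
have : (\int[mu]_x `|f x| = 0)%E.
  by rewrite h; apply: eq_integral => x _; rewrite gee0_abs// ltW.
move/ae_eq_integral_abs => /(_ measurableT mf)[N [mN N0 sub]].
have : (mu setT <= mu N)%E.
  by apply: le_measure; rewrite ?inE// => x _; apply: sub => /(_ Logic.I)/eqP;
    rewrite gt_eqF// f0.
by rewrite N0 -set_itvNyy lebesgue_measure_itv.
Qed.

Lemma integral_gt0_leb n (f : 'rV[R]_n -> \bar R) : measurable_fun setT f ->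
  (forall x, 0 < f x)%E -> (0 < \int[leb R n]_x f x)%E.
Proof.
elim: n f => [|n IH] f mf f0.
  by rewrite (ge0_integral_leb0 (fun x => ltW (f0 x)) mf).
rewrite (ge0_integral_cons mf (fun x => ltW (f0 x))).
have mfc z : measurable_fun setT (fun y : 'rV[R]_n => f (cons_rV (z, y))).
  by apply: (measurableT_comp mf); exact: measurable_cons_rVP.
apply: integral_gt0_line; last by move=> z; exact: IH.
apply: (@measurable_integral_section R _ _ _ _ (leb R n)
  (fun (z : measurableTypeR R) y => f (cons_rV (z, y)))).
  by apply: (measurableT_comp mf); exact: measurable_cons_rVP.
by move=> *; exact/ltW.
Qed.

(** The reference weight for all dominations. Being a product of one-dimensional profiles, it passes
    to sections in one coordinate, so that a bound by it survives the induction on the dimension. It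
    is also the weight added to f^pstar to make it positive. *)
Definition tail_weight n (y : 'rV[R]_n) : R := \prod_i profile 2 (y ord0 i).

Lemma tail_weight_gt0 n (y : 'rV[R]_n) : 0 < tail_weight y.
Proof. by apply: prodr_gt0 => i _; exact: profile_gt0. Qed.

Lemma continuous_tail_weight n : continuous (@tail_weight n).
Proof.
apply: continuous_prod_ord => i.
move=> y; apply: (@continuous_comp _ _ _ (fun y : 'rV[R]_n => y ord0 i)).
  exact: coord_continuous.
exact: continuous_profile.
Qed.

Lemma tail_weight_cons n z (y : 'rV[R]_n) :
  tail_weight (cons_rV (z, y)) = profile 2 z * tail_weight y.
Proof.
rewrite /tail_weight big_ord_recl cons_rV0; congr (_ * _).
by apply: eq_bigr => i _; rewrite cons_rV_lift.
Qed.

Lemma integral_tail_weight n :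
  (\int[leb R n]_y (tail_weight y)%:E < +oo)%E.
Proof.
have p2 : (1 < 2 :> R) by rewrite ltr1n.
have mw m : measurable_fun setT (fun y : 'rV[R]_m => (tail_weight y)%:E).
  by apply/measurable_EFinP; apply: continuous_measurable_rV;
    exact: continuous_tail_weight.
have w0 m (y : 'rV[R]_m) : (0 <= (tail_weight y)%:E)%E.
  by rewrite lee_fin ltW// tail_weight_gt0.
elim: n => [|n IH].
  by rewrite (ge0_integral_leb0 (@w0 0%N) (mw 0%N)) ltry.
rewrite (ge0_integral_cons (mw n.+1) (@w0 n.+1)).
rewrite [X in (X < _)%E](_ : _ = \int[mu]_z
    ((profile 2 z)%:E * \int[leb R n]_y (tail_weight y)%:E))%E; last first.
  apply: eq_integral => z _; rewrite -ge0_integralZl//.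
  - by apply: eq_integral => y _; rewrite tail_weight_cons.
  - exact: mw.
  - by rewrite lee_fin ltW// profile_gt0.
rewrite ge0_integralZr//.
- by rewrite integral_profile// lte_mul_pinfty// lee_fin ltW// profile_mass_gt0.
- apply/measurable_EFinP; apply: continuous_measurable_fun.
  exact: continuous_profile.
- by move=> z _; rewrite lee_fin ltW// profile_gt0.
- exact: integral_ge0.
Qed.

End row_vector_continuity.

Section marginal.
Context (R : realType).
Local Notation mu := (@lebesgue_measure R).

Lemma continuous_mulrl (T : topologicalType) (c : R) (f : T -> R) :
  continuous f -> continuous (fun x => c * f x).
Proof. by move=> cf x; apply: cvgMr; exact: cf. Qed.

Lemma integrable_tail_weight n C (f : 'rV[R]_n -> R) : continuous f ->
  (forall y, 0 < f y) -> (forall y, f y <= C * tail_weight y) ->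
  (leb R n).-integrable setT (EFin \o f).
Proof.
move=> cf f0 fC; apply/integrableP; split.
  by apply/measurable_EFinP; exact: continuous_measurable_rV.
have mw : measurable_fun setT (fun y : 'rV[R]_n => (tail_weight y)%:E).
  by apply/measurable_EFinP; apply: continuous_measurable_rV;
    exact: continuous_tail_weight.
have C0 : 0 <= C.
  rewrite -(pmulr_lge0 _ (tail_weight_gt0 (0 : 'rV[R]_n))).
  exact: le_trans (ltW (f0 _)) (fC _).
apply: (@le_lt_trans _ _ (\int[leb R n]_y (C%:E * (tail_weight y)%:E))%E).
  apply: ge0_le_integral => //.
  - apply/measurable_EFinP; apply: measurableT_comp => //.
    exact: continuous_measurable_rV.
  - by apply: emeasurable_funM => //; exact: measurable_cst.
  - by move=> y _ /=; rewrite -EFinM lee_fin ger0_norm// ltW.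
rewrite ge0_integralZl//.
- by rewrite lte_mul_pinfty ?lee_fin// integral_tail_weight.
- by move=> y _; rewrite lee_fin ltW// tail_weight_gt0.
Qed.

Definition marginal n (rho : 'rV[R]_n.+1 -> R) (z : R) : R :=
  \int[leb R n]_y rho (cons_rV (z, y)).

Variables (n : nat) (C : R) (rho : 'rV[R]_n.+1 -> R).
Hypotheses (crho : continuous rho) (rho0 : forall x, 0 < rho x).
Hypothesis rhoC : forall x, rho x <= C * tail_weight x.

Let C0 : 0 < C.
Proof.
rewrite -(pmulr_lgt0 _ (tail_weight_gt0 (0 : 'rV[R]_n.+1))).
exact: lt_le_trans (rho0 _) (rhoC _).
Qed.

Let csec z : continuous (fun y : 'rV[R]_n => rho (cons_rV (z, y))).
Proof.
move=> y; apply: (@continuous_comp _ _ _ (fun y : 'rV[R]_n => cons_rV (z, y)) rho).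
  exact: continuous_consr.
exact: crho.
Qed.

Lemma section_tail_weight z y :
  rho (cons_rV (z, y)) <= C * profile 2 z * tail_weight y.
Proof. by rewrite -mulrA -tail_weight_cons. Qed.

Let profile_le1 z : profile 2 z <= 1 :> R.
Proof.
rewrite /profile divff//; have h : (1 : R) <= 1 + z ^+ 2 by rewrite lerDl sqr_ge0.
by apply: (le_trans (powR_lower ltr01 h ler01)); rewrite powR1.
Qed.

Let isec z :
  (leb R n).-integrable setT (EFin \o (fun y => rho (cons_rV (z, y)))).
Proof.
apply: integrable_tail_weight; [exact: csec|by []|exact: section_tail_weight].
Qed.

Lemma marginalE z :
  (\int[leb R n]_y (rho (cons_rV (z, y)))%:E = (marginal rho z)%:E)%E.
Proof. by rewrite /marginal /Rintegral fineK//; exact: integrable_fin_num (isec z). Qed.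

Lemma marginal_gt0 z : 0 < marginal rho z.
Proof.
rewrite -lte_fin -marginalE; apply: integral_gt0_leb.
  by apply/measurable_EFinP; apply: continuous_measurable_rV; exact: csec.
by move=> x; rewrite lte_fin.
Qed.

(** Since [profile 2] is at most 1, the function [C * tail_weight] dominates all sections at once
    and allows passage to the limit under the integral. Continuity of the marginal is what makes its
    one-dimensional transport differentiable. *)
Lemma continuous_marginal : continuous (marginal rho).
Proof.
move=> z.
have := @continuity_under_integral R _ _ (leb R n)
  (fun z y => rho (cons_rV (z, y))) setT measurableT (z - 1) (z + 1) _ _
  (fun y => C * tail_weight y) _ _.
apply.
- by move=> x _; exact: isec.
- apply: aeW => y _ x _.
  apply: (@continuous_comp _ _ _ (fun z : R => cons_rV (z, y)) rho).
    exact: continuous_consl.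
  exact: crho.
- apply: (@integrable_tail_weight n C); last by [].
  + by apply: continuous_mulrl; exact: continuous_tail_weight.
  + by move=> y; rewrite mulr_gt0// tail_weight_gt0.
- move=> x _; apply: aeW => y _; rewrite ger0_norm; last exact: ltW.
  apply: (le_trans (section_tail_weight _ _)).
  rewrite ler_wpM2r ?(ltW (tail_weight_gt0 _))// ler_piMr//; exact: ltW.
- have h (r : R) : r - 1 < r < r + 1 by apply/andP; split; lra.
  by rewrite inE/= in_itv/=; exact: h.
Qed.

Let mrho : measurable_fun setT (fun x => (rho x)%:E).
Proof. by apply/measurable_EFinP; exact: continuous_measurable_rV. Qed.

Lemma integral_marginal :
  (\int[mu]_z (marginal rho z)%:E = (\int[leb R n.+1]_x rho x)%:E)%E.
Proof.
rewrite /Rintegral fineK; last first.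
  exact: integrable_fin_num (integrable_tail_weight crho rho0 rhoC).
rewrite (ge0_integral_cons mrho (fun x => ltW (rho0 x))).
by apply: eq_integral => z _; rewrite marginalE.
Qed.

Lemma Rintegral_marginal :
  \int[mu]_z marginal rho z = \int[leb R n.+1]_x rho x.
Proof. by rewrite {1}/Rintegral integral_marginal. Qed.

Lemma integrable_marginal : mu.-integrable setT (EFin \o marginal rho).
Proof.
apply/integrableP; split.
  by apply/measurable_EFinP; apply: continuous_measurable_fun;
    exact: continuous_marginal.
under eq_integral => z _ do rewrite /= ger0_norm ?(ltW (marginal_gt0 _))//.
by rewrite integral_marginal ltry.
Qed.

End marginal.

(** * The triangular transport map in any dimension *)

Section knothe.
Context (R : realType).
Local Notation mu := (@lebesgue_measure R).

(** The constant K of the overview, as the product obtained by integrating out one coordinate at a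
    time; [integral_radial] identifies it. *)
Definition profile_masses n (a : R) : R := \prod_(j < n) profile_mass (a - j%:R).

Lemma measurableT_comp2 d1 d2 d3 d4 (X : measurableType d1) (S : measurableType d2)
    (T : measurableType d3) (U : measurableType d4) (f : S -> T -> U)
    (u : X -> S) (v : X -> T) :
  measurable_fun setT (fun w : S * T => f w.1 w.2) ->
  measurable_fun setT u -> measurable_fun setT v ->
  measurable_fun setT (fun x => f (u x) (v x)).
Proof.
move=> mf mu' mv; apply: (measurableT_comp mf (g := fun x => (u x, v x))).
exact/measurable_fun_pairP.
Qed.

Lemma measurable_funV_ge0 d (T : measurableType d) (f : T -> R) :
  measurable_fun setT f -> (forall x, 0 <= f x) ->
  measurable_fun setT (fun x => (f x)^-1).
Proof.
move=> mf f0; rewrite (_ : (fun _ => _) = fun x => f x `^ (-1)).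
  exact: measurableT_comp (measurable_powR _) mf.
by apply/funext => x; rewrite powR_inv1.
Qed.

(** Joint measurability in the parameter and the variable is needed because each coordinate of the
    triangular map depends on the preceding ones through its parameter. *)
Lemma measurable_transport d (S : measurableType d) b (A m : S -> R)
    (rho : S -> R -> R) : 1 < b ->
  measurable_fun setT A -> measurable_fun setT m ->
  measurable_fun setT (fun w : S * measurableTypeR R => rho w.1 w.2) ->
  (forall s z, 0 <= rho s z) -> (forall s, 0 <= m s) ->
  measurable_fun setT
    (fun w : S * measurableTypeR R => transport b (A w.1) (m w.1) (rho w.1) w.2).
Proof.
move=> b1 mA mm mrho rho0 m0; rewrite /transport.
apply: measurable_funM; first exact: measurableT_comp mA measurable_fst.
apply: (measurableT_comp (measurable_quantile (@continuous_profile R b)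
  (@profile_gt0 R b) (integrable_profile b1))).
apply: measurable_funM; first exact: measurable_cst.
apply: measurable_funM; last first.
  by apply: measurable_funV_ge0 => //; exact: measurableT_comp mm measurable_fst.
(* The moving endpoint goes into the integrand, so that the cumulative distribution becomes an
   integral of sections over a fixed domain. *)
rewrite (_ : (fun _ => _) = fun w : S * measurableTypeR R =>
    \int[mu]_t (if t <= w.2 then rho w.1 t else 0)); last first.
  apply/funext => w; rewrite /cumul Rintegral_mkcond.
  by apply: eq_Rintegral => t _; rewrite patchE mem_setE in_itv/=.
apply: (@measurable_Rintegral_section _ _ _ _ _ mu
  (fun (w : S * measurableTypeR R) (t : measurableTypeR R) =>
     if t <= w.2 then rho w.1 t else 0)); last first.
  by move=> w t; case: ifP.
apply: measurable_fun_ifT; last exact: measurable_cst.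
  apply: measurable_fun_ler; first exact: measurable_snd.
  exact: measurableT_comp measurable_snd measurable_fst.
apply: (measurableT_comp2 mrho); last exact: measurable_snd.
exact: measurableT_comp measurable_fst measurable_fst.
Qed.

Lemma measurable_pair_rV d (S : measurableType d) n d' (T : measurableType d')
    (f : S -> 'rV[R]_n -> T) (s : S) :
  measurable_fun setT (fun w : S * 'rV[R]_n => f w.1 w.2) ->
  measurable_fun setT (f s).
Proof.
move=> mf; apply: (measurableT_comp2 mf (u := fun=> s) (v := id)).
  exact: measurable_cst.
exact: measurable_id.
Qed.

(* The triangular structure lets the change of variables be done one coordinate
   at a time; the first coordinate, already transported, becomes a parameter
   [s] of the remaining ones, and changes the scale [A] of their target. *)
Lemma knothe_map n (a : R) : n%:R < a ->
  forall d (S : measurableType d) (rho : S -> 'rV[R]_n -> R) (C A : S -> R),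
  measurable_fun setT (fun w : S * 'rV[R]_n => rho w.1 w.2) ->
  (forall s, continuous (rho s)) -> (forall s y, 0 < rho s y) ->
  (forall s y, rho s y <= C s * tail_weight y) ->
  measurable_fun setT A -> (forall s, 0 < A s) ->
  exists theta dtheta : S -> 'rV[R]_n -> 'rV[R]_n,
  [/\ measurable_fun setT (fun w : S * 'rV[R]_n => theta w.1 w.2),
      measurable_fun setT (fun w : S * 'rV[R]_n => dtheta w.1 w.2),
      forall s y i, 0 < dtheta s y ord0 i,
      forall s y, \prod_i dtheta s y ord0 i =
        rho s y / (\int[leb R n]_x rho s x) * profile_masses n a *
        A s `^ (n%:R - a) *
        (A s ^+ 2 + \sum_i theta s y ord0 i ^+ 2) `^ (a / 2) &
      forall s t (H : 'rV[R]_n -> \bar R), 0 <= t ->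
        measurable_fun setT H -> (forall x, 0 <= H x)%E ->
        (\int[leb R n]_x H x = \int[leb R n]_y
          (H (y + t *: theta s y)%R *
           (\prod_i (1 + t * dtheta s y ord0 i))%:E))%E].
Proof.
elim: n => [|n IH] na d S rho C A mrho crho rho0 rhoC mA A0.
  exists (fun _ _ => 0), (fun _ _ => 0); split.
  - exact: measurable_cst.
  - exact: measurable_cst.
  - by move=> s y [].
  - move=> s y; rewrite !big_ord0 /profile_masses big_ord0 addr0 mulr1 sub0r.
    have -> : \int[leb R 0]_x rho s x = rho s 0.
      rewrite /Rintegral ge0_integral_leb0//; first by move=> x; rewrite lee_fin ltW.
      by apply/measurable_EFinP; exact: continuous_measurable_rV.
    have -> : y = 0 by apply/rowP => -[].
    rewrite divff ?gt_eqF// mul1r -powR_mulrn ?ltW// -powRrM -powRD.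
      by rewrite (_ : _ + _ = 0) ?powRr0//; field.
    by rewrite (gt_eqF (A0 s)) implybT.
  - move=> s t H t0 mH H0; rewrite !ge0_integral_leb0//.
    + by rewrite scaler0 addr0 big_ord0 mule1.
    + by move=> x; rewrite big_ord0 mule1.
    + under eq_fun do rewrite scaler0 addr0 big_ord0 mule1.
      exact: mH.
have nn1 : n%:R < n.+1%:R :> R by rewrite ltr_nat.
have na' : n%:R < a by exact: lt_trans nn1 na.
have b1 : 1 < a - n%:R by move: na; rewrite -natr1; lra.
pose T := (S * measurableTypeR R)%type.
pose marg s := marginal (rho s).
pose m s : R := \int[leb R n.+1]_x rho s x.
(* In n + 1 coordinates the first marginal of (A^2 + |z|^2)^(-a/2) is proportional to (A^2 +
   z^2)^(-(a - n)/2), hence the exponent a - n. *)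
pose th1 s := transport (a - n%:R) (A s) (m s) (marg s).
pose dth1 s := transport_deriv (a - n%:R) (A s) (m s) (marg s).
have mE s : m s = \int[mu]_z marg s z.
  by rewrite /m -(Rintegral_marginal (crho s) (rho0 s) (rhoC s)).
have cmarg s : continuous (marg s).
  exact: continuous_marginal (crho s) (rho0 s) (rhoC s).
have marg0 s z : 0 < marg s z.
  exact: marginal_gt0 (crho s) (rho0 s) (rhoC s) z.
have imarg s : mu.-integrable setT (EFin \o marg s).
  exact: integrable_marginal (crho s) (rho0 s) (rhoC s).
have mm : measurable_fun setT m.
  apply: (@measurable_Rintegral_section _ _ _ _ _ (leb R n.+1) rho) => //.
  by move=> s x; exact: ltW.
have m_ge0 s : 0 <= m s by apply: Rintegral_ge0 => x _; exact: ltW.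
have mrho' : measurable_fun setT
    (fun w : T * 'rV[R]_n => rho w.1.1 (cons_rV (w.1.2, w.2))).
  apply: (measurableT_comp2 mrho).
    exact: measurableT_comp measurable_fst measurable_fst.
  apply: measurable_cons_rVP; last exact: measurable_snd.
  exact: measurableT_comp measurable_snd measurable_fst.
have mmarg : measurable_fun setT (fun w : T => marg w.1 w.2).
  apply: (@measurable_Rintegral_section _ _ _ _ _ (leb R n)
    (fun (w : T) y => rho w.1 (cons_rV (w.2, y)))) => //.
  by move=> s x; exact: ltW.
have mth1 : measurable_fun setT (fun w : T => th1 w.1 w.2).
  by apply: measurable_transport => // s z; exact: ltW.
(* Once the first coordinate is known, A^2 + |theta|^2 is (A^2 + th1^2) plus the squares of the
   others, so this root is the scale of the remaining problem. *)
pose A' (w : T) : R := Num.sqrt (A w.1 ^+ 2 + th1 w.1 w.2 ^+ 2).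
have A2 (w : T) : 0 < A w.1 ^+ 2 + th1 w.1 w.2 ^+ 2.
  by rewrite ltr_wpDr ?sqr_ge0// exprn_gt0.
have mA2 : measurable_fun setT (fun w : T => A w.1 ^+ 2 + th1 w.1 w.2 ^+ 2).
  apply: measurable_funD; apply: measurable_funX => //.
  exact: measurableT_comp mA measurable_fst.
have mA' : measurable_fun setT A'.
  apply: measurableT_comp mA2.
  by apply: continuous_measurable_fun; exact: sqrt_continuous.
have mdth1 : measurable_fun setT (fun w : T => dth1 w.1 w.2).
  have mAf : measurable_fun setT (fun w : T => A w.1).
    exact: measurableT_comp mA measurable_fst.
  rewrite /dth1 /transport_deriv; apply: measurable_funM.
    apply: measurable_funM; last exact: measurableT_comp (measurable_powR _) mAf.
    apply: measurable_funM; last exact: measurable_cst.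
    apply: measurable_funM => //.
    apply: measurable_funV_ge0; last by move=> w; exact: m_ge0.
    exact: measurableT_comp mm measurable_fst.
  exact: measurableT_comp (measurable_powR _) mA2.
have [||||||th' [dth' [mth' mdth' dth0 dthE dthI]]] := IH na' _ T
  (fun w y => rho w.1 (cons_rV (w.2, y))) (fun w => C w.1 * profile 2 w.2) A'.
- exact: mrho'.
- move=> w y; apply: (@continuous_comp _ _ _ (fun y => cons_rV (w.2, y)) (rho w.1)).
    exact: continuous_consr.
  exact: crho.
- by [].
- by move=> w y; exact: (section_tail_weight (rhoC w.1)).
- exact: mA'.
- by move=> w; rewrite sqrtr_gt0.
have mpair : measurable_fun setT
    (fun w : S * 'rV[R]_n.+1 => ((w.1, w.2 ord0 ord0), behead_rV w.2) : T * 'rV[R]_n).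
  apply/measurable_fun_pairP; split.
    apply/measurable_fun_pairP; split; first exact: measurable_fst.
    exact: measurableT_comp (measurable_coord ord0) measurable_snd.
  exact: measurableT_comp (@measurable_behead_rV R n) measurable_snd.
have mhd : measurable_fun setT (fun w : S * 'rV[R]_n.+1 => (w.1, w.2 ord0 ord0) : T).
  exact: measurableT_comp measurable_fst mpair.
pose theta s (x : 'rV[R]_n.+1) := cons_rV (th1 s (x ord0 ord0),
  th' (s, x ord0 ord0) (behead_rV x)).
pose dtheta s (x : 'rV[R]_n.+1) := cons_rV (dth1 s (x ord0 ord0),
  dth' (s, x ord0 ord0) (behead_rV x)).
have mtheta : measurable_fun setT (fun w : S * 'rV[R]_n.+1 => theta w.1 w.2).
  apply: measurable_cons_rVP; first exact: (measurableT_comp mth1 mhd).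
  exact: (measurableT_comp mth' mpair).
have mdtheta : measurable_fun setT (fun w : S * 'rV[R]_n.+1 => dtheta w.1 w.2).
  apply: measurable_cons_rVP; first exact: (measurableT_comp mdth1 mhd).
  exact: (measurableT_comp mdth' mpair).
exists theta, dtheta; split => //.
- move=> s y i; rewrite /dtheta; case: (unliftP ord0 i) => [j|] ->.
    by rewrite cons_rV_lift.
  rewrite cons_rV0 /dth1 mE; apply: transport_deriv_gt0 => //.
- move=> s y; rewrite big_ord_recl [in RHS]big_ord_recl /dtheta /theta !cons_rV0.
  under eq_bigr do rewrite cons_rV_lift.
  under [in RHS]eq_bigr do rewrite cons_rV_lift.
  rewrite dthE /= cons_behead_rV.
  rewrite -/(marginal (rho s) (y ord0 ord0)) -/(marg s (y ord0 ord0)).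
  rewrite /A' sqr_sqrtr ?(ltW (A2 (s, _)))//= addrA.
  rewrite /dth1 /transport_deriv -/(th1 s (y ord0 ord0)) -/(m s).
  rewrite /profile_masses big_ord_recr/=.
  set B := A s ^+ 2 + th1 s _ ^+ 2.
  have B0 : 0 < B by exact: (A2 (s, y ord0 ord0)).
  (* The remaining coordinates contribute B^(-(a - n)/2) and the first derivative contributes B^((a
     - n)/2). The intermediate scale cancels, as does the marginal. *)
  have -> : Num.sqrt B `^ (n%:R - a) = (B `^ ((a - n%:R) / 2))^-1.
    by rewrite -powR12_sqrt ?ltW// -powRrM -powRN; congr (_ `^ _); field.
  have -> : 1 - (a - n%:R) = n.+1%:R - a by rewrite -natr1; ring.
  have Bp : B `^ ((a - n%:R) / 2) != 0 by rewrite gt_eqF// powR_gt0.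
  have mp : marg s (y ord0 ord0) != 0 by rewrite gt_eqF.
  have m0 : m s != 0.
    rewrite mE gt_eqF// -lte_fin.
    rewrite /Rintegral fineK; last exact: integrable_fin_num (imarg s).
    apply: integral_gt0_line; last by move=> x; rewrite lte_fin.
    by apply/measurable_EFinP; exact: continuous_measurable_fun.
  by field; rewrite m0 mp Bp.
- move=> s t H t0 mH H0.
  have mHz z : measurable_fun setT (fun y : 'rV[R]_n => H (cons_rV (z, y))).
    by apply: (measurableT_comp mH); exact: measurable_cons_rVP.
  have p0 x : (0 <= (\prod_i (1 + t * dtheta s x ord0 i))%:E)%E.
    rewrite lee_fin; apply: prodr_ge0 => i _; rewrite addr_ge0// mulr_ge0//.
    rewrite /dtheta; case: (unliftP ord0 i) => [j|] ->.
      by rewrite cons_rV_lift ltW.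
    rewrite cons_rV0 /dth1 mE ltW//; exact: transport_deriv_gt0.
  have mF : measurable_fun setT (fun y : 'rV[R]_n.+1 => H (y + t *: theta s y)%R *
      (\prod_i (1 + t * dtheta s y ord0 i))%:E)%E.
    apply: emeasurable_funM.
      apply: (measurableT_comp mH); apply: measurable_rVD; first exact: measurable_id.
      exact: measurable_pair_rV mtheta.
    apply/measurable_EFinP; apply: measurable_prod_ord => i.
    apply: measurable_funD; first exact: measurable_cst.
    apply: measurable_funM; first exact: measurable_cst.
    apply: measurableT_comp (measurable_coord i) _.
    exact: measurable_pair_rV mdtheta.
  rewrite (ge0_integral_cons mH H0) (ge0_integral_cons mF); last first.
    by move=> x; exact: mule_ge0.
  (* The first coordinate is substituted under the inner integral; the induction hypothesis at the
     parameter (s, z) then substitutes the others, and the two Jacobians multiply. *)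
  rewrite (@ge0_integral_transport R _ _ _ b1 (A0 s) (cmarg s) (marg0 s) (imarg s) t
    (fun z => \int[leb R n]_y H (cons_rV (z, y)))%E t0); last 2 first.
  + apply: (@measurable_integral_section R _ _ _ _ (leb R n)
      (fun (z : measurableTypeR R) y => H (cons_rV (z, y)))) => //.
    by apply: (measurableT_comp mH); exact: measurable_cons_rVP.
  + by move=> z; exact: integral_ge0.
  apply: eq_integral => z _; rewrite -mE -/(th1 s z) -/(dth1 s z).
  rewrite (dthI (s, z) t (fun y => H (cons_rV (z + t * th1 s z, y))))//.
  rewrite -ge0_integralZr//.
  + apply: eq_integral => y _; rewrite -muleA -EFinM.
    rewrite /theta /dtheta cons_rV0 behead_cons_rV cons_rVD; congr (_ * _%:E)%E.
    rewrite [in RHS]big_ord_recl cons_rV0 mulrC; congr (_ * _).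
    by apply: eq_bigr => i _; rewrite cons_rV_lift.
  + apply: emeasurable_funM.
      apply: (measurableT_comp (mHz _)); apply: measurable_rVD; first exact: measurable_id.
      exact: (@measurable_pair_rV _ T _ _ _ th' (s, z) mth').
    apply/measurable_EFinP; apply: measurable_prod_ord => i.
    apply: measurable_funD; first exact: measurable_cst.
    apply: measurable_funM; first exact: measurable_cst.
    apply: measurableT_comp (measurable_coord i) _.
    exact: (@measurable_pair_rV _ T _ _ _ dth' (s, z) mdth').
  + move=> y _; apply: mule_ge0 => //; rewrite lee_fin; apply: prodr_ge0 => i _.
    by rewrite addr_ge0// mulr_ge0// ltW.
  + rewrite lee_fin addr_ge0// mulr_ge0// /dth1 mE ltW//.
    exact: transport_deriv_gt0.
Qed.

End knothe.

(** * The sharp trace inequality for C^1 functions of bounded support *)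

Section euclidean_norm.
Context (R : realType) (N : nat).
Implicit Types x y : 'rV[R]_N.

Lemma enorm_ge0 x : 0 <= enorm x. Proof. exact: sqrtr_ge0. Qed.

Let sumsq_ge0 x : 0 <= \sum_i x ord0 i ^+ 2.
Proof. by apply: sumr_ge0 => i _; exact: sqr_ge0. Qed.

Lemma sqr_enorm x : enorm x ^+ 2 = \sum_i x ord0 i ^+ 2.
Proof. by rewrite sqr_sqrtr. Qed.

Lemma enorm_eq0 x : enorm x = 0 -> forall i, x ord0 i = 0.
Proof.
move=> x0 i; have : \sum_i x ord0 i ^+ 2 = 0 by rewrite -sqr_enorm x0 expr0n.
move/eqP; rewrite psumr_eq0 => [|j _]; last exact: sqr_ge0.
by move/allP => /(_ i (mem_index_enum _)) /=; rewrite sqrf_eq0 => /eqP.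
Qed.

Lemma cauchy_schwarz x y :
  `|\sum_i x ord0 i * y ord0 i| <= enorm x * enorm y.
Proof.
have [x0|x0] := eqVneq (enorm x) 0.
  rewrite x0 mul0r big1 ?normr0// => i _; by rewrite (enorm_eq0 x0) mul0r.
have [y0|y0] := eqVneq (enorm y) 0.
  rewrite y0 mulr0 big1 ?normr0// => i _; by rewrite (enorm_eq0 y0) mulr0.
have {}x0 : 0 < enorm x by rewrite lt_neqAle eq_sym x0 enorm_ge0.
have {}y0 : 0 < enorm y by rewrite lt_neqAle eq_sym y0 enorm_ge0.
have h (s : R) : s ^+ 2 = 1 ->
    s * \sum_i x ord0 i * y ord0 i <= enorm x * enorm y.
  move=> s1; rewrite -subr_ge0.
  rewrite (_ : _ - _ = (enorm x * enorm y / 2) *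
     \sum_i (x ord0 i / enorm x - s * y ord0 i / enorm y) ^+ 2).
    by rewrite mulr_ge0 ?divr_ge0 ?mulr_ge0 ?enorm_ge0// sumr_ge0// => i _; exact: sqr_ge0.
  rewrite [X in _ = _ * X](eq_bigr (fun i => (enorm x)^-2 * (x ord0 i) ^+ 2 +
     ((enorm y)^-2 * (y ord0 i) ^+ 2 -
     2 * s / (enorm x * enorm y) * (x ord0 i * y ord0 i)))); last first.
    move=> i _; rewrite (_ : y ord0 i ^+ 2 = s ^+ 2 * y ord0 i ^+ 2); last by rewrite s1 mul1r.
    by field; rewrite !gt_eqF.
  rewrite !big_split/= sumrN -!mulr_sumr -!sqr_enorm.
  by field; rewrite !gt_eqF.
rewrite ler_norml; apply/andP; split.
  by rewrite lerNl -mulN1r; apply: h; rewrite sqrrN expr1n.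
by rewrite -[leLHS]mul1r; apply: h; rewrite expr1n.
Qed.

Lemma enormD x y : enorm (x + y) <= enorm x + enorm y.
Proof.
rewrite -(@ler_pXn2r _ 2) ?nnegrE ?addr_ge0 ?enorm_ge0//.
rewrite sqr_enorm sqrrD !sqr_enorm.
under eq_bigr do rewrite mxE sqrrD.
rewrite !big_split/= lerD2r lerD2l mulr2n; apply: lerD;
  exact: le_trans (ler_norm _) (cauchy_schwarz x y).
Qed.

Lemma enorm_le_sum x : enorm x <= \sum_i `|x ord0 i|.
Proof.
have s0 : 0 <= \sum_i `|x ord0 i| by apply: sumr_ge0.
rewrite -[leRHS](ger0_norm s0) -sqrtr_sqr ler_sqrt ?sqr_ge0//.
rewrite expr2 mulr_suml; apply: ler_sum => i _.
rewrite -real_normK ?num_real// expr2; apply: ler_wpM2l => //.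
by rewrite (bigD1 i)//= lerDl; apply: sumr_ge0.
Qed.

Lemma continuous_enorm : continuous (@enorm R N).
Proof.
move=> x; apply: (@continuous_comp _ _ _ (fun x : 'rV[R]_N => \sum_i x ord0 i ^+ 2)
  Num.sqrt); last exact: sqrt_continuous.
have h m (T : topologicalType) (f : 'I_m -> T -> R) : (forall i, continuous (f i)) ->
    continuous (fun z => \sum_i f i z).
  elim: m f => [|m IH] f cf z.
    by under eq_fun do rewrite big_ord0; exact: cst_continuous.
  by under eq_fun do rewrite big_ord_recl; apply: cvgD; [exact: cf|exact: IH].
suff hc : continuous (fun z : 'rV[R]_N => \sum_i z ord0 i ^+ 2) by exact: hc.
apply: (h N 'rV[R]_N (fun i (z : 'rV[R]_N) => z ord0 i ^+ 2)) => i y.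
apply: (@continuous_comp _ _ _ (fun x : 'rV[R]_N => x ord0 i) (fun z => z ^+ 2)).
  exact: coord_continuous.
exact: exprn_continuous.
Qed.

Lemma measurable_enorm : measurable_fun setT (@enorm R N).
Proof. exact: continuous_measurable_rV continuous_enorm. Qed.

End euclidean_norm.

(** * Functions of class C^1 *)

Section C1_functions.
Context (R : realType).

Definition C1 n (u : 'rV[R]_n -> R) : Prop :=
  (forall i, continuous (partial i u)) /\
  (forall i x, derivable u x (delta_mx ord0 i)).

Lemma is_derive_line n (u : 'rV[R]_n -> R) x v (t : R) l :
  is_derive (x + t *: v) v u l -> is_derive t 1 (fun s : R => u (x + s *: v)) l.
Proof.
move=> [du Du].
have E : (fun h : R => h^-1 *: (((fun s : R => u (x + s *: v)) \o shift t) (h *: (1 : R)) -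
      u (x + t *: v))) =
    (fun h : R => h^-1 *: ((u \o shift (x + t *: v)) (h *: v) - u (x + t *: v))).
  apply/funext => h /=; congr (_ *: (u _ - _)).
  have -> : h *: (1 : R) = h by exact: mulr1.
  by rewrite scalerDl addrCA.
split; first by rewrite /derivable E; exact: du.
by rewrite /derive E; exact: Du.
Qed.

Variables (n : nat) (u : 'rV[R]_n -> R).
Hypothesis C1u : C1 u.

Lemma is_derive_partial (x : 'rV[R]_n) i : is_derive x (delta_mx ord0 i) u (partial i u x).
Proof. by split=> //; case: C1u => _; exact. Qed.

Lemma mean_value_coord (x : 'rV[R]_n) i (c : R) : exists2 s : R, `|s| <= `|c| &
  u (x + c *: delta_mx ord0 i) - u x = c * partial i u (x + s *: delta_mx ord0 i).
Proof.
pose g (s : R) := u (x + s *: delta_mx ord0 i).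
have dg (s : R) : is_derive s 1 g (partial i u (x + s *: delta_mx ord0 i)).
  exact/is_derive_line/is_derive_partial.
have cg : continuous g by apply: derivable_continuous => s; case: (dg s).
have g0 : g 0 = u x by rewrite /g scale0r addr0.
have [c0|c0|c0] := ltgtP c 0.
- have [|s] := @MVT _ _ _ c 0 c0 (fun s _ => dg s); first exact: continuous_subspaceT.
  rewrite in_itv/= => /andP[cs s0] E; exists s.
    by rewrite !ltr0_norm// lerN2 ltW.
  by rewrite -g0 -/(g c) -opprB E sub0r mulrN opprK mulrC.
- have [|s] := @MVT _ _ _ 0 c c0 (fun s _ => dg s); first exact: continuous_subspaceT.
  rewrite in_itv/= => /andP[s0 sc] E; exists s.
    by rewrite !gtr0_norm// ltW.
  by rewrite -g0 -/(g c) E subr0 mulrC.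
- by exists 0; rewrite ?c0// scale0r addr0 subrr mul0r.
Qed.

(** Telescoping along the axes: [W k] keeps the first k coordinates of w, the mean value theorem
    handles the passage from [W k] to [W k.+1], and continuity of the partial derivatives at x
    brings the intermediate point back to x. *)
Lemma C1_taylor (x : 'rV[R]_n) (e : R) : 0 < e -> exists2 d : R, 0 < d &
  forall w : 'rV[R]_n, (forall i, `|w ord0 i| < d) ->
  `|u (x + w) - u x - \sum_i w ord0 i * partial i u x| <= e * \sum_i `|w ord0 i|.
Proof.
move=> e0.
have : \forall y \near x, forall i, `|partial i u x - partial i u y| < e.
  apply: (@filter_forall _ _ (fun i y => `|partial i u x - partial i u y| < e)
    (nbhs x)) => i.
  by have /cvgrPdist_lt := C1u.1 i x; exact.
move/nbhs_ballP => [d d0 hd]; exists d => // w wd.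
pose W k : 'rV[R]_n := \row_i (if (i < k)%N then w ord0 i else 0).
have WS k (kn : (k < n)%N) :
    W k.+1 = W k + w ord0 (Ordinal kn) *: delta_mx ord0 (Ordinal kn).
  apply/rowP => i; rewrite !mxE eqxx/= ltnS leq_eqVlt.
  have -> : (i == Ordinal kn) = (i == k :> nat) by [].
  case: eqP => [ik|_]; last by rewrite mulr0 addr0.
  by rewrite ik ltnn add0r mulr1; congr (w _ _); exact: val_inj.
have sumS k (kn : (k < n)%N) (F : 'I_n -> R) :
    \sum_(i < n | (i < k.+1)%N) F i = F (Ordinal kn) + \sum_(i < n | (i < k)%N) F i.
  rewrite (bigD1 (Ordinal kn))//=; congr (_ + _); apply: eq_bigl => i.
  by rewrite ltnS leq_eqVlt -val_eqE/=; case: eqP => [->|_]; rewrite ?ltnn ?andbT.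
suff h k : (k <= n)%N ->
    `|u (x + W k) - u x - \sum_(i < n | (i < k)%N) w ord0 i * partial i u x|
    <= e * \sum_(i < n | (i < k)%N) `|w ord0 i|.
  have := h n (leqnn n).
  have -> : W n = w by apply/rowP => i; rewrite mxE ltn_ord.
  have bE (F : 'I_n -> R) : \sum_(i < n | (i < n)%N) F i = \sum_i F i.
    by apply: eq_bigl => i; rewrite ltn_ord.
  by rewrite !bE.
elim: k => [_|k IH kn].
  have -> : W 0%N = 0 by apply/rowP => i; rewrite !mxE.
  by rewrite !big_pred0// addr0 !subrr normr0 mulr0.
have {}IH := IH (ltnW kn).
rewrite !(sumS _ kn) WS addrA.
set o := Ordinal kn; have [s sw sE] := mean_value_coord (x + W k) o (w ord0 o).
have hs : `|partial o u x - partial o u (x + W k + s *: delta_mx ord0 o)| < e.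
  apply: hd; apply/ball_rVP => // i; rewrite !mxE eqxx/=.
  rewrite opprD opprD addrA addrA subrr add0r -opprD normrN.
  have -> : (i == o) = (i == k :> nat) by [].
  case: eqP => [ik|_]; last first.
    by rewrite mulr0 addr0; case: ifP => // _; rewrite normr0.
  by rewrite ik ltnn add0r mulr1 (le_lt_trans sw).
set P := partial o u _ in sE hs.
rewrite (_ : _ - _ = (u (x + W k) - u x -
    \sum_(i < n | (i < k)%N) w ord0 i * partial i u x) +
    w ord0 o * (P - partial o u x)).
  rewrite [leRHS]mulrDr [leRHS]addrC; apply: (le_trans (ler_normD _ _)); apply: lerD => //.
  rewrite normrM mulrC ler_wpM2r// distrC; exact: ltW.
by rewrite -[u (_ + _ *: _)](subrK (u (x + W k))) sE; ring.
Qed.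

(** The gradient is made of derivatives along the axes, whereas the rays of the proof are oblique;
    this lemma bridges the two. *)
Lemma C1_is_derive (x v : 'rV[R]_n) : is_derive x v u (\sum_i v ord0 i * partial i u x).
Proof.
set l := \sum_i _.
suff cvgl : h^-1 *: ((u \o shift x) (h *: v) - u x) @[h --> 0^'] --> l.
  by split; [apply/cvg_ex; exists l|exact/cvg_lim].
apply/cvgrPdist_le => e e0.
pose S := 1 + \sum_i `|v ord0 i|.
have S0 : 0 < S by rewrite ltr_wpDr// sumr_ge0.
have [d d0 hd] := C1_taylor x (divr_gt0 e0 S0).
near=> h.
have h0 : h != 0 by near: h; exact: nbhs_dnbhs_neq.
have hdS : `|h| < d / S by near: h; apply: dnbhs0_lt; exact: divr_gt0.
have vS i : `|v ord0 i| <= S.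
  rewrite /S (bigD1 i)//= addrCA lerDl addr_ge0// sumr_ge0//.
have := hd (h *: v) _.
have -> : \sum_i (h *: v) ord0 i * partial i u x = h * l.
  by rewrite mulr_sumr; apply: eq_bigr => i _; rewrite mxE mulrA.
have -> : \sum_i `|(h *: v) ord0 i| = `|h| * \sum_i `|v ord0 i|.
  by rewrite mulr_sumr; apply: eq_bigr => i _; rewrite mxE normrM.
move=> H; rewrite /= distrC.
have -> : h^-1 *: (u (h *: v + x) - u x) - l =
    h^-1 * (u (x + h *: v) - u x - h * l).
  by rewrite [h *: v + x]addrC [RHS]mulrBr mulKf.
rewrite normrM normfV ler_pdivrMl ?normr_gt0//.
apply: (le_trans (H _)).
  move=> i; rewrite mxE normrM; apply: (le_lt_trans (ler_wpM2l _ (vS i))) => //.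
  by rewrite -ltr_pdivlMr.
rewrite mulrCA; apply: ler_wpM2l => //.
rewrite mulrAC ler_pdivrMr//; apply: ler_wpM2l; first exact: ltW.
by rewrite /S lerDr.
Unshelve. all: by end_near. Qed.

Lemma C1_continuous : continuous u.
Proof.
suff h (x : 'rV[R]_n) : {for x, continuous u} by move=> x; exact: h.
apply/(@cvgrPdist_le _ _ _ (nbhs x)) => e e0.
pose S := 1 + \sum_i `|partial i u x| + n%:R.
have S0 : 0 < S by rewrite ltr_wpDr// ltr_wpDr// sumr_ge0.
have [d d0 hd] := C1_taylor x ltr01.
have m0 : 0 < Num.min d (e / S) by rewrite lt_min d0 divr_gt0.
near=> y.
have yx : ball x (Num.min d (e / S)) y by near: y; exact: nbhsx_ballx.
have {}yx i : `|(y - x) ord0 i| < Num.min d (e / S).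
  by rewrite !mxE distrC; move/ball_rVP : yx; exact.
have H := hd (y - x); rewrite [x + (y - x)]addrC subrK in H.
rewrite distrC -[u y - u x](subrK (\sum_i (y - x) ord0 i * partial i u x)).
apply: (le_trans (ler_normD _ _)).
have yx2 i : `|(y - x) ord0 i| <= e / S.
  by apply: (le_trans (ltW (yx i))); rewrite ge_min lexx orbT.
apply: (@le_trans _ _ (e / S * n%:R + e / S * \sum_i `|partial i u x|)).
  apply: lerD.
    apply: (le_trans (H _)).
      by move=> i; apply: (lt_le_trans (yx i)); rewrite ge_min lexx.
    rewrite mul1r; apply: (le_trans (ler_sum _ (fun i _ => yx2 i))).
    by rewrite sumr_const card_ord mulr_natr.
  apply: (le_trans (ler_norm_sum _ _ _)); rewrite mulr_sumr.
  by apply: ler_sum => i _; rewrite normrM ler_wpM2r.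
rewrite -mulrDr mulrAC ler_pdivrMr// ler_wpM2l ?(ltW e0)//.
rewrite /S; lra.
Unshelve. all: by end_near. Qed.

End C1_functions.

(** * Integration over the half-space *)

Section half_space_integrals.
Context (R : realType).
Local Notation mu := (@lebesgue_measure R).

Lemma half_space_snoc n (y : 'rV[R]_n) t :
  (snoc_rV y t \in @half_space R n.+1) = (0 < t).
Proof.
apply/idP/idP => [|t0]; last by rewrite inE => i /(@snoc_rV_last _ _ y t) ->.
by rewrite inE => /(_ ord_max erefl); rewrite snoc_rV_max.
Qed.

Lemma measurable_half_space n : measurable (@half_space R n.+1).
Proof.
rewrite (_ : @half_space R n.+1 = (fun x : 'rV[R]_n.+1 => x ord0 ord_max) @^-1` `]0, +oo[).
  rewrite -[X in measurable X]setTI.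
  by apply: (@measurable_coord _ _ n.+1 ord_max); [exact: measurableT|exact: measurable_itv].
apply/seteqP; split => x /=; rewrite in_itv/= andbT.
  exact.
by move=> x0 i [ii]; rewrite (_ : i = ord_max)//; exact: val_inj.
Qed.

Lemma measurable_patch0 d (T : measurableType d) (D : set T) (f : T -> \bar R) :
  measurable D -> measurable_fun setT f -> measurable_fun setT (f \_ D).
Proof.
move=> mD mf; rewrite (_ : f \_ D = fun x => if x \in D then f x else 0%E)//.
apply: measurable_fun_ifT => //.
apply: (measurable_fun_bool true).
rewrite setTI (_ : _ @^-1` _ = D)//.
by apply/seteqP; split => w /=; [exact: set_mem|exact: mem_set].
Qed.

(** The heights range over the closed half-line, which differs from the open one by a null set, to
    agree with the integrals along the rays. *)
Lemma ge0_integral_half_space n (F : 'rV[R]_n.+1 -> \bar R) :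
  measurable_fun setT F -> (forall x, 0 <= F x)%E ->
  (\int[leb R n.+1]_(x in @half_space R n.+1) F x =
   \int[mu]_(t in `[0%R, +oo[) \int[leb R n]_y F (snoc_rV y t))%E.
Proof.
move=> mF F0.
have mFs : measurable_fun setT
    (fun w : measurableTypeR R * 'rV[R]_n => F (snoc_rV w.2 w.1)).
  apply: (measurableT_comp mF); apply: measurable_snoc_rVP.
    exact: measurable_snd.
  exact: measurable_fst.
rewrite -integral_itv_obnd_cbnd; last first.
  apply: measurable_funTS.
  exact: (@measurable_integral_section R _ _ _ _ (leb R n)
    (fun (t : measurableTypeR R) y => F (snoc_rV y t))).
rewrite integral_mkcond [RHS]integral_mkcond.
have mFp : measurable_fun setT (F \_ (@half_space R n.+1)).
  exact: measurable_patch0 (@measurable_half_space n) mF.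
have Fp0 x : (0 <= (F \_ (@half_space R n.+1)) x)%E by rewrite patchE; case: ifP.
rewrite (ge0_integral_snoc mFp Fp0); apply: eq_integral => t _.
rewrite patchE mem_setE in_itv/= andbT; case: ifPn => t0.
  by apply: eq_integral => y _; rewrite patchE half_space_snoc t0.
by apply: integral0_eq => y _; rewrite patchE half_space_snoc (negbTE t0).
Qed.

Lemma measurable_patch_snd d1 d2 (T1 : measurableType d1) (T2 : measurableType d2)
    (D : set T2) (f : T1 -> T2 -> \bar R) : measurable D ->
  measurable_fun setT (fun w : T1 * T2 => f w.1 w.2) ->
  measurable_fun setT (fun w : T1 * T2 => (f w.1 \_ D) w.2).
Proof.
move=> mD mf.
rewrite (_ : (fun _ => _) = (fun w : T1 * T2 => f w.1 w.2) \_ (setT `*` D)).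
  by apply: measurable_patch0 => //; exact: measurableX.
apply/funext => w; rewrite !patchE; congr (if _ then _ else _).
apply/idP/idP => h; apply: mem_set; last by case: (set_mem h).
by split => //; exact: set_mem h.
Qed.

Lemma measurable_integral_section_in d1 d2 (T1 : measurableType d1)
    (T2 : measurableType d2) (m2 : {sigma_finite_measure set T2 -> \bar R})
    (D : set T2) (f : T1 -> T2 -> \bar R) : measurable D ->
  measurable_fun setT (fun w : T1 * T2 => f w.1 w.2) ->
  (forall x y, D y -> 0 <= f x y)%E ->
  measurable_fun setT (fun x => \int[m2]_(y in D) f x y)%E.
Proof.
move=> mD mf f0; under eq_fun do rewrite integral_mkcond.
apply: (@measurable_integral_section R _ _ _ _ m2 (fun x y => (f x \_ D) y)).
  exact: measurable_patch_snd.
by move=> x y; rewrite patchE; case: ifPn => // /set_mem; exact: f0.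
Qed.

Lemma tonelli_swap_in d1 d2 (T1 : measurableType d1) (T2 : measurableType d2)
    (m1 : {sigma_finite_measure set T1 -> \bar R})
    (m2 : {sigma_finite_measure set T2 -> \bar R}) (D : set T2)
    (f : T1 -> T2 -> \bar R) : measurable D ->
  measurable_fun setT (fun w : T1 * T2 => f w.1 w.2) ->
  (forall x y, D y -> 0 <= f x y)%E ->
  (\int[m1]_x \int[m2]_(y in D) f x y = \int[m2]_(y in D) \int[m1]_x f x y)%E.
Proof.
move=> mD mf f0.
transitivity (\int[m1]_x \int[m2]_y ((f x) \_ D) y)%E.
  by apply: eq_integral => x _; rewrite integral_mkcond.
rewrite tonelli_swap.
- rewrite [RHS]integral_mkcond; apply: eq_integral => y _.
  rewrite [RHS]patchE; case: ifPn => yD.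
    by apply: eq_integral => x _; rewrite patchE yD.
  by apply: integral0_eq => x _; rewrite patchE (negbTE yD).
- exact: measurable_patch_snd.
- by move=> x y; rewrite patchE; case: ifPn => // /set_mem; exact: f0.
Qed.

Lemma measurable_rVDs d (T : measurableType d) n (f g : T -> 'rV[R]_n)
    (s : T -> R) :
  measurable_fun setT f -> measurable_fun setT g -> measurable_fun setT s ->
  measurable_fun setT (fun x => f x + s x *: g x).
Proof.
move=> mf mg ms; apply: measurable_fun_coordP => i; under eq_fun do rewrite !mxE.
apply: measurable_funD; first exact: measurableT_comp (measurable_coord i) mf.
by apply: measurable_funM => //; exact: measurableT_comp (measurable_coord i) mg.
Qed.

End half_space_integrals.

(** * A weighted Young inequality and geometric means *)

Section real_inequalities.
Context (R : realType).
Implicit Types p a b c J t G : R.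

(** Young's inequality with exponents p and p/(p - 1) for the factors G J^(1/p) and c J^(-1/p). *)
Lemma young_weighted p J c G : 1 < p -> 0 < J -> 0 <= c -> 0 <= G ->
  p * (c * G) <= G `^ p * J + (p - 1) * c `^ (p / (p - 1)) * J `^ (- (p - 1)^-1).
Proof.
move=> p1 J0 c0 G0; have p0 : 0 < p by exact: lt_trans p1.
have p10 : 0 < p - 1 by rewrite subr_gt0.
have pN : p != 0 by rewrite gt_eqF.
have p1N : p - 1 != 0 by rewrite gt_eqF.
have := @conjugate_powR _ (G * J `^ p^-1) (c * J `^ (- p^-1)) p (p / (p - 1)).
rewrite !mulr_ge0 ?powR_ge0// divr_gt0//.
move=> /(_ isT isT p0 isT) h.
have {}h := h (_ : p^-1 + (p / (p - 1))^-1 = 1).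
have E : p^-1 + (p / (p - 1))^-1 = 1 by field; rewrite pN p1N.
have {}h := h E.
move: h; rewrite (_ : G * _ * (c * _) = c * G); last first.
  rewrite powRN; field; by rewrite gt_eqF// powR_gt0.
rewrite !powRM ?powR_ge0// -!powRrM mulVf// (powRr1 (ltW J0)).
rewrite (_ : - p^-1 * (p / (p - 1)) = - (p - 1)^-1); last by field; rewrite pN p1N.
rewrite -(ler_pM2l p0) => /le_trans; apply.
by rewrite le_eqVlt; apply/orP; left; apply/eqP; field; rewrite pN p1N.
Qed.

Lemma AGM_ord n (E : 'I_n -> R) : (forall i, 0 <= E i) ->
  \prod_i E i <= ((\sum_i E i) / n%:R) ^+ n.
Proof.
move=> E0; have := @leif_AGM R 'I_n predT E.
rewrite cardT size_enum_ord => /= h; have [|+ _] := h; last exact.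
by move=> i _; exact: E0.
Qed.

(** Superadditivity of the geometric mean. The inequality of means is applied to the numbers 1/(1 +
    t D_i) and to the numbers t D_i/(1 + t D_i); for each i the two add up to 1, and so do the two
    arithmetic means. *)
Lemma prod_superadditive n (D : 'I_n -> R) (d t : R) : 0 <= d -> 0 <= t ->
  (forall i, 0 < D i) -> d ^+ n = \prod_i D i ->
  (1 + t * d) ^+ n <= \prod_i (1 + t * D i).
Proof.
move=> d0 t0 D0 dE; case: n D D0 dE => [|n] D D0 dE; first by rewrite big_ord0 expr0.
have p0 i : 0 < 1 + t * D i by rewrite ltr_wpDr// mulr_ge0// ltW.
set P := \prod_i _; have P0 : 0 < P by apply: prodr_gt0.
pose g := P `^ (n.+1%:R^-1).
have g0 : 0 < g by exact: powR_gt0.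
have gP : g ^+ n.+1 = P.
  by rewrite -powR_mulrn ?ltW// -powRrM mulVf ?pnatr_eq0// powRr1// ltW.
have n0 : 0 < n.+1%:R :> R by [].
have h1 : g^-1 <= (\sum_i (1 + t * D i)^-1) / n.+1%:R.
  rewrite -(@ler_pXn2r _ n.+1) ?nnegrE ?invr_ge0 ?(ltW g0)//; last first.
    by rewrite divr_ge0// sumr_ge0// => i _; rewrite invr_ge0 ltW.
  rewrite exprVn gP -prodfV; apply: AGM_ord => i.
  by rewrite invr_ge0 ltW.
have h2 : t * d / g <= (\sum_i (t * D i / (1 + t * D i))) / n.+1%:R.
  rewrite -(@ler_pXn2r _ n.+1) ?nnegrE ?divr_ge0 ?mulr_ge0 ?(ltW g0)//; last first.
    by rewrite sumr_ge0// => i _; rewrite divr_ge0 ?mulr_ge0 ?(ltW (D0 _)) ?(ltW (p0 _)).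
  rewrite (_ : _ ^+ _ = \prod_i (t * D i / (1 + t * D i))).
    by apply: AGM_ord => i; rewrite divr_ge0 ?mulr_ge0 ?(ltW (D0 _)) ?(ltW (p0 _)).
  by rewrite !big_split/= prodfV -/P -gP !exprMn exprVn dE prodr_const card_ord.
have h : (1 + t * d) / g <= 1.
  rewrite mulrDl mul1r; apply: (le_trans (lerD h1 h2)).
  rewrite -mulrDl -big_split/= (eq_bigr (fun=> 1)).
    by rewrite sumr_const card_ord divff// gt_eqF.
  by move=> i _; field; rewrite gt_eqF.
rewrite -gP lerXn2r ?nnegrE ?addr_ge0 ?mulr_ge0 ?(ltW g0)//.
by rewrite -[leRHS]mul1r -ler_pdivrMr.
Qed.

End real_inequalities.

(** * Estimates along rays *)

Section rays.
Context (R : realType) (n : nat).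
Local Notation mu := (@lebesgue_measure R).

Definition bounded_support (u : 'rV[R]_n.+1 -> R) : Prop :=
  exists M : R, forall (x : 'rV[R]_n.+1) i, M < `|x ord0 i| -> u x = 0.

Lemma snoc_rVD (y th : 'rV[R]_n) (t : R) :
  snoc_rV (y + t *: th) t = snoc_rV y 0 + t *: snoc_rV th 1.
Proof.
apply/rowP => i; rewrite !mxE; case: insubP => [j _ _|_] /=.
  by rewrite !mxE.
by rewrite mulr1 add0r.
Qed.

Lemma continuous_sum_ord (T : topologicalType) m (f : 'I_m -> T -> R) :
  (forall i, continuous (f i)) -> continuous (fun z => \sum_i f i z).
Proof.
elim: m f => [|m IH] f cf z.
  by under eq_fun do rewrite big_ord0; exact: cst_continuous.
by under eq_fun do rewrite big_ord_recl; apply: cvgD; [exact: cf|exact: IH].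
Qed.

Lemma continuous_line (x v : 'rV[R]_n.+1) : continuous (fun t : R => x + t *: v).
Proof.
apply: continuous_rV => i; rewrite (_ : (fun _ => _) = fun t : R => x ord0 i + t * v ord0 i).
  move=> t; apply: cvgD; first exact: cvg_cst.
  by apply: cvgMl; exact: cvg_id.
by apply/funext => t; rewrite !mxE.
Qed.

Variable u : 'rV[R]_n.+1 -> R.
Hypotheses (C1u : C1 u) (bu : bounded_support u).

Lemma continuous_enorm_grad : continuous (fun x => enorm (grad u x)).
Proof.
move=> x; apply: (@continuous_comp _ _ _ (grad u) (@enorm R n.+1)); last first.
  exact: continuous_enorm.
apply: continuous_rV => i.
rewrite (_ : (fun _ => _) = partial i u); first exact: C1u.1.
by apply/funext => z; rewrite mxE.
Qed.

Lemma measurable_enorm_grad : measurable_fun setT (fun x => enorm (grad u x)).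
Proof. exact: continuous_measurable_rV continuous_enorm_grad. Qed.

Lemma ray_bound (y th : 'rV[R]_n) :
  (`|u (snoc_rV y 0)|%:E <= \int[mu]_(t in `[0%R, +oo[)
    (enorm (snoc_rV th 1) * enorm (grad u (snoc_rV (y + t *: th) t)))%:E)%E.
Proof.
pose v := snoc_rV th 1; pose x := snoc_rV y 0.
pose f (t : R) := u (x + t *: v).
pose g (t : R) := \sum_i v ord0 i * partial i u (x + t *: v).
have df (t : R) : is_derive t 1 f (g t).
  exact/is_derive_line/C1_is_derive.
have cg : continuous g.
  apply: continuous_sum_ord => i; apply: continuous_mulrl => t.
  apply: (@continuous_comp _ _ _ (fun t : R => x + t *: v) (partial i u)).
    exact: continuous_line.
  exact: C1u.1.
(* The last coordinate of the point at time T is T itself, so the ray has left the support by then,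
   whatever its direction. *)
have [M hM] := bu; pose T := Num.max 0 M + 1.
have T0 : 0 < T by rewrite ltr_wpDl// le_max lexx.
have fT : f T = 0.
  apply: (hM _ ord_max); rewrite -snoc_rVD snoc_rV_max gtr0_norm//.
  by rewrite (@le_lt_trans _ _ (Num.max 0 M)) ?le_max ?lexx ?orbT// ltrDl.
have := integral_itv_derive df cg T0; rewrite fT sub0r.
rewrite /f scale0r addr0 -/x => fE.
have -> : (`|u x|%:E = `| \int[mu]_(t in `]0%R, T]) (g t)%:E |)%E.
  by rewrite fE /= normrN.
have mg : measurable_fun setT (g : measurableTypeR R -> R).
  exact: continuous_measurable_fun.
apply: (le_trans (le_abse_integral _ _ _)) => //.
  by apply/measurable_EFinP; apply: measurable_funTS.
have mG : measurable_fun setT (fun t : measurableTypeR R =>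
    (enorm (snoc_rV th 1) * enorm (grad u (snoc_rV (y + t *: th) t)))%:E).
  apply/measurable_EFinP; apply: measurable_funM; first exact: measurable_cst.
  apply: (measurableT_comp measurable_enorm_grad).
  apply: measurable_snoc_rVP; last exact: measurable_id.
  by apply: measurable_rVDs; [exact: measurable_cst|exact: measurable_cst|exact: measurable_id].
have G0 (t : R) : (0 <= (enorm (snoc_rV th 1) * enorm (grad u (snoc_rV (y + t *: th) t)))%:E)%E.
  by rewrite lee_fin mulr_ge0 ?enorm_ge0.
apply: (@le_trans _ _ (\int[mu]_(t in `]0%R, T])
    (enorm (snoc_rV th 1) * enorm (grad u (snoc_rV (y + t *: th) t)))%:E)%E).
  apply: ge0_le_integral => //.
  - by apply: measurableT_comp => //; apply/measurable_EFinP; apply: measurable_funTS.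
  - exact: measurable_funTS.
  - move=> t _; rewrite lee_fin snoc_rVD -/x -/v.
    apply: le_trans (cauchy_schwarz v (grad u (x + t *: v))).
    rewrite le_eqVlt; apply/orP; left; apply/eqP; congr (`| _ |).
    by rewrite /g; apply: eq_bigr => i _; rewrite [grad u _ _ _]mxE.
apply: ge0_subset_integral => //; first exact: measurable_funTS.
by move=> t /=; rewrite !in_itv/= andbT => /andP[/ltW].
Qed.

Lemma sqr_enorm_snoc (th : 'rV[R]_n) :
  enorm (snoc_rV th 1) ^+ 2 = 1 + \sum_i th ord0 i ^+ 2.
Proof.
rewrite sqr_enorm big_ord_recr /= snoc_rV_max expr1n addrC; congr (_ + _).
by apply: eq_bigr => i _; rewrite snoc_rV_widen.
Qed.

End rays.

Section weighted_energy.
Context (R : realType) (n : nat).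
Local Notation mu := (@lebesgue_measure R).
Variables (u : 'rV[R]_n.+1 -> R) (p : R).
Hypotheses (C1u : C1 u) (bu : bounded_support u).
Hypotheses (p1 : 1 < p) (pn : p - 1 < n%:R).

Let p10 : 0 < p - 1. Proof. by rewrite subr_gt0. Qed.
Let n0 : 0 < n%:R :> R. Proof. exact: lt_trans p10 pn. Qed.

Let measurable_along (th : 'rV[R]_n -> 'rV[R]_n) (D : 'rV[R]_n -> 'rV[R]_n) :
  measurable_fun setT th -> measurable_fun setT D ->
  measurable_fun setT (fun w : 'rV[R]_n * measurableTypeR R =>
    (enorm (grad u (snoc_rV (w.1 + w.2 *: th w.1) w.2)) `^ p *
     \prod_i (1 + w.2 * D w.1 ord0 i))%:E).
Proof.
move=> mth mD; apply/measurable_EFinP; apply: measurable_funM.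
  apply: (measurableT_comp (measurable_powR _)).
  apply: (measurableT_comp (measurable_enorm_grad C1u)).
  apply: measurable_snoc_rVP; last exact: measurable_snd.
  apply: measurable_rVDs; [exact: measurable_fst| |exact: measurable_snd].
  exact: measurableT_comp mth measurable_fst.
apply: measurable_prod_ord => i; apply: measurable_funD; first exact: measurable_cst.
apply: measurable_funM; first exact: measurable_snd.
apply: measurableT_comp (measurable_coord i) _.
exact: measurableT_comp mD measurable_fst.
Qed.

(** Young's inequality is used at each t with the Jacobian as weight and c = kappa |(th, 1)|. The
    remainder carries the Jacobian to the power -1/(p - 1), hence at most (1 + t d)^(-n/(p - 1)),
    which is integrable because n > p - 1; its integral is the last factor. The factor kappa stays
    free and will depend on y. *)
Lemma ray_young (y th D : 'rV[R]_n) (kappa d : R) : 0 <= kappa -> 0 < d ->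
  (forall i, 0 < D ord0 i) -> d ^+ n = \prod_i D ord0 i ->
  ((p * kappa * `|u (snoc_rV y 0)|)%:E <=
   \int[mu]_(t in `[0%R, +oo[)
     (enorm (grad u (snoc_rV (y + t *: th) t)) `^ p * \prod_i (1 + t * D ord0 i))%:E +
   ((p - 1) * (kappa * enorm (snoc_rV th 1)) `^ (p / (p - 1)) *
    (d * (n%:R / (p - 1) - 1))^-1)%:E)%E.
Proof.
move=> k0 d0 D0 dE; have p0 : 0 < p by exact: lt_trans p1.
set om := enorm (snoc_rV th 1); have om0 : 0 <= om by exact: enorm_ge0.
pose G (t : R) := enorm (grad u (snoc_rV (y + t *: th) t)).
pose c := (p - 1) * (kappa * om) `^ (p / (p - 1)).
have c0 : 0 <= c by rewrite mulr_ge0 ?powR_ge0// ltW.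
have g1 : 1 < n%:R / (p - 1) by rewrite ltr_pdivlMr// mul1r.
have mG : measurable_fun setT (G : measurableTypeR R -> R).
  apply: (measurableT_comp (measurable_enorm_grad C1u)).
  apply: measurable_snoc_rVP; last exact: measurable_id.
  by apply: measurable_rVDs; [exact: measurable_cst|exact: measurable_cst|exact: measurable_id].
have mJ : measurable_fun setT (fun t : measurableTypeR R =>
    (G t `^ p * \prod_i (1 + t * D ord0 i))%:E).
  apply/measurable_EFinP; apply: measurable_funM.
    exact: measurableT_comp (measurable_powR _) mG.
  apply: measurable_prod_ord => i; apply: measurable_funD; first exact: measurable_cst.
  by apply: measurable_funM; [exact: measurable_id|exact: measurable_cst].
have mP : measurable_fun setT (fun t : measurableTypeR R =>
    ((1 + d * t) `^ (- (n%:R / (p - 1))))%:E).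
  apply/measurable_EFinP; apply: (measurableT_comp (measurable_powR _)).
  by apply: measurable_funD; [exact: measurable_cst|exact: measurable_funM].
have J0 (t : R) : 0 <= t -> 0 <= G t `^ p * \prod_i (1 + t * D ord0 i).
  move=> t0; rewrite mulr_ge0 ?powR_ge0// prodr_ge0// => i _.
  by rewrite addr_ge0// mulr_ge0// ltW.
have -> : ((p - 1) * (kappa * om) `^ (p / (p - 1)) * (d * (n%:R / (p - 1) - 1))^-1)%:E =
   (\int[mu]_(t in `[0%R, +oo[) (c%:E * ((1 + d * t) `^ (- (n%:R / (p - 1))))%:E))%E.
  rewrite ge0_integralZl//.
  - by rewrite integral_affine_powR.
  - exact: measurable_funTS.
  - by move=> t _; rewrite lee_fin powR_ge0.
rewrite -ge0_integralD//; last 4 first.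
- by move=> t /=; rewrite in_itv/= andbT => t0; rewrite lee_fin J0.
- exact: measurable_funTS.
- by move=> t _; rewrite mule_ge0// lee_fin powR_ge0.
- by apply: emeasurable_funM; [exact: measurable_cst|exact: measurable_funTS].
rewrite EFinM.
apply: (@le_trans _ _ ((p * kappa)%:E *
    \int[mu]_(t in `[0%R, +oo[) (om * G t)%:E)%E).
  by apply: lee_wpmul2l; [rewrite lee_fin mulr_ge0// ltW|exact: ray_bound].
rewrite -ge0_integralZl//; last 3 first.
- by apply/measurable_EFinP; apply: measurable_funTS; apply: measurable_funM => //; exact: measurable_cst.
- by move=> t _; rewrite lee_fin mulr_ge0 ?enorm_ge0.
- by rewrite lee_fin mulr_ge0// ltW.
apply: ge0_le_integral => //.
- by move=> t _; rewrite -EFinM lee_fin !mulr_ge0 ?enorm_ge0// ltW.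
- apply: emeasurable_funM; first exact: measurable_cst.
  by apply/measurable_EFinP; apply: measurable_funTS; apply: measurable_funM => //; exact: measurable_cst.
- apply: emeasurable_funD; first exact: measurable_funTS.
  by apply: emeasurable_funM; [exact: measurable_cst|exact: measurable_funTS].
move=> t /=; rewrite in_itv/= andbT => t0; rewrite -!EFinM -EFinD lee_fin.
set J := \prod_i _.
have JJ : (1 + t * d) ^+ n <= J by apply: prod_superadditive => //; exact: ltW.
have td0 : 0 < 1 + t * d by rewrite ltr_wpDr// mulr_ge0// ltW.
have Jp : 0 < J by apply: lt_le_trans JJ; exact: exprn_gt0.
have h := young_weighted p1 Jp (mulr_ge0 k0 om0) (enorm_ge0 (grad u (snoc_rV (y + t *: th) t))).
rewrite -/(G t) -/c in h.
rewrite (_ : _ * _ * _ = p * (kappa * om * G t)); last by ring.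
apply: (le_trans h); rewrite lerD2l; apply: ler_wpM2l => //.
apply: (le_trans (powR_lower _ JJ _)); first exact: exprn_gt0.
  by rewrite invr_ge0 ltW.
rewrite -(powR_mulrn _ (ltW td0)) -powRrM mulrN [d * t]mulrC.
by rewrite lexx.
Qed.

Let a := p * n%:R / (p - 1).
Let K0 := profile_masses n a.
Let beta := n%:R / (p - 1) - 1.

Let na : n%:R < a.
Proof.
rewrite /a ltr_pdivlMr// mulrC ltr_pM2r//.
by rewrite ltrBlDr ltrDl.
Qed.

Lemma profile_masses_gt0 : 0 < K0.
Proof.
apply: prodr_gt0 => j _; apply: profile_mass_gt0.
have : (j : nat).+1%:R <= n%:R :> R by rewrite ler_nat.
by rewrite -natr1; move: na; lra.
Qed.

(** Here the exponents are forced. With a = pn/(p - 1), d is (rho K0/m)^(1/n) |(theta, 1)|^(p/(p -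
    1)), whose second factor cancels the one in the remainder of [ray_young]. Raising rho to N(p -
    1)/(pn) in kappa puts rho^(1 + 1/n) into that remainder; after division by d, a constant times
    rho is left, and it integrates to a multiple of m. *)
Lemma weighted_trace_ineq (rho : 'rV[R]_n -> R) (C lam : R) :
  continuous rho -> (forall y, 0 < rho y) -> (forall y, rho y <= C * tail_weight y) ->
  0 <= lam -> forall m, m = \int[leb R n]_y rho y ->
  (\int[leb R n]_y (p * (lam * rho y `^ ((n.+1%:R * (p - 1)) / (p * n%:R))) *
      `|u (snoc_rV y 0)|)%:E <=
   \int[leb R n.+1]_(x in @half_space R n.+1) (enorm (grad u x) `^ p)%:E +
   ((p - 1) * lam `^ (p / (p - 1)) * (m / K0) `^ n%:R^-1 / beta * m)%:E)%E.
Proof.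
move=> crho rho0 rhoC lam0 m mI.
have mrho : measurable_fun setT rho by exact: continuous_measurable_rV.
have [th0 [D0 [mth mD D_gt0 DE DI]]] := @knothe_map R n a na _ unit (fun=> rho)
  (fun=> C) (fun=> 1) (measurableT_comp mrho measurable_snd) (fun=> crho)
  (fun=> rho0) (fun=> rhoC) (measurable_cst _) (fun=> ltr01).
pose th := th0 tt; pose D := D0 tt.
have {}mth : measurable_fun setT th by exact: measurable_pair_rV mth.
have {}mD : measurable_fun setT D by exact: measurable_pair_rV mD.
have irho := integrable_tail_weight crho rho0 rhoC.
have mE : (\int[leb R n]_y (rho y)%:E = m%:E)%E.
  by rewrite mI /Rintegral fineK//; exact: integrable_fin_num irho.
have m0 : 0 < m.
  rewrite -lte_fin -mE; apply: integral_gt0_leb; last by move=> y; rewrite lte_fin.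
  exact/measurable_EFinP.
have K00 := profile_masses_gt0.
have pp0 : 0 < p by exact: lt_trans p1.
have pN : p != 0 by rewrite gt_eqF.
have p1N : p - 1 != 0 by rewrite gt_eqF.
have nN0 : n%:R != 0 :> R by rewrite gt_eqF.
have beta0 : 0 < beta by rewrite subr_gt0 ltr_pdivlMr// mul1r.
pose om y := enorm (snoc_rV (th y) 1).
have om0 y : 0 < om y.
  rewrite lt_neqAle enorm_ge0 andbT eq_sym -sqrf_eq0 sqr_enorm_snoc gt_eqF//.
  by rewrite ltr_wpDr// sumr_ge0// => i _; exact: sqr_ge0.
pose d y := (\prod_i D y ord0 i) `^ n%:R^-1.
have PD y : 0 < \prod_i D y ord0 i by apply: prodr_gt0 => i _; exact: D_gt0.
have d0 y : 0 < d y by exact: powR_gt0.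
have dn y : d y ^+ n = \prod_i D y ord0 i.
  by rewrite -(powR_mulrn _ (ltW (d0 y))) -powRrM mulVf// (powRr1 (ltW (PD y))).
have dE y : d y = (rho y / m * K0) `^ n%:R^-1 * om y `^ (p / (p - 1)).
  rewrite /d /D DE powR1 mulr1 expr1n -sqr_enorm_snoc -/(om y) -/K0 -mI.
  rewrite powRM; last 2 first.
  - by rewrite mulr_ge0 ?ltW// divr_gt0.
  - exact: powR_ge0.
  congr (_ * _); rewrite -powR_mulrn ?enorm_ge0// -!powRrM; congr (_ `^ _).
  by rewrite /a; field; rewrite p1N nN0.
set e := (n.+1%:R * (p - 1)) / (p * n%:R).
set cst := (p - 1) * lam `^ (p / (p - 1)) * (m / K0) `^ n%:R^-1 / beta.
have cst0 : 0 <= cst.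
  by rewrite !mulr_ge0 ?powR_ge0 ?invr_ge0 ?(ltW beta0)// ltW.
pose En (y : 'rV[R]_n) := (\int[mu]_(t in `[0%R, +oo[)
     (enorm (grad u (snoc_rV (y + t *: th y) t)) `^ p *
      \prod_i (1 + t * D y ord0 i))%:E)%E.
have J0 (y : 'rV[R]_n) (t : R) : `[0%R, +oo[%classic t ->
    (0 <= (enorm (grad u (snoc_rV (y + t *: th y) t)) `^ p *
      \prod_i (1 + t * D y ord0 i))%:E)%E.
  rewrite /= in_itv/= andbT => t0.
  rewrite lee_fin mulr_ge0 ?powR_ge0// prodr_ge0// => i _.
  by rewrite addr_ge0// mulr_ge0// ltW// D_gt0.
have En0 y : (0 <= En y)%E by apply: integral_ge0 => t; exact: J0.
have ptw y : ((p * (lam * rho y `^ e) * `|u (snoc_rV y 0)|)%:E <=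
    En y + (cst * rho y)%:E)%E.
  have k0 : 0 <= lam * rho y `^ e by rewrite mulr_ge0 ?powR_ge0.
  apply: (le_trans (ray_young y (th y) k0 (d0 y) (D_gt0 tt y) (dn y))).
  apply: leeD => //; rewrite lee_fin -/(om y) -/beta.
  rewrite le_eqVlt; apply/orP; left; apply/eqP.
  rewrite powRM// ?(ltW (om0 y))// powRM ?powR_ge0// -powRrM dE /cst.
  have -> : rho y `^ (e * (p / (p - 1))) = rho y * rho y `^ n%:R^-1.
    rewrite -{2}(powRr1 (ltW (rho0 y))) -powRD; last by rewrite (gt_eqF (rho0 y)) implybT.
    congr (_ `^ _); rewrite /e -natr1; field; by rewrite pN p1N nN0.
  have -> : (rho y / m * K0) `^ n%:R^-1 = rho y `^ n%:R^-1 / (m / K0) `^ n%:R^-1.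
    rewrite (_ : rho y / m * K0 = rho y * (m / K0)^-1); last first.
      by field; rewrite !gt_eqF.
    rewrite powRM ?invr_ge0 ?divr_ge0 ?(ltW m0) ?(ltW K00) ?(ltW (rho0 y))//.
    have mK0 : 0 <= m / K0 by rewrite divr_ge0 ?ltW.
    by rewrite -[in LHS](powR_inv1 mK0) powRAC powR_inv1 ?powR_ge0.
  have h1 : om y `^ (p / (p - 1)) != 0 by rewrite gt_eqF// powR_gt0.
  have h2 : rho y `^ n%:R^-1 != 0 by rewrite gt_eqF// powR_gt0.
  have h3 : (m / K0) `^ n%:R^-1 != 0 by rewrite gt_eqF// powR_gt0// divr_gt0.
  by field; rewrite h1 h2 h3 gt_eqF.
have mu0 : measurable_fun setT (fun y : 'rV[R]_n => `|u (snoc_rV y 0)|).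
  apply: measurableT_comp => //.
  apply: (measurableT_comp (continuous_measurable_rV (C1_continuous C1u))).
  by apply: measurable_snoc_rVP; [exact: measurable_id|exact: measurable_cst].
have mEn : measurable_fun setT En.
  apply: (@measurable_integral_section_in R _ _ _ _ mu `[0%R, +oo[%classic
    (fun (y : 'rV[R]_n) (t : measurableTypeR R) => (enorm (grad u (snoc_rV (y + t *: th y) t)) `^ p *
      \prod_i (1 + t * D y ord0 i))%:E)); [exact: measurable_itv|exact: measurable_along|].
  exact: J0.
apply: (@le_trans _ _ (\int[leb R n]_y (En y + (cst * rho y)%:E))%E).
  apply: ge0_le_integral => //.
  - by move=> y _; rewrite lee_fin !mulr_ge0 ?powR_ge0// ltW.
  - apply/measurable_EFinP; apply: measurable_funM => //.
    apply: measurable_funM; first exact: measurable_cst.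
    apply: measurable_funM; first exact: measurable_cst.
    exact: measurableT_comp (measurable_powR _) mrho.
  - apply: emeasurable_funD => //; apply/measurable_EFinP.
    by apply: measurable_funM => //; exact: measurable_cst.
rewrite ge0_integralD//; last 2 first.
- by move=> y _; rewrite lee_fin mulr_ge0// ltW.
- by apply/measurable_EFinP; apply: measurable_funM => //; exact: measurable_cst.
apply: leeD.
  (* At each height t the map y + t theta(y) has Jacobian prod (1 + t D_i), so the energies gathered
     along the rays add up to the energy in the half-space, without loss. *)
  rewrite /En tonelli_swap_in.
  - rewrite ge0_integral_half_space; last 2 first.
    + apply/measurable_EFinP; apply: (measurableT_comp (measurable_powR _)).
      exact: measurable_enorm_grad.
    + by move=> x; rewrite lee_fin powR_ge0.
    rewrite le_eqVlt; apply/orP; left; apply/eqP; apply: eq_integral => t.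
    rewrite inE/= in_itv/= andbT => t0.
    have := DI tt t (fun x => (enorm (grad u (snoc_rV x t)) `^ p)%:E) t0 _ _.
    rewrite -/th -/D => ->.
    + by apply: eq_integral => y _; rewrite -EFinM.
    + apply/measurable_EFinP; apply: (measurableT_comp (measurable_powR _)).
      apply: (measurableT_comp (measurable_enorm_grad C1u)).
      by apply: measurable_snoc_rVP; [exact: measurable_id|exact: measurable_cst].
    + by move=> x; rewrite lee_fin powR_ge0.
  - exact: measurable_itv.
  - exact: measurable_along.
  - exact: J0.
under eq_integral do rewrite EFinM.
rewrite ge0_integralZl//.
- by rewrite mE.
- exact/measurable_EFinP.
- by move=> y _; rewrite lee_fin ltW.
Qed.

End weighted_energy.

(** * The choice of density and multiplier *)

Section sharp_trace.
Context (R : realType).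

Lemma continuous_powR_ge0 (T : topologicalType) (g : T -> R) a : 0 < a ->
  (forall x, 0 <= g x) -> continuous g -> continuous (fun x => g x `^ a).
Proof.
move=> a0 g0 cg x; have := g0 x; rewrite le_eqVlt => /predU1P[gx|gx]; last first.
  by apply: continuous_powR_comp => //; exact: cg.
apply/cvgrPdist_le => e e0; rewrite -gx powR0 ?gt_eqF//.
have e1 : 0 < e `^ a^-1 by exact: powR_gt0.
have := cg x; move/cvgrPdist_lt => /(_ _ e1).
apply: filterS => y; rewrite -gx !sub0r !normrN (ger0_norm (g0 y)) => /ltW h.
rewrite ger0_norm ?powR_ge0//.
have := @ge0_ler_powR R a (ltW a0) _ _ (g0 y) (ltW e1) h.
by rewrite -powRrM mulVf ?gt_eqF// powRr1// ltW.
Qed.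

Lemma bounded_support_tail n (f : 'rV[R]_n -> R) (M : R) : continuous f ->
  (forall (y : 'rV[R]_n) i, M < `|y ord0 i| -> f y = 0) ->
  exists C, forall y, f y <= C * tail_weight y.
Proof.
move=> cf fM.
pose M' := Num.max M 0.
pose B := [set y : 'rV[R]_n | forall i, `[- M', M']%classic (y ord0 i)].
have cB : compact B.
  apply: (@rV_compact _ n (fun=> `[- M', M']%classic)) => i.
  exact: segment_compact.
have [L hL] : exists L : R, forall y, B y -> f y <= L.
  have := compact_bounded (continuous_compact (continuous_subspaceT cf) cB).
  move=> [L [_ /(_ (L + 1))]]; rewrite ltrDl ltr01 => /(_ isT) h.
  by exists (L + 1) => y By; apply: (le_trans (ler_norm _)); apply: h; exists y.
pose c := profile 2 M' ^+ n.
have c0 : 0 < c by apply: exprn_gt0; exact: profile_gt0.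
exists (Num.max L 0 / c) => y.
have [By|nBy] := pselect (B y).
  apply: (le_trans (hL _ By)).
  apply: (@le_trans _ _ (Num.max L 0)); first by rewrite le_max lexx.
  rewrite mulrAC ler_pdivlMr//; apply: ler_wpM2l; first by rewrite le_max lexx orbT.
  rewrite /c /tail_weight -[X in _ ^+ X](card_ord n) -prodr_const.
  apply: ler_prod => i _; rewrite ltW ?profile_gt0//=.
  have := By i; rewrite /= in_itv/= => hi.
  rewrite /profile; apply: powR_lower; [exact: sqr1_gt0| |by rewrite divr_ge0].
  rewrite lerD2l -real_normK ?num_real// lerXn2r ?nnegrE//.
    by rewrite le_max lexx orbT.
  by rewrite ler_norml.
have [i hi] : exists i, ~ `[- M', M']%classic (y ord0 i) by apply/existsNP.
rewrite (fM y i).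
  by rewrite mulr_ge0 ?divr_ge0 ?(ltW c0) ?(ltW (tail_weight_gt0 _))// le_max lexx orbT.
move: hi; rewrite /= in_itv/= -ler_norml => /negP; rewrite -ltNge.
by apply: le_lt_trans; rewrite le_max lexx.
Qed.

Variables (n : nat) (p : R).
Hypotheses (n0 : (0 < n)%N) (p1 : 1 < p) (pN : p < n.+1%:R).

(** Since N - p = n - (p - 1), the base of the first power is beta. *)
Definition trace_const : R :=
  (n%:R / (p - 1) - 1) `^ (p - 1) *
  profile_masses n (p * n%:R / (p - 1)) `^ ((p - 1) / n%:R).

Let nR : 0 < n%:R :> R. Proof. by rewrite ltr0n. Qed.
Let p10 : 0 < p - 1. Proof. by rewrite subr_gt0. Qed.
Let p0 : 0 < p. Proof. exact: lt_trans p1. Qed.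
Let pn : p - 1 < n%:R. Proof. by rewrite ltrBlDr natr1. Qed.
Let Np0 : 0 < n.+1%:R - p. Proof. by rewrite subr_gt0. Qed.
Let K0 := profile_masses n (p * n%:R / (p - 1)).
Let K00 : 0 < K0. Proof. exact: profile_masses_gt0. Qed.
Let beta := n%:R / (p - 1) - 1.
Let beta0 : 0 < beta. Proof. by rewrite subr_gt0 ltr_pdivlMr// mul1r. Qed.

Lemma trace_const_gt0 : 0 < trace_const.
Proof. by rewrite mulr_gt0 ?powR_gt0. Qed.

Lemma pstar_gt0 : 0 < pstar n.+1 p.
Proof. by rewrite /pstar divr_gt0// mulr_gt0. Qed.

Variable u : 'rV[R]_n.+1 -> R.
Hypotheses (C1u : C1 u) (bu : bounded_support u).

Let f (y : 'rV[R]_n) : R := `|u (snoc_rV y 0)|.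

Lemma continuous_trace : continuous (fun y : 'rV[R]_n => u (snoc_rV y 0)).
Proof.
move=> y; apply: (@continuous_comp _ _ _ (fun y : 'rV[R]_n => snoc_rV y 0) u).
  apply: continuous_rV => i z.
  have [h|h] := ltnP i n.
    rewrite (_ : (fun _ => _) = fun y : 'rV[R]_n => y ord0 (Ordinal h)).
      exact: coord_continuous.
    by apply/funext => w; rewrite snoc_rV_lt.
  rewrite (_ : (fun _ => _) = cst 0); first exact: cst_continuous.
  apply/funext => w; rewrite snoc_rV_last//.
  by apply/eqP; rewrite eqSS eqn_leq h -ltnS ltn_ord.
exact: (C1_continuous C1u).
Qed.

Let ps := pstar n.+1 p.

Let cfp : continuous (fun y => f y `^ ps).
Proof.
apply: continuous_powR_ge0; [exact: pstar_gt0|by move=> y; exact: normr_ge0|].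
move=> y; apply: (@continuous_comp _ _ _ (fun y => u (snoc_rV y 0)) (fun z : R => `|z|)).
  exact: continuous_trace.
exact: norm_continuous.
Qed.

Lemma trace_tail : exists C, forall y, f y `^ ps <= C * tail_weight y.
Proof.
have [M hM] := bu; apply: (@bounded_support_tail _ _ M cfp) => y i h.
rewrite /f (hM _ (widen_ord (leqnSn n) i)) ?snoc_rV_widen//.
by rewrite normr0 powR0// gt_eqF// pstar_gt0.
Qed.

Lemma trace_integral_fin :
  (\int[leb R n]_y (`|u (snoc_rV y 0)| `^ ps)%:E)%E \is a fin_num.
Proof.
have [C hC] := trace_tail.
have mf : measurable_fun setT (fun y => f y `^ ps) by exact: continuous_measurable_rV.
rewrite ge0_fin_numE; last by apply: integral_ge0 => y _; rewrite lee_fin powR_ge0.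
have C0 : 0 <= C.
  rewrite -(pmulr_lge0 _ (tail_weight_gt0 (0 : 'rV[R]_n))).
  exact: le_trans (powR_ge0 _ _) (hC _).
have mw : measurable_fun setT (fun y : 'rV[R]_n => (tail_weight y)%:E).
  by apply/measurable_EFinP; apply: continuous_measurable_rV;
    exact: continuous_tail_weight.
apply: (@le_lt_trans _ _ (\int[leb R n]_y (C%:E * (tail_weight y)%:E))%E).
  apply: ge0_le_integral => //.
  - by apply/measurable_EFinP; exact: mf.
  - by apply: emeasurable_funM => //; exact: measurable_cst.
  - by move=> y _ /=; rewrite -EFinM lee_fin; exact: hC.
rewrite ge0_integralZl//.
- by rewrite lte_mul_pinfty ?lee_fin// integral_tail_weight.
- by move=> y _; rewrite lee_fin ltW// tail_weight_gt0.
Qed.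

Theorem sharp_trace :
  (trace_const%:E *
   (\int[leb R n]_y (`|u (snoc_rV y 0)| `^ ps)%:E) `^ (p / ps) <=
   \int[leb R n.+1]_(x in @half_space R n.+1) (enorm (grad u x) `^ p)%:E)%E.
Proof.
set E := (X in (_ <= X)%E).
have E0 : (0 <= E)%E by apply: integral_ge0 => x _; rewrite lee_fin powR_ge0.
have [C hC] := trace_tail.
have C0 : 0 <= C.
  rewrite -(pmulr_lge0 _ (tail_weight_gt0 (0 : 'rV[R]_n))).
  exact: le_trans (powR_ge0 _ _) (hC _).
have mf : measurable_fun setT (fun y => (f y `^ ps)%:E).
  by apply/measurable_EFinP; exact: continuous_measurable_rV.
have mw : measurable_fun setT (fun y : 'rV[R]_n => (tail_weight y)%:E).
  by apply/measurable_EFinP; apply: continuous_measurable_rV;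
    exact: continuous_tail_weight.
have := trace_integral_fin; set I := (\int[leb R n]_y _)%E => /fineK IE.
pose F := fine I.
have F0 : 0 <= F by apply: fine_ge0; apply: integral_ge0 => y _; rewrite lee_fin powR_ge0.
pose W := fine (\int[leb R n]_y (tail_weight y)%:E)%E.
have WE : (\int[leb R n]_y (tail_weight y)%:E)%E = W%:E.
  rewrite fineK// ge0_fin_numE; first exact: integral_tail_weight.
  by apply: integral_ge0 => y _; rewrite lee_fin ltW// tail_weight_gt0.
have W0 : 0 <= W.
  by rewrite -lee_fin -WE; apply: integral_ge0 => y _; rewrite lee_fin ltW// tail_weight_gt0.
have psN : ps != 0 by rewrite gt_eqF// pstar_gt0.
rewrite -IE -/F poweR_EFin -EFinM.
have [->|Fne] := eqVneq F 0.
  by rewrite powR0 ?mulr0// mulf_neq0 ?invr_eq0// gt_eqF.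
have {Fne}Fp : 0 < F by rewrite lt_neqAle eq_sym Fne.
move: E0; case EE : E => [r| |]// E0; last by rewrite leey.
rewrite lee_fin.
have key (eps : R) : 0 < eps -> trace_const * (F + eps * W) `^ (- ((p - 1) / n%:R)) *
    (p * F - (p - 1) * (F + eps * W)) <= r.
  move=> e0; pose rho (y : 'rV[R]_n) := f y `^ ps + eps * tail_weight y.
  pose m := F + eps * W.
  have m0 : 0 < m by rewrite ltr_wpDr// mulr_ge0// ltW.
  have mI : m = \int[leb R n]_y rho y.
    rewrite /Rintegral; under eq_integral do rewrite EFinD.
    rewrite ge0_integralD//; last 3 first.
    - by move=> y _; rewrite lee_fin powR_ge0.
    - by move=> y _; rewrite lee_fin mulr_ge0 ?(ltW e0)// ltW// tail_weight_gt0.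
    - under eq_fun do rewrite EFinM.
      by apply: emeasurable_funM => //; exact: measurable_cst.
    under [X in fine (_ + X)]eq_integral do rewrite EFinM.
    rewrite ge0_integralZl//; last 2 first.
    - by move=> y _; rewrite lee_fin ltW// tail_weight_gt0.
    - by rewrite lee_fin ltW.
    by rewrite WE -/I -IE.
  (* The maximizer of p lam m - (p - 1) lam^(p/(p - 1)) (m/K0)^(1/n) m/beta, that is, the best
     multiplier once F and m are identified. *)
  pose lam := (beta * (K0 / m) `^ n%:R^-1) `^ (p - 1).
  have b0 : 0 < beta * (K0 / m) `^ n%:R^-1 by rewrite mulr_gt0// powR_gt0// divr_gt0.
  have lam0 : 0 < lam by exact: powR_gt0.
  have rho0 y : 0 < rho y.
    by rewrite ltr_wpDl ?powR_ge0// mulr_gt0// tail_weight_gt0.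
  have := @weighted_trace_ineq R n u p C1u bu p1 pn rho (C + eps) lam _ rho0 _ (ltW lam0) m mI.
  rewrite -/E EE -/beta -/K0 => h.
  have {}h := h _ _.
  have crho : continuous rho.
    move=> y; apply: (@continuousD _ _ _ (fun y => f y `^ ps) (fun y => eps * tail_weight y)).
      exact: cfp.
    by apply: continuous_mulrl; exact: continuous_tail_weight.
  have rhoC y : rho y <= (C + eps) * tail_weight y by rewrite mulrDl lerD.
  have {}h := h crho rhoC.
  have lamE : lam `^ (p / (p - 1)) = lam * (beta * (K0 / m) `^ n%:R^-1).
    rewrite -[in RHS](powRr1 (ltW b0)) /lam -powRrM -powRD.
      by congr (_ `^ _); field; rewrite gt_eqF.
    by rewrite (gt_eqF b0) implybT.
  have h1 : ((p * lam)%:E * I <= r%:E + ((p - 1) * lam * m)%:E)%E.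
    rewrite (_ : (p - 1) * lam * m = (p - 1) * lam `^ (p / (p - 1)) * (m / K0) `^ n%:R^-1 / beta * m); last first.
      rewrite lamE (_ : K0 / m = (m / K0)^-1); last by field; rewrite !gt_eqF.
      have mK0 : 0 <= m / K0 by rewrite divr_ge0 ?ltW.
      have -> : (m / K0)^-1 `^ n%:R^-1 = ((m / K0) `^ n%:R^-1)^-1.
        by rewrite -(powR_inv1 mK0) powRAC powR_inv1 ?powR_ge0.
      have h3 : (m / K0) `^ n%:R^-1 != 0 by rewrite gt_eqF// powR_gt0// divr_gt0.
      by field; rewrite h3 gt_eqF.
    apply: le_trans h; rewrite -ge0_integralZl//; last first.
      by rewrite lee_fin mulr_ge0// ltW.
    apply: ge0_le_integral => //.
    - by move=> y _; rewrite -EFinM lee_fin !mulr_ge0 ?powR_ge0// ltW.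
    - by apply: emeasurable_funM => //; exact: measurable_cst.
    - apply/measurable_EFinP; apply: measurable_funM.
        apply: measurable_funM; first exact: measurable_cst.
        apply: measurable_funM; first exact: measurable_cst.
        apply: (measurableT_comp (measurable_powR _)).
        exact: continuous_measurable_rV.
      apply: measurableT_comp => //; apply: continuous_measurable_rV.
      exact: continuous_trace.
    - move=> y _; rewrite -EFinM lee_fin -/(f y) mulrA -mulrA ler_pM2l ?mulr_gt0//.
      (* With e = N(p - 1)/(pn), rho^e f is at least f^(pstar e + 1), and pstar e + 1 = pstar.
         Exponents can be added only where f is positive, hence the case distinction. *)
      have [fy|fy] := eqVneq (f y) 0.
        by rewrite fy powR0// mulr0.
      have f0 : 0 < f y by rewrite lt_neqAle eq_sym fy normr_ge0.
      apply: (@le_trans _ _ ((f y `^ ps) `^ (n.+1%:R * (p - 1) / (p * n%:R)) * f y)).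
        rewrite -powRrM -[X in _ * X](powRr1 (ltW f0)) -powRD; last first.
          by rewrite (gt_eqF f0) implybT.
        rewrite le_eqVlt; apply/orP; left; apply/eqP; congr (_ `^ _).
        rewrite /ps /pstar -natr1; field.
        by rewrite natr1 !gt_eqF.
      apply: ler_wpM2r; first exact: normr_ge0.
      apply: ge0_ler_powR; rewrite ?nnegrE ?powR_ge0 ?(ltW (rho0 y))//.
        by rewrite divr_ge0 ?mulr_ge0 ?ltW.
      by rewrite lerDl mulr_ge0 ?(ltW e0)// ltW// tail_weight_gt0.
  move: h1; rewrite -IE -/F -EFinM -EFinD lee_fin -/m.
  rewrite -lerBlDr => /(le_trans _); apply.
  rewrite le_eqVlt; apply/orP; left; apply/eqP.
  have -> : lam = trace_const * m `^ (- ((p - 1) / n%:R)).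
    have K0' := ltW K00; have m' : 0 <= m^-1 by rewrite invr_ge0 ltW.
    have b' := ltW beta0.
    rewrite /lam /trace_const -/K0 -/beta (powRM _ K0' m').
    rewrite (powRM _ b') ?mulr_ge0 ?powR_ge0// (powRM _ (powR_ge0 _ _)) ?powR_ge0//.
    rewrite -!powRrM [_^-1 * _]mulrC -mulrA; congr (_ * (_ * _)).
    by rewrite -(powR_inv1 (ltW m0)) -powRrM mulN1r.
  by ring.
(* As eps tends to 0, the lower bound in [key] tends to the constant times F^(1 - (p - 1)/n), and 1
   - (p - 1)/n = p/pstar. A strict failure of the inequality would persist for small eps. *)
rewrite leNgt; apply/negP => rlt.
pose h (eps : R) := trace_const * (F + eps * W) `^ (- ((p - 1) / n%:R)) *
    (p * F - (p - 1) * (F + eps * W)).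
have h0E : trace_const * F `^ (p / ps) = h 0.
  rewrite /h mul0r addr0 (_ : p * F - _ = F); last by ring.
  rewrite -mulrA; congr (_ * _).
  rewrite -[X in _ = _ * X](powRr1 F0) -powRD; last by rewrite (gt_eqF Fp) implybT.
  congr (_ `^ _); rewrite /ps /pstar -natr1; field.
  by rewrite natr1 !gt_eqF.
have cl : {for 0, continuous (fun eps : R => F + eps * W)}.
  by apply: cvgD; [exact: cvg_cst|apply: cvgMl; exact: cvg_id].
have ch : {for 0, continuous h}.
  apply: cvgM.
    apply: cvgMr; have F00 : 0 < F + 0 * W by rewrite mul0r addr0.
    exact: (@continuous_powR_comp _ _ (fun eps : R => F + eps * W) _ 0 F00 cl).
  by apply: cvgB; [exact: cvg_cst|apply: cvgMr; exact: cl].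
have hr : \forall eps \near (0 : R)^'+, r < h eps.
  have chr : h eps @[eps --> (0 : R)^'+] --> h 0 by apply: cvg_at_right_filter; exact: ch.
  have rh : r < h 0 by rewrite -h0E.
  exact: (cvgr_gt (h 0) chr r rh).
have := @nbhs_right_gt R 0 => hp.
have [eps [e0 e1]] := @filter_ex _ _ _ _ (filterI hp hr).
by have := key _ e0; rewrite leNgt e1.
Qed.

End sharp_trace.

(** * Smooth functions *)

Section flat_functions.
Context (R : realType).

(** The exponent a makes the family stable under differentiation: the derivative of [flat a] is a
    combination of [flat (a - 1)] and [flat (a - 2)]. Smoothness then follows by induction on the
    order, for all a at once. *)
Definition flat (a x : R) : R := if 0 < x then x `^ a * expR (- x^-1) else 0.

Lemma flat_ge0 a x : 0 <= flat a x.
Proof. by rewrite /flat; case: ifP => // _; rewrite mulr_ge0 ?powR_ge0 ?expR_ge0. Qed.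

Lemma flat_le0 a x : x <= 0 -> flat a x = 0.
Proof. by rewrite /flat ltNge => ->. Qed.

Lemma flat_gt0 a x : 0 < x -> 0 < flat a x.
Proof. by move=> x0; rewrite /flat x0 mulr_gt0 ?powR_gt0 ?expR_gt0. Qed.

Lemma expRN_inv_le (m : nat) (x : R) : (0 < m)%N -> 0 < x ->
  expR (- x^-1) <= m%:R ^+ m * x ^+ m.
Proof.
move=> m0 x0; have mR : 0 < m%:R :> R by rewrite ltr0n.
rewrite -exprMn expRN -lef_pV2 ?posrE ?invr_gt0 ?expR_gt0 ?exprn_gt0 ?mulr_gt0//.
rewrite invrK -exprVn (_ : x^-1 = m%:R * (m%:R * x)^-1); last by field; rewrite !gt_eqF.
rewrite expRM_natl lerXn2r ?nnegrE ?expR_ge0 ?invr_ge0 ?mulr_ge0 ?(ltW x0)//.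
by apply: le_trans (expR_ge1Dx _); rewrite lerDr.
Qed.

Lemma flat_le_sqr a : exists2 C : R, 0 <= C &
  forall x : R, `|x| <= 1 -> flat a x <= C * x ^+ 2.
Proof.
(* With a + m >= 2, the bound exp(-1/x) <= m^m x^m yields x^a exp(-1/x) <= m^m x^2 for 0 < x <= 1.
   The square makes the difference quotient at 0 tend to 0. *)
pose m := (Num.truncn (Num.max (2 - a) 1)).+1.
have m0 : (0 < m)%N by [].
have am : 2 <= a + m%:R.
  have : Num.max (2 - a) 1 < m%:R by apply: truncnS_gt.
  by rewrite gt_max => /andP[h _]; rewrite -lerBlDl ltW.
exists (m%:R ^+ m); first by rewrite exprn_ge0.
move=> x x1; have [x0|x0] := leP x 0.
  by rewrite flat_le0// mulr_ge0 ?sqr_ge0// exprn_ge0.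
rewrite /flat x0.
apply: (@le_trans _ _ (x `^ a * (m%:R ^+ m * x ^+ m))).
  by rewrite ler_wpM2l ?powR_ge0// expRN_inv_le.
rewrite mulrCA ler_wpM2l ?exprn_ge0//.
rewrite -!powR_mulrn ?(ltW x0)// -powRD ?(gt_eqF x0) ?implybT//.
by apply: ger_powR => //; rewrite x0/= (le_trans (ler_norm _)).
Qed.

Lemma is_derive_flat (a x : R) : is_derive x 1 (flat a) (a * flat (a - 1) x + flat (a - 2) x).
Proof.
case: (ltrgt0P x) => [x0|x0|->].
- apply: (@near_eq_is_derive _ _ _ (fun y => y `^ a * expR (- y^-1))).
    near=> y; rewrite /flat ifT//; near: y.
    exact: lt_nbhsr.
  have Dp := is_derive1_powR a x0.
  have Di : is_derive x 1 (fun y : R => - y^-1) (x ^- 2).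
    have := @is_deriveV R id x 1 1 (lt0r_neq0 x0) (is_derive_id _ _).
    move/is_deriveN => /is_derive_eq; apply.
    by rewrite scaleNr opprK; exact: mulr1.
  have De : is_derive x 1 (fun y : R => expR (- y^-1)) (expR (- x^-1) * x ^- 2).
    exact: (is_derive1_comp (is_derive_expR _) Di).
  apply: (is_derive_eq (is_deriveM Dp De)).
  rewrite /flat x0 /GRing.scale/= (_ : x `^ (a - 2) = x `^ a * x ^- 2); first by ring.
  rewrite powRD; last by rewrite (gt_eqF x0) implybT.
  by rewrite powRN powR_mulrn// ltW.
- rewrite !flat_le0 ?(ltW x0)// mulr0 addr0.
  apply: (@near_eq_is_derive _ R R (cst (0 : R))).
  near=> y; rewrite flat_le0//; near: y.
  by apply: filterS (lt_nbhsl x0) => y /ltW.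
- rewrite !flat_le0// mulr0 addr0.
  have [C C0 hC] := flat_le_sqr a.
  suff H : h^-1 *: ((flat a \o shift 0) (h *: 1) - flat a 0) @[h --> 0^'] --> (0 : R).
    by split; [apply/cvg_ex; exists 0|exact/cvg_lim].
  apply/cvgrPdist_le => e e0.
  near=> h.
  have hne : h != 0 by near: h; exact: nbhs_dnbhs_neq.
  have h1 : `|h| <= 1.
    by near: h; apply: dnbhs0_le.
  have h2 : `|h| <= e / (C + 1).
    by near: h; apply: dnbhs0_le; rewrite divr_gt0// ltr_wpDl.
  rewrite sub0r normrN /= addr0 (flat_le0 _ (lexx 0)) subr0.
  rewrite [_ *: _]mulrC [h *: 1]mulr1 normrM normfV ler_pdivrMr ?normr_gt0//.
  rewrite ger0_norm ?flat_ge0//; apply: (le_trans (hC _ h1)).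
  rewrite -real_normK ?num_real// expr2 mulrA ler_wpM2r//.
  move: h2; rewrite ler_pdivlMr ?ltr_wpDl//; apply: le_trans.
  by rewrite mulrC ler_wpM2l// lerDl.
Unshelve. all: by end_near. Qed.

Lemma continuous_flat a : continuous (flat a).
Proof. by apply: derivable_continuous => x; case: (is_derive_flat a x). Qed.

End flat_functions.

(** * Functions of class C^k *)

Section iterated_partials.
Context (R : realType) (N : nat).
Implicit Types (f g : 'rV[R]_N -> R).

Lemma is_derive_line_comp f (h : R -> R) (x v : 'rV[R]_N) (df dh : R) :
  is_derive x v f df -> is_derive (f x) 1 h dh ->
  is_derive x v (h \o f) (dh * df).
Proof.
move=> Df Dh.
have L (u : 'rV[R]_N -> R) (l : R) :
    is_derive x v u l <-> is_derive (0 : R) 1 (fun s : R => u (x + s *: v)) l.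
  have E : (fun t : R => t^-1 *: (((fun s : R => u (x + s *: v)) \o shift 0) (t *: (1 : R)) -
      u (x + (0 : R) *: v))) =
      (fun t : R => t^-1 *: ((u \o shift x) (t *: v) - u x)).
    apply/funext => t /=; rewrite scale0r !addr0 [x + _]addrC.
    by have -> : t *: (1 : R) = t by exact: mulr1.
  by split=> -[du Du]; split; move: du Du; rewrite /derivable /derive E.
apply/L; have /L Df' := Df.
apply: (@is_derive1_comp R h (fun s : R => f (x + s *: v)) 0 dh df) => //.
by rewrite scale0r addr0.
Qed.

(** [smooth] speaks of words of partial derivatives, which do not behave well under products and
    compositions. This recursive form is closed under both by induction on k, and holding it for all
    k amounts to [smooth]. *)
Fixpoint Ck (k : nat) f : Prop := continuous f /\
  if k is k'.+1 then forall i,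
    (forall x, derivable f x (delta_mx ord0 i)) /\ Ck k' (partial i f) else True.

Lemma Ck_continuous k f : Ck k f -> continuous f. Proof. by case: k => [|k] []. Qed.

Lemma CkS k f : continuous f ->
  (forall i, exists g, (forall x, is_derive x (delta_mx ord0 i) f (g x)) /\ Ck k g) ->
  Ck k.+1 f.
Proof.
move=> cf H; split => // i; have [g [Dg Cg]] := H i.
split=> [x|]; first by case: (Dg x).
rewrite (_ : partial i f = g)//; apply/funext => x.
by rewrite /partial; case: (Dg x).
Qed.

Lemma Ck_is_derive k f i x : Ck k.+1 f -> is_derive x (delta_mx ord0 i) f (partial i f x).
Proof. by move=> [_ /(_ i)[h _]]; split=> //; exact: h. Qed.

Lemma Ck_partial k f i : Ck k.+1 f -> Ck k (partial i f).
Proof. by move=> [_ /(_ i)[]]. Qed.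

Lemma CkW k f : Ck k.+1 f -> Ck k f.
Proof.
elim: k f => [|k IH] f h; first by split=> //; exact: Ck_continuous h.
apply: CkS (Ck_continuous h) _ => i; exists (partial i f); split.
  by move=> x; exact: Ck_is_derive h.
by apply: IH; exact: Ck_partial h.
Qed.

Lemma Ck_smooth f : (forall k, Ck k f) -> smooth f.
Proof.
move=> h s; have {h} : forall k, Ck k (foldr (@partial R N) f s).
  by elim: s => //= i s IH k; apply: Ck_partial; exact: IH.
by move=> h; split=> [|i x]; [exact: Ck_continuous (h 0%N)|case: (h 1%N) => _ /(_ i)[]].
Qed.

Lemma smooth_Ck f k : smooth f -> Ck k f.
Proof.
move=> sf; suff h s : Ck k (foldr (@partial R N) f s) by exact: (h [::]).
elim: k s => [|k IH] s; first by split=> //; case: (sf s).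
split; first by case: (sf s).
by move=> i; split; [move=> x; case: (sf s) => _; exact|exact: (IH (i :: s))].
Qed.

Lemma Ck_cst k (c : R) : Ck k (fun=> c).
Proof.
elim: k c => [|k IH] c; first by split => //; exact: cst_continuous.
apply: CkS; first exact: cst_continuous.
by move=> i; exists (fun=> 0); split=> // x; exact: is_derive_cst.
Qed.

Lemma CkD k f g : Ck k f -> Ck k g -> Ck k (fun x => f x + g x).
Proof.
have cD f' g' : continuous f' -> continuous g' -> continuous (fun x : 'rV[R]_N => f' x + g' x).
  by move=> cf cg x; apply: (@continuousD _ _ _ f' g'); [exact: cf|exact: cg].
elim: k f g => [|k IH] f g Cf Cg.
  by split=> //; apply: cD; [exact: Ck_continuous Cf|exact: Ck_continuous Cg].
apply: CkS; first by apply: cD; [exact: Ck_continuous Cf|exact: Ck_continuous Cg].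
move=> i; exists (fun x => partial i f x + partial i g x); split.
  by move=> x; exact: (is_deriveD (Ck_is_derive i x Cf) (Ck_is_derive i x Cg)).
by apply: IH; exact: Ck_partial.
Qed.

Lemma CkM k f g : Ck k f -> Ck k g -> Ck k (fun x => f x * g x).
Proof.
have cM f' g' : continuous f' -> continuous g' -> continuous (fun x : 'rV[R]_N => f' x * g' x).
  by move=> cf cg x; apply: (@continuousM _ _ f' g'); [exact: cf|exact: cg].
elim: k f g => [|k IH] f g Cf Cg.
  by split=> //; apply: cM; [exact: Ck_continuous Cf|exact: Ck_continuous Cg].
apply: CkS; first by apply: cM; [exact: Ck_continuous Cf|exact: Ck_continuous Cg].
move=> i; exists (fun x => f x * partial i g x + g x * partial i f x); split.
  by move=> x; exact: (is_deriveM (Ck_is_derive i x Cf) (Ck_is_derive i x Cg)).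
by apply: CkD; apply: IH; (exact: CkW) || exact: Ck_partial.
Qed.

Lemma CkN k f : Ck k f -> Ck k (fun x => - f x).
Proof.
move=> Cf; rewrite (_ : (fun _ => _) = fun x => -1 * f x).
  by apply: CkM => //; exact: Ck_cst.
by apply/funext => x; rewrite mulN1r.
Qed.

Lemma Ck_coord k i : Ck k (fun x : 'rV[R]_N => x ord0 i).
Proof.
case: k => [|k]; first by split => //; exact: coord_continuous.
apply: CkS; first exact: coord_continuous.
move=> j; exists (fun=> (i == j)%:R); split; last exact: Ck_cst.
move=> x; suff H : h^-1 *: (((fun x : 'rV[R]_N => x ord0 i) \o shift x) (h *: delta_mx ord0 j)
    - x ord0 i) @[h --> 0^'] --> ((i == j)%:R : R).
  by split; [apply/cvg_ex; eexists; exact: H|exact/cvg_lim].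
apply: cvg_near_cst; near=> h => /=.
rewrite !mxE eqxx addrK scalerA mulVf ?scale1r//.
by near: h; exact: nbhs_dnbhs_neq.
Unshelve. all: by end_near. Qed.

Lemma Ck_sum k m (F : 'I_m -> 'rV[R]_N -> R) :
  (forall j, Ck k (F j)) -> Ck k (fun x => \sum_j F j x).
Proof.
elim: m F => [|m IH] F CF.
  by under eq_fun do rewrite big_ord0; exact: Ck_cst.
under eq_fun do rewrite big_ord_recr/=.
by apply: CkD => //; exact: IH.
Qed.

Lemma Ck_prod k m (F : 'I_m -> 'rV[R]_N -> R) :
  (forall j, Ck k (F j)) -> Ck k (fun x => \prod_j F j x).
Proof.
elim: m F => [|m IH] F CF.
  by under eq_fun do rewrite big_ord0; exact: Ck_cst.
under eq_fun do rewrite big_ord_recr/=.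
by apply: CkM => //; exact: IH.
Qed.

Lemma Ck_flat k a f : Ck k f -> Ck k (fun x => flat a (f x)).
Proof.
have c0 b g : continuous g -> continuous (fun x : 'rV[R]_N => flat b (g x)).
  by move=> cg x; apply: (@continuous_comp _ _ _ g (flat b)); [exact: cg|exact: continuous_flat].
elim: k a f => [|k IH] a f Cf; first by split=> //; apply: c0; exact: Ck_continuous Cf.
apply: CkS; first by apply: c0; exact: Ck_continuous Cf.
move=> i; exists (fun x => (a * flat (a - 1) (f x) + flat (a - 2) (f x)) * partial i f x).
split=> [x|]; first by apply: is_derive_line_comp; [exact: Ck_is_derive Cf|exact: is_derive_flat].
apply: CkM; last exact: Ck_partial Cf.
by apply: CkD; [apply: CkM; first exact: Ck_cst|]; apply: IH; exact: CkW.
Qed.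

Lemma Ck_powR k a f : (forall x, 0 < f x) -> Ck k f -> Ck k (fun x => f x `^ a).
Proof.
move=> f0; have c0 b : continuous f -> continuous (fun x : 'rV[R]_N => f x `^ b).
  by move=> cf x; apply: continuous_powR_comp => //; exact: cf.
elim: k a => [|k IH] a Cf; first by split=> //; apply: c0; exact: Ck_continuous Cf.
apply: CkS; first by apply: c0; exact: Ck_continuous Cf.
move=> i; exists (fun x => (a * f x `^ (a - 1)) * partial i f x).
split=> [x|].
  exact: (@is_derive_line_comp f (fun y : R => y `^ a) _ _ _ _
    (Ck_is_derive i x Cf) (is_derive1_powR a (f0 x))).
apply: CkM; last exact: Ck_partial Cf.
by apply: CkM; [exact: Ck_cst|]; apply: IH; exact: CkW.
Qed.

Lemma C1_Ck f : C1 f <-> Ck 1 f.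
Proof.
split=> [[h1 h2]|h].
  split; first by move=> x; exact: (C1_continuous (conj h1 h2)).
  by move=> i; split=> //; split=> //; exact: h1.
split=> [i|i x]; first exact: (Ck_continuous (Ck_partial i h)).
by case: (Ck_is_derive i x h).
Qed.

End iterated_partials.

(** * Integration by parts *)

Section integration_by_parts.
Context (R : realType).
Local Notation mu := (@lebesgue_measure R).

Definition supported_in n (M : R) (f : 'rV[R]_n -> R) : Prop :=
  forall (x : 'rV[R]_n) j, M < `|x ord0 j| -> f x = 0.

Lemma integral_derive_eq0 (g g' : R -> R) (M : R) :
  (forall t : R, is_derive t 1 g (g' t)) -> continuous g' ->
  (forall t : R, M < `|t| -> g t = 0) -> (forall t : R, M < `|t| -> g' t = 0) ->
  (\int[mu]_t (g' t)%:E = 0)%E.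
Proof.
move=> Dg cg' gM g'M.
pose L : R := `|M| + 1.
have LM : M < L by rewrite /L (le_lt_trans (ler_norm _))// ltrDl.
have L0 : 0 < L by rewrite ltr_wpDl.
have -> : (\int[mu]_t (g' t)%:E = \int[mu]_(t in `](- L)%R, L%R]) (g' t)%:E)%E.
  rewrite [RHS]integral_mkcond; apply: eq_integral => t _.
  rewrite patchE; case: ifPn => // tL; rewrite g'M//.
  apply: (lt_le_trans LM); rewrite ler_normr.
  move: tL; rewrite notin_setE /= in_itv/= => /negP; rewrite negb_and -leNgt -ltNge.
  by case/orP => [|/ltW] h; rewrite ?h ?orbT// lerNr h orbT.
rewrite (integral_itv_derive Dg cg') ?gtrN//.
by rewrite !gM ?subrr// ?normrN (gtr0_norm L0).
Qed.

Lemma continuous_bounded_integrable n (f : 'rV[R]_n -> R) (M : R) :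
  continuous f -> supported_in M f -> (leb R n).-integrable setT (EFin \o f).
Proof.
move=> cf fM.
have cn : continuous (fun y => `|f y|).
  by move=> y; apply: (@continuous_comp _ _ _ f (fun z : R => `|z|));
    [exact: cf|exact: norm_continuous].
have [C hC] := @bounded_support_tail R n (fun y => `|f y|) M cn
  (fun y j h => etrans (congr1 _ (fM y j h)) (normr0 _)).
have mf : measurable_fun setT f by exact: continuous_measurable_rV.
have w0 := @tail_weight_gt0 R n.
have C0 : 0 <= C.
  rewrite -(pmulr_lge0 _ (w0 0)).
  exact: le_trans (normr_ge0 _) (hC _).
apply: (@le_integrable _ _ _ (leb R n) _ measurableT _
  (EFin \o (fun y => (C + 1) * tail_weight y))).
- by apply/measurable_EFinP.
- move=> y _ /=; rewrite lee_fin.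
  have h : 0 <= (C + 1) * tail_weight y by rewrite mulr_ge0 ?(ltW (w0 _)) ?addr_ge0.
  rewrite (ger0_norm h).
  by apply: (le_trans (hC _)); rewrite ler_wpM2r ?(ltW (w0 _))// lerDl.
- apply: (@integrable_tail_weight R n (C + 1)); last by [].
    by apply: continuous_mulrl; exact: continuous_tail_weight.
  by move=> y; rewrite mulr_gt0// ltr_wpDl.
Qed.

Lemma partial_supported_in n (w : 'rV[R]_n -> R) i (M : R) :
  supported_in M w -> supported_in M (partial i w).
Proof.
move=> wM x j xj; rewrite /partial.
rewrite (@near_eq_derive _ _ _ _ (cst 0) x).
  exact: derive_cst.
near=> z; apply: (wM z j); near: z.
have cj : {for x, continuous (fun z : 'rV[R]_n => `|z ord0 j|)}.
  apply: (@continuous_comp _ _ _ (fun z : 'rV[R]_n => z ord0 j) (fun z : R => `|z|)).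
    exact: coord_continuous.
  exact: norm_continuous.
exact: (cvgr_gt _ cj).
Unshelve. all: by end_near. Qed.

Lemma integrable_leb_cons n (f : 'rV[R]_n.+1 -> \bar R) :
  (leb R n.+1).-integrable setT f ->
  (mu \x leb R n)%E.-integrable setT (f \o @cons_rV R n).
Proof.
move=> /integrableP[mf If]; apply/integrableP; split.
  exact: (measurableT_comp mf (@measurable_cons_rV R n)).
move: If; congr (_ < _)%E.
rewrite [LHS](@ge0_integral_pushforward _ _ _ _ _ _ (@measurable_cons_rV R n)
  (mu \x leb R n)%E setT)//.
by apply: measurableT_comp => //.
Qed.

Lemma integral_leb_cons n (f : 'rV[R]_n.+1 -> \bar R) :
  (leb R n.+1).-integrable setT f ->
  (\int[leb R n.+1]_x f x = \int[mu]_t \int[leb R n]_y f (cons_rV (t, y)))%E /\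
  (\int[leb R n.+1]_x f x = \int[leb R n]_y \int[mu]_t f (cons_rV (t, y)))%E.
Proof.
move=> iF; have iF' := integrable_leb_cons iF.
have mf := measurable_int _ iF.
have -> : (\int[leb R n.+1]_x f x = \int[mu \x leb R n]_z (f \o @cons_rV R n) z)%E.
  exact: (@integral_pushforward _ _ _ _ _ _ (@measurable_cons_rV R n)
    (mu \x leb R n)%E setT f mf iF' measurableT).
by rewrite -{1}(integral12_prod_meas1 iF') -(integral21_prod_meas1 iF').
Qed.

Lemma is_derive_cons0 n (w : 'rV[R]_n.+1 -> R) (y : 'rV[R]_n) (t l : R) :
  is_derive (cons_rV (t, y)) (delta_mx ord0 ord0) w l ->
  is_derive t 1 (fun s : R => w (cons_rV (s, y))) l.
Proof.
have E (s : R) : cons_rV (s, y) = cons_rV (0, y) + s *: delta_mx ord0 ord0.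
  apply/rowP => j; rewrite !mxE; case: unliftP => [k ->|->] /=.
    by rewrite mulr0 addr0.
  by rewrite mulr1 add0r.
rewrite E => /is_derive_line.
by rewrite (_ : (fun s : R => w (_ + _)) = (fun s => w (cons_rV (s, y))))//;
  apply/funext => s; rewrite E.
Qed.

Lemma is_derive_consl n (w : 'rV[R]_n.+1 -> R) (y : 'rV[R]_n) (t l : R) j :
  is_derive (cons_rV (t, y)) (delta_mx ord0 (lift ord0 j)) w l ->
  is_derive y (delta_mx ord0 j) (fun z => w (cons_rV (t, z))) l.
Proof.
have E : (fun h : R => h^-1 *: (((fun z => w (cons_rV (t, z))) \o shift y)
      (h *: delta_mx ord0 j) - w (cons_rV (t, y)))) =
    (fun h : R => h^-1 *: ((w \o shift (cons_rV (t, y)))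
      (h *: delta_mx ord0 (lift ord0 j)) - w (cons_rV (t, y)))).
  apply/funext => h /=; congr (_ *: (w _ - _)).
  apply/rowP => k; rewrite !mxE; case: unliftP => [m ->|->] /=.
    by rewrite !mxE !eqxx/= (inj_eq (@lift_inj _ ord0)).
  by rewrite mulr0 add0r.
by move=> [du Du]; split; [rewrite /derivable E|rewrite /derive E].
Qed.

(** Fubini, with [leb] giving access to the first coordinate. If the derivative is in that
    coordinate, the integral along it vanishes by the fundamental theorem of calculus; otherwise
    each slice is a function of the same kind in one variable less. *)
Theorem integral_partial_eq0 n (w : 'rV[R]_n -> R) i (M : R) :
  C1 w -> supported_in M w -> (\int[leb R n]_x (partial i w x)%:E = 0)%E.
Proof.
elim: n w i => [|n IH] w i C1w wM; first by case: i.
have cp : continuous (partial i w) by case: C1w.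
have [E1 E2] := integral_leb_cons
  (continuous_bounded_integrable cp (partial_supported_in i wM)).
have D j x : is_derive x (delta_mx ord0 j) w (partial j w x).
  exact: is_derive_partial.
case: (unliftP ord0 i) cp E1 E2 => [j|] -> cp E1 E2.
- rewrite E1; apply: integral0_eq => t _.
  have Dt k y : is_derive y (delta_mx ord0 k) (fun z : 'rV[R]_n => w (cons_rV (t, z)))
      (partial (lift ord0 k) w (cons_rV (t, y))).
    by apply: is_derive_consl; exact: D.
  have Et k : partial k (fun z : 'rV[R]_n => w (cons_rV (t, z))) =
      (fun y => partial (lift ord0 k) w (cons_rV (t, y))).
    by apply/funext => y; rewrite /partial; case: (Dt k y).
  transitivity (\int[leb R n]_y (partial j (fun z : 'rV[R]_n => w (cons_rV (t, z))) y)%:E)%E.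
    by rewrite Et.
  apply: IH.
    split=> [k|k y]; last by case: (Dt k y).
    rewrite Et => y; apply: (@continuous_comp _ _ _ (fun y : 'rV[R]_n => cons_rV (t, y))
      (partial (lift ord0 k) w)); first exact: continuous_consr.
    by case: C1w => + _; exact.
  by move=> y k yk; apply: (wM _ (lift ord0 k)); rewrite cons_rV_lift.
- rewrite E2; apply: integral0_eq => y _.
  apply: (@integral_derive_eq0 (fun s : R => w (cons_rV (s, y))) _ M).
  + by move=> t; apply: is_derive_cons0; exact: D.
  + move=> t; apply: (@continuous_comp _ _ _ (fun s : R => cons_rV (s, y))
      (partial ord0 w)); first exact: continuous_consl.
    exact: cp.
  + by move=> t tM; apply: (wM _ ord0); rewrite cons_rV0.
  + move=> t tM; apply: (partial_supported_in ord0 wM (_ : _ < `|_ ord0 ord0|)).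
    by rewrite cons_rV0.
Qed.

End integration_by_parts.

Section Lfun_integral.
Context d (T : measurableType d) (R : realType) (mu : {measure set T -> \bar R}).

Lemma LnormE (p : R) (f : T -> R) :
  ('N[mu]_p%:E[EFin \o f] = (\int[mu]_x (`|f x| `^ p)%:E) `^ p^-1)%E.
Proof. by rewrite unlock. Qed.

Lemma Lfun_integralP (p : R) (f : T -> R) : 0 < p ->
  f \in Lfun mu p%:E <->
  measurable_fun setT f /\ (\int[mu]_x (`|f x| `^ p)%:E < +oo)%E.
Proof.
move=> p0; split.
- rewrite inE => /andP[/[!inE]/= mf]; split=> //.
  have := powR_Lnorm mu (EFin \o f) (lt0r_neq0 p0) => /= <-.
  exact: poweR_lty.
- move=> [mf If]; rewrite inE; apply/andP; split; rewrite inE//=.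
  by rewrite /finite_norm LnormE; exact: poweR_lty.
Qed.

End Lfun_integral.

Section test_functions.
Context (R : realType) (n : nat).
Implicit Types (f g : 'rV[R]_n -> R) (A : set 'rV[R]_n).

Lemma compact_closure_bounded A (M : R) :
  (forall x, A x -> forall i, `|x ord0 i| <= M) -> compact (closure A).
Proof.
move=> AM; pose B := [set y : 'rV[R]_n | forall i, `[- M, M]%classic (y ord0 i)].
have cB : compact B.
  by apply: (@rV_compact _ n (fun=> `[- M, M]%classic)) => i; exact: segment_compact.
apply: (subclosed_compact (@closed_closure _ A) cB).
have -> : B = closure B.
  by apply/closure_id; apply: compact_closed cB; exact: norm_hausdorff.
by apply: closure_subset => x /AM xM i; rewrite /= in_itv/= -ler_norml.
Qed.

Lemma compact_supported_in f :
  compact (closure [set x | f x != 0]) -> exists M, supported_in M f.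
Proof.
move=> cA; have [M [_ /(_ (M + 1))]] := compact_bounded cA.
rewrite ltrDl ltr01 => /(_ isT) hM; exists (M + 1) => x j xj.
apply/eqP; apply: contraTT xj => fx; rewrite -leNgt.
have := hM x (@subset_closure _ [set x | f x != 0] x fx).
rewrite /= [X in X <= _ -> _]/Num.norm/= mx_normrE; apply: le_trans.
exact: (le_bigmax _ (fun ij : 'I_1 * 'I_n => `|x ij.1 ij.2|) (ord0, j)).
Qed.

Lemma continuous_bounded_Lp (Omega : set 'rV[R]_n) (p M : R) f : 0 < p ->
  measurable Omega -> continuous f -> supported_in M f -> Lp Omega p f.
Proof.
move=> p0 mO cf fM.
have mf : measurable_fun setT f by exact: continuous_measurable_rV.
have mfO : measurable_fun setT (f \_ Omega).
  by apply/(measurable_restrictT _ mO); exact: measurable_funTS.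
apply/(Lfun_integralP _ _ p0); split => //.
have cfp : continuous (fun x => `|f x| `^ p).
  apply: continuous_powR_ge0 => // x.
  by apply: (@continuous_comp _ _ _ f (fun z : R => `|z|));
    [exact: cf|exact: norm_continuous].
have /integrableP[mfp] : (leb R n).-integrable setT (EFin \o (fun x => `|f x| `^ p)).
  apply: (@continuous_bounded_integrable _ _ _ M cfp) => x j /fM ->.
  by rewrite normr0 powR0 ?gt_eqF.
apply: le_lt_trans; apply: ge0_le_integral => //.
- apply/measurable_EFinP; apply: (measurableT_comp (measurable_powR _)).
  exact: measurableT_comp.
- by apply: measurableT_comp.
- move=> x _ /=; rewrite lee_fin [leRHS]ger0_norm ?powR_ge0//.
  rewrite patchE; case: ifP => // _; rewrite normr0 powR0 ?powR_ge0//.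
  by rewrite gt_eqF.
Qed.

End test_functions.

(** * Uniqueness of weak gradients *)

Section open_boxes.
Context (R : realType) (n : nat).

Definition open_box (a b : 'I_n -> R) : set 'rV[R]_n :=
  [set x | forall i, a i < x ord0 i < b i].

Lemma measurable_open_box a b : measurable (open_box a b).
Proof.
rewrite (_ : open_box a b = \bigcap_(i in [set: 'I_n])
    ((fun x : 'rV[R]_n => x ord0 i) @^-1` `]a i, b i[)).
  apply: fin_bigcap_measurable; first exact: finite_finset.
  move=> i _; rewrite -[X in measurable X]setTI.
  by apply: measurable_coord => //; exact: measurable_itv.
apply/seteqP; split => x h i /=.
  by move=> _; rewrite in_itv/=; exact: h.
by have := h i Logic.I; rewrite /= in_itv.
Qed.

Lemma open_box_setI : setI_closed [set Q : set 'rV[R]_n | exists a b, Q = open_box a b].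
Proof.
move=> _ _ [a [b ->]] [c [d ->]].
exists (fun i => Num.max (a i) (c i)), (fun i => Num.min (b i) (d i)).
apply/seteqP; split => x /=.
  move=> [h1 h2] i; have /andP[? ?] := h1 i; have /andP[? ?] := h2 i.
  by rewrite gt_max lt_min; apply/andP; split; apply/andP.
by move=> h; split=> i; have := h i; rewrite gt_max lt_min => /andP[/andP[? ?] /andP[? ?]];
  apply/andP.
Qed.

Lemma coord_lt_nat (x : 'rV[R]_n) : exists m, forall k i, (m <= k)%N -> `|x ord0 i| < k.+1%:R.
Proof.
exists (Num.truncn (\sum_i `|x ord0 i|)) => k i mk.
have s0 : 0 <= \sum_i `|x ord0 i| by apply: sumr_ge0.
apply: (@le_lt_trans _ _ (\sum_i `|x ord0 i|)).
  by rewrite (bigD1 i)//= lerDl sumr_ge0.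
by apply: (lt_le_trans (truncnS_gt _)); rewrite ler_nat.
Qed.

Lemma open_box_cover : \bigcup_k open_box (fun=> - k.+1%:R) (fun=> k.+1%:R) = setT.
Proof.
apply/seteqP; split => // x _; have [m hm] := coord_lt_nat x.
by exists m => // i; rewrite -ltr_norml; exact: hm.
Qed.

(** Together with [open_box_setI], this makes the boxes a generating system closed under
    intersection, as uniqueness of measures requires. *)
Lemma measurable_open_boxes :
  (measurable : set (set 'rV[R]_n)) = <<s [set Q | exists a b, Q = open_box a b] >>.
Proof.
set G := (X in <<s X >>).
apply/seteqP; split; last first.
  apply: smallest_sub; first exact: sigma_algebra_measurable.
  by move=> _ [a [b ->]]; exact: measurable_open_box.
have mc i : @measurable_fun _ _ (g_sigma_algebraType G) R setT
    (fun x : 'rV[R]_n => x ord0 i).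
  apply: (measurability _ (RGenOpens.measurableE R)).
  move=> _ [_ [c [d ->] <-]]; rewrite setTI.
  rewrite (_ : _ @^-1` _ = \bigcup_k open_box
      (fun j => if j == i then c else - k.+1%:R) (fun j => if j == i then d else k.+1%:R)).
    apply: bigcup_measurable => k _; apply: sub_sigma_algebra.
    by eexists; eexists.
  apply/seteqP; split => x.
    rewrite /= in_itv/= => xi; have [m hm] := coord_lt_nat x; exists m => // j.
    have [->//|_] := eqVneq j i.
    by rewrite -ltr_norml; exact: hm.
  by move=> [k _] /(_ i); rewrite eqxx /= in_itv.
apply: smallest_sub; first exact: smallest_sigma_algebra.
move=> A; rewrite -bigcup_seq/= => -[i _ [Y mY <-]].
exact: (mc i measurableT Y mY).
Qed.

End open_boxes.

Section box_bumps.
Context (R : realType) (n : nat).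
Implicit Types (a b : 'I_n -> R).

Lemma flat0_le1 (x : R) : flat 0 x <= 1.
Proof.
rewrite /flat; case: ifP => // x0; rewrite powRr0 mul1r -expR0 ler_expR.
by rewrite oppr_le0 invr_ge0 ltW.
Qed.

Lemma near_natS_gt (A : R) : \forall k \near \oo, A < k.+1%:R.
Proof.
near=> k; apply: (lt_le_trans (truncnS_gt A)); rewrite ler_nat ltnS.
by near: k; exact: nbhs_infty_ge.
Unshelve. all: by end_near. Qed.

Lemma cvg_flat0 (c : R) : 0 < c -> flat 0 (k.+1%:R * c - 1) @[k --> \oo] --> (1 : R).
Proof.
move=> c0; pose g (k : nat) : R := - (k.+1%:R * c - 1)^-1.
have c1 : \forall k \near \oo, 0 < k.+1%:R * c - 1.
  apply: filterS (near_natS_gt c^-1) => k h.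
  by rewrite subr_gt0 -ltr_pdivrMr// div1r.
have gE : \forall k \near \oo, expR (g k) = flat 0 (k.+1%:R * c - 1).
  by apply: filterS c1 => k h; rewrite /flat h powRr0 mul1r.
have g0 : g k @[k --> \oo] --> (0 : R).
  rewrite -oppr0; apply: cvgN; apply/gtr0_cvgV0; first exact: c1.
  apply/cvgryPge => A; apply: filterS (near_natS_gt ((A + 1) / c)) => k h.
  by rewrite lerBrDr -ler_pdivrMr// ltW.
have : expR (g k) @[k --> \oo] --> expR (0 : R).
  by apply: (@cvg_comp _ _ _ g expR _ _ _ g0); exact: continuous_expR.
by rewrite expR0; apply: cvg_trans; exact: near_eq_cvg gE.
Qed.

(** [flat 0] is exp(-1/s) for s > 0, so each factor tends to 1 inside the box. The shift by 1 keeps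
    the support at distance 1/(k + 1) from the faces, hence its closure inside the open box. *)
Definition box_bump a b (k : nat) (x : 'rV[R]_n) : R :=
  \prod_i (flat 0 (k.+1%:R * (x ord0 i - a i) - 1) *
           flat 0 (k.+1%:R * (b i - x ord0 i) - 1)).

Lemma box_bump_ge0 a b k x : 0 <= box_bump a b k x.
Proof. by apply: prodr_ge0 => i _; rewrite mulr_ge0 ?flat_ge0. Qed.

Lemma box_bump_le1 a b k x : box_bump a b k x <= 1.
Proof.
rewrite [leRHS](_ : 1 = \prod_(i < n) (1 : R)); last by rewrite big1.
apply: ler_prod => i _; rewrite mulr_ge0 ?flat_ge0//=.
by rewrite -[leRHS]mul1r ler_pM ?flat_ge0 ?flat0_le1.
Qed.

Lemma box_bump_neq0 a b k x : box_bump a b k x != 0 ->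
  forall i, a i + k.+1%:R^-1 <= x ord0 i <= b i - k.+1%:R^-1.
Proof.
move=> /prodf_neq0 h i; have := h i isT.
have k0 : 0 < k.+1%:R :> R by rewrite ltr0n.
have H (y : R) : flat 0 (k.+1%:R * y - 1) != 0 -> k.+1%:R^-1 <= y.
  apply: contraNT; rewrite -ltNge => yk; apply/eqP/flat_le0.
  by rewrite subr_le0 -ler_pdivlMl// mulr1 ltW.
rewrite mulf_eq0 negb_or => /andP[/H h1 /H h2].
by apply/andP; split; [rewrite -lerBrDl|rewrite lerBrDl -lerBrDr].
Qed.

Lemma box_bump_out a b k x : ~ open_box a b x -> box_bump a b k x = 0.
Proof.
move=> nx; apply/eqP; apply/negPn/negP => /box_bump_neq0 h; apply: nx => i.
have k0 : 0 < k.+1%:R^-1 :> R by rewrite invr_gt0 ltr0n.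
have /andP[h1 h2] := h i; apply/andP; split.
  by apply: lt_le_trans h1; rewrite ltrDl.
by apply: (le_lt_trans h2); rewrite gtrBl.
Qed.

Lemma cvg_box_bump a b x : box_bump a b k x @[k --> \oo] --> (\1_(open_box a b) x : R).
Proof.
have [h|h] := pselect (open_box a b x); last first.
  rewrite indicE memNset//; under eq_fun do rewrite (box_bump_out _ h).
  exact: cvg_cst.
rewrite indicE mem_set//=.
rewrite (_ : 1%:R = \prod_(i < n) (1 : R)); last by rewrite big1.
apply: cvg_big => //; first by move=> z; apply: mul_continuous.
move=> i _; rewrite -[X in _ --> X]mulr1; have /andP[h1 h2] := h i.
by apply: cvgM; apply: cvg_flat0; rewrite subr_gt0.
Qed.

Lemma smooth_box_bump a b k : smooth (box_bump a b k).
Proof.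
apply: Ck_smooth => m; apply: Ck_prod => i.
apply: CkM; apply: Ck_flat; apply: CkD; try exact: Ck_cst;
  (apply: CkM; first exact: Ck_cst); apply: CkD.
- exact: Ck_coord.
- exact: Ck_cst.
- exact: Ck_cst.
- by apply: CkN; exact: Ck_coord.
Qed.

End box_bumps.

Section box_density.
Context (R : realType) (n : nat) (p : R) (f : 'rV[R]_n -> R).
Hypotheses (p1 : 1 <= p) (mf : measurable_fun setT f).
Hypothesis fp : (\int[leb R n]_x (`|f x| `^ p)%:E < +oo)%E.

Let p0 : 0 < p. Proof. exact: lt_le_trans p1. Qed.

Lemma indic_open_box_le (a b : 'I_n -> R) : exists C : R, 0 <= C /\
  forall x, \1_(open_box a b) x <= C * tail_weight x.
Proof.
pose M : R := \sum_i (`|a i| + `|b i|).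
have aM i : `|a i| + `|b i| <= M.
  by rewrite /M (bigD1 i)//= lerDl sumr_ge0// => j _; rewrite addr_ge0.
(* A continuous function of bounded support that is at least 1 on the box, where every |x_i| is at
   most M. *)
pose h (x : 'rV[R]_n) := \prod_i Num.max 0 (M + 1 - `|x ord0 i|).
have ch : continuous h.
  apply: continuous_prod_ord => i x; apply: (@continuous_max _ _ (fun=> 0) (fun x : 'rV[R]_n => M + 1 - `|x ord0 i|)).
    exact: cst_continuous.
  apply: (@continuousB _ _ _ (fun=> M + 1) (fun x : 'rV[R]_n => `|x ord0 i|)).
    exact: cst_continuous.
  apply: (@continuous_comp _ _ _ (fun z : 'rV[R]_n => z ord0 i) (fun z : R => `|z|)).
    exact: coord_continuous.
  exact: norm_continuous.
have hM : supported_in (M + 1) h.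
  move=> x j xj; rewrite /h (bigD1 j)//= max_l ?mul0r//.
  by rewrite subr_le0 ltW.
have [C hC] := bounded_support_tail ch hM; exists C; split.
  rewrite -(pmulr_lge0 _ (tail_weight_gt0 (0 : 'rV[R]_n))).
  apply: le_trans (hC _); apply: prodr_ge0 => i _.
  by rewrite le_max lexx.
move=> x; apply: le_trans (hC x); rewrite indicE.
have [xQ|xQ] := boolP (x \in open_box a b); last first.
  by apply: prodr_ge0 => i _; rewrite le_max lexx.
rewrite [leLHS](_ : _ = \prod_(i < n) (1 : R)); last by rewrite big1.
apply: ler_prod => i _; rewrite ler01/= le_max; apply/orP; right.
rewrite lerBrDl -lerBrDr addrK; apply: le_trans (aM i).
move: xQ; rewrite inE => /(_ i)/andP[/ltW h1 /ltW h2].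
have [x0|x0] := leP 0 (x ord0 i).
  by rewrite ger0_norm//; apply: (le_trans h2); rewrite (le_trans (ler_norm _))// lerDr.
rewrite ltr0_norm// lerNl; apply: le_trans h1.
by rewrite opprD lerBlDl (le_trans (_ : - `|a i| <= a i)) ?lerDr//; rewrite lerNl -normrN ler_norm.
Qed.

Lemma norm_le_powR (x : R) : `|x| <= 1 + `|x| `^ p.
Proof.
have [h|h] := leP `|x| 1; first by rewrite (le_trans h)// lerDl powR_ge0.
by rewrite ler_wpDl//; apply: le1r_powR => //; exact: ltW.
Qed.

Lemma integrable_box_dominant (C : R) : 0 <= C ->
  (leb R n).-integrable setT (fun x => (C * tail_weight x + `|f x| `^ p)%:E).
Proof.
move=> C0.
have mfp : measurable_fun setT (fun x => `|f x| `^ p).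
  by apply: (measurableT_comp (measurable_powR _)); exact: measurableT_comp.
have mw : measurable_fun setT (fun x : 'rV[R]_n => C * tail_weight x).
  apply: continuous_measurable_rV; apply: continuous_mulrl.
  exact: continuous_tail_weight.
rewrite (_ : (fun _ => _) = (fun x : 'rV[R]_n => (C * tail_weight x)%:E) \+
  (fun x => (`|f x| `^ p)%:E))%E; last by apply/funext.
apply: integrableD => //; apply/integrableP; split.
- by apply/measurable_EFinP.
- under eq_integral do rewrite gee0_abs ?lee_fin ?mulr_ge0 ?(ltW (tail_weight_gt0 _))// EFinM.
  rewrite ge0_integralZl//; last 2 first.
  + by apply/measurable_EFinP; apply: continuous_measurable_rV; exact: continuous_tail_weight.
  + by move=> x _; rewrite lee_fin ltW// tail_weight_gt0.
  by rewrite lte_mul_pinfty ?lee_fin// integral_tail_weight.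
- by apply/measurable_EFinP.
- by under eq_integral do rewrite gee0_abs ?lee_fin ?powR_ge0//.
Qed.

Lemma bump_dominated (a b : 'I_n -> R) (C h : R) x :
  (forall x, \1_(open_box a b) x <= C * tail_weight x) -> 0 <= C ->
  0 <= h -> h <= \1_(open_box a b) x ->
  `|f x * h| <= C * tail_weight x + `|f x| `^ p.
Proof.
move=> hC C0 h0 h1; rewrite normrM (ger0_norm h0).
have Cw : 0 <= C * tail_weight x by rewrite mulr_ge0// ltW// tail_weight_gt0.
apply: (@le_trans _ _ ((1 + `|f x| `^ p) * \1_(open_box a b) x)).
  by rewrite ler_pM// norm_le_powR.
have := hC x; rewrite indicE; case: (x \in _) => h2; last by rewrite mulr0 addr_ge0// powR_ge0.
by rewrite mulr1 lerD2r.
Qed.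

Lemma integral_box_bump_cvg (a b : 'I_n -> R) :
  (forall k, \int[leb R n]_x (f x * box_bump a b k x)%:E = 0)%E ->
  (\int[leb R n]_x (f x * \1_(open_box a b) x)%:E = 0)%E.
Proof.
move=> h0; have [C [C0 hC]] := indic_open_box_le a b.
have := @dominated_convergence _ _ _ (leb R n) setT measurableT
  (fun k x => (f x * box_bump a b k x)%:E) (fun x => (f x * \1_(open_box a b) x)%:E)
  (fun x => (C * tail_weight x + `|f x| `^ p)%:E).
case.
- move=> k; apply/measurable_EFinP; apply: measurable_funM => //.
  by apply: continuous_measurable_rV; exact: Ck_continuous (smooth_Ck 0 (smooth_box_bump _ _ _)).
- apply/measurable_EFinP; apply: measurable_funM => //.
  by apply: measurable_indic; exact: measurable_open_box.
- apply: aeW => x _; apply: cvg_EFin; first by apply: nearW.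
  by apply: cvgMr; exact: cvg_box_bump.
- exact: integrable_box_dominant.
- apply: aeW => x k _; rewrite abse_EFin lee_fin.
  apply: (@bump_dominated a b) => //; first exact: box_bump_ge0.
  have [xQ|xQ] := pselect (open_box a b x).
    by rewrite indicE mem_set// box_bump_le1.
  by rewrite (box_bump_out _ xQ) indicE.
move=> _ _; under [X in X @ \oo]eq_fun do rewrite h0.
by move/(@cvg_lim _ (@ereal_hausdorff R)); rewrite lim_cst.
Qed.

Lemma integrable_open_box (a b : 'I_n -> R) :
  (leb R n).-integrable setT (fun x => (f x * \1_(open_box a b) x)%:E).
Proof.
have [C [C0 hC]] := indic_open_box_le a b.
apply: (le_integrable _ _ _ (integrable_box_dominant C0)) => //.
  apply/measurable_EFinP; apply: measurable_funM => //.
  by apply: measurable_indic; exact: measurable_open_box.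
move=> x _; rewrite lee_fin; apply: le_trans (ler_norm _).
by apply: (@bump_dominated a b).
Qed.

(** The positive and negative parts are densities of two measures that agree on boxes, where they
    are finite because f is in L^p with p >= 1; hence they agree on all measurable sets. On the set
    where the positive part is positive the negative part vanishes, so both integrals are 0. *)
Theorem ae_eq0_open_box :
  (forall a b : 'I_n -> R, \int[leb R n]_x (f x * \1_(open_box a b) x)%:E = 0)%E ->
  ae_eq (leb R n) setT f (cst 0).
Proof.
move=> h0.
pose fP (x : 'rV[R]_n) : R := Num.max (f x) 0.
pose fN (x : 'rV[R]_n) : R := Num.max (- f x) 0.
have fP0 x : 0 <= fP x by rewrite le_max lexx orbT.
have fN0 x : 0 <= fN x by rewrite le_max lexx orbT.
have mP : measurable_fun setT fP by exact: measurable_maxr.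
have mN : measurable_fun setT fN.
  by apply: measurable_maxr => //; exact: measurableT_comp.
have fE x : f x = fP x - fN x.
  by rewrite /fP /fN; case: (leP (f x) 0) => h;
    [rewrite max_l ?oppr_ge0// sub0r opprK|rewrite max_r ?subr0// oppr_le0 ltW].
have absE x : `|f x| = fP x + fN x.
  rewrite /fP /fN; case: (leP (f x) 0) => h.
    by rewrite max_l ?oppr_ge0// add0r ler0_norm.
  by rewrite max_r ?addr0 ?gtr0_norm// oppr_le0 ltW.
have PQ (g : 'rV[R]_n -> R) (mg : measurable_fun setT g) (a b : 'I_n -> R) : (forall x, 0 <= g x) -> (forall x, g x <= `|f x|) ->
    (\int[leb R n]_(x in open_box a b) (g x)%:E < +oo)%E.
  move=> g0 gf; have /integrableP[_] := integrable_open_box a b.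
  apply: le_lt_trans; rewrite integral_mkcond; apply: ge0_le_integral => //.
  - by move=> x _; rewrite patchE; case: ifP => // _; rewrite lee_fin.
  - by apply: measurable_patch0; [exact: measurable_open_box|apply/measurable_EFinP].
  - apply: measurableT_comp => //; apply/measurable_EFinP; apply: measurable_funM => //.
    by apply: measurable_indic; exact: measurable_open_box.
  - move=> x _; rewrite patchE indicE /=; case: ifP => _; rewrite ?mulr1 ?mulr0 ?normr0 ?lee_fin//.
have gP x : fP x <= `|f x| by rewrite absE lerDl.
have gN x : fN x <= `|f x| by rewrite absE lerDr.
have mQ := @measurable_open_box R n.
have boxE (a b : 'I_n -> R) : (\int[leb R n]_(x in open_box a b) (fP x)%:E =
                 \int[leb R n]_(x in open_box a b) (fN x)%:E)%E.
  have iP (g : 'rV[R]_n -> R) : measurable_fun setT g -> (forall x, 0 <= g x) -> (forall x, g x <= `|f x|) ->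
      (leb R n).-integrable (open_box a b) (fun x => (g x)%:E).
    move=> mg g0 gf; apply/integrableP; split.
      by apply: measurable_funTS; apply/measurable_EFinP.
    by under eq_integral do rewrite gee0_abs ?lee_fin//; exact: PQ.
  have iPP := iP _ mP fP0 gP; have iPN := iP _ mN fN0 gN.
  have : (\int[leb R n]_(x in open_box a b) (f x)%:E = 0)%E.
    rewrite integral_mkcond -(h0 a b); apply: eq_integral => x _.
    by rewrite patchE indicE; case: ifP => _; rewrite ?mulr1 ?mulr0.
  under eq_integral do rewrite fE EFinB.
  rewrite integralB//; move/eqP; rewrite sube_eq ?add0e; first by move/eqP.
  - exact: integrable_fin_num.
  - rewrite fin_num_adde_defl//; exact: integrable_fin_num.
have mE A : measurable A -> (\int[leb R n]_(x in A) (fP x)%:E =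
                 \int[leb R n]_(x in A) (fN x)%:E)%E.
  apply: (@measure_unique _ R _ _ (fun k : nat => open_box (fun=> - k.+1%:R) (fun=> k.+1%:R))
    (@measurable_open_boxes R n) (@open_box_setI R n) _ (@open_box_cover R n)
    (density_measure (leb R n) mP fP0) (density_measure (leb R n) mN fN0)).
  - by move=> k; eexists; eexists.
  - by move=> _ [a [b ->]]; exact: boxE.
  - by move=> k; exact: PQ.
have z1 : (\int[leb R n]_x (fP x)%:E = 0)%E.
  have mA : measurable [set x | 0 < fP x].
    have := mP measurableT `]0, +oo[%classic (measurable_itv _); rewrite setTI.
    by congr (measurable _); apply/seteqP; split => x /=; rewrite in_itv/= andbT.
  rewrite (_ : \int[leb R n]_x _ = \int[leb R n]_(x in [set x | 0 < fP x]%R) (fP x)%:E)%E.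
    rewrite mE//; apply: integral0_eq => x /=; rewrite /fP /fN lt_max ltxx orbF => fx.
    by rewrite max_r// oppr_le0 ltW.
  rewrite [RHS]integral_mkcond; apply: eq_integral => x _.
  rewrite patchE; case: ifPn => //; rewrite notin_setE /= => /negP; rewrite -leNgt => h.
  by congr (_%:E); apply/eqP; rewrite eq_le h fP0.
have z2 : (\int[leb R n]_x (fN x)%:E = 0)%E by rewrite -mE.
have : (\int[leb R n]_x `|(f x)%:E| = 0)%E.
  under eq_integral do rewrite abse_EFin absE EFinD.
  rewrite ge0_integralD ?z1 ?z2 ?adde0//.
  - by move=> x _; rewrite lee_fin.
  - by apply/measurable_EFinP.
  - by move=> x _; rewrite lee_fin.
  - by apply/measurable_EFinP.
move/(ae_eq_integral_abs (leb R n) measurableT _).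
have mfE : measurable_fun setT (fun x => (f x)%:E) by apply/measurable_EFinP.
move=> /(_ mfE); apply: filterS => x h /h[].
by [].
Qed.

End box_density.

Section test_function_facts.
Context (R : realType) (n : nat).
Implicit Types (phi psi : 'rV[R]_n -> R) (Omega : set 'rV[R]_n).

Lemma test_fun_C1 Omega phi : test_fun Omega phi -> C1 phi.
Proof. by case=> sf _ _; apply/C1_Ck; exact: smooth_Ck. Qed.

Lemma test_fun_supported Omega phi : test_fun Omega phi -> exists M, supported_in M phi.
Proof. by case=> _ cf _; exact: compact_supported_in. Qed.

Lemma test_fun_sub Omega Omega' phi : Omega `<=` Omega' ->
  test_fun Omega phi -> test_fun Omega' phi.
Proof. by move=> h [? ? h']; split=> //; exact: subset_trans h. Qed.

Lemma test_fun_out Omega phi x : test_fun Omega phi -> ~ Omega x ->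
  phi x = 0 /\ forall i, partial i phi x = 0.
Proof.
move=> [_ _ sO] Ox.
have nx : ~ closure [set x | phi x != 0] x by move/sO.
have nr : \forall y \near x, phi y = 0.
  have : open_nbhs x (~` closure [set x | phi x != 0]).
    by split=> //; apply: closed_openC; exact: closed_closure.
  move/open_nbhs_nbhs; apply: filterS => y ny.
  apply/eqP; apply: contrapT => /negP h; apply: ny; exact: subset_closure.
split; first exact: nbhs_singleton nr.
move=> i; rewrite /partial (@near_eq_derive _ _ _ _ (cst 0) x).
  exact: derive_cst.
exact: nr.
Qed.

Lemma supported_bounded phi (M : R) : continuous phi -> supported_in M phi ->
  exists2 B : R, 0 <= B & forall x, `|phi x| <= B.
Proof.
move=> cphi sM.
have cn : continuous (fun y => `|phi y|).
  by move=> y; apply: (@continuous_comp _ _ _ phi (fun z : R => `|z|));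
    [exact: cphi|exact: norm_continuous].
have [C hC] := @bounded_support_tail R n (fun y => `|phi y|) M cn
  (fun y j h => etrans (congr1 _ (sM y j h)) (normr0 _)).
have C0 : 0 <= C.
  rewrite -(pmulr_lge0 _ (tail_weight_gt0 (0 : 'rV[R]_n))).
  exact: le_trans (normr_ge0 _) (hC _).
exists C => // x; apply: (le_trans (hC x)); rewrite -[leRHS]mulr1 ler_wpM2l//.
rewrite [leRHS](_ : 1 = \prod_(i < n) (1 : R)); last by rewrite big1.
apply: ler_prod => i _; rewrite ltW ?profile_gt0//=.
rewrite -[leRHS](@powRr0 R (1 + x ord0 i ^+ 2)) /profile; apply: ler_powR.
  by rewrite lerDl sqr_ge0.
by rewrite oppr_le0 divr_ge0.
Qed.

Lemma integrable_Lp_mul (p M : R) (g phi : 'rV[R]_n -> R) : 1 <= p ->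
  measurable_fun setT g -> (\int[leb R n]_x (`|g x| `^ p)%:E < +oo)%E ->
  continuous phi -> supported_in M phi ->
  (leb R n).-integrable setT (fun x => (g x * phi x)%:E).
Proof.
move=> p1 mg gp cphi sM.
have [B B0 hB] := supported_bounded cphi sM.
have mgp : measurable_fun setT (fun x => `|g x| `^ p).
  by apply: (measurableT_comp (measurable_powR _)); exact: measurableT_comp.
have mphi : measurable_fun setT phi by exact: continuous_measurable_rV.
have i1 := continuous_bounded_integrable cphi sM.
have i2 : (leb R n).-integrable setT (fun x => (B * `|g x| `^ p)%:E).
  apply/integrableP; split.
    by apply/measurable_EFinP; apply: measurable_funM => //; exact: measurable_cst.
  under eq_integral do rewrite gee0_abs ?lee_fin ?mulr_ge0 ?powR_ge0// EFinM.
  rewrite ge0_integralZl//.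
  - by rewrite lte_mul_pinfty ?lee_fin.
  - by apply/measurable_EFinP.
have i1' := integrable_abse i1.
apply: (le_integrable _ _ _ (integrableD _ i1' i2)) => //.
  by apply/measurable_EFinP; exact: measurable_funM.
move=> x _; rewrite /= lee_fin normrM [leRHS]ger0_norm; last first.
  by rewrite addr_ge0// mulr_ge0// powR_ge0.
apply: (@le_trans _ _ ((1 + `|g x| `^ p) * `|phi x|)).
  by rewrite ler_wpM2r// norm_le_powR.
by rewrite mulrDl mul1r lerD2l mulrC ler_wpM2r ?powR_ge0.
Qed.

Lemma Rintegral_patch (Omega : set 'rV[R]_n) (g phi : 'rV[R]_n -> R) :
  \int[leb R n]_(x in Omega) (g x * phi x) =
  fine (\int[leb R n]_x ((g \_ Omega) x * phi x)%:E)%E.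
Proof.
rewrite /Rintegral integral_mkcond; congr fine; apply: eq_integral => x _.
by rewrite !patchE; case: ifP => // _; rewrite mul0r.
Qed.

Lemma weak_grad_C1 Omega phi : C1 phi -> weak_grad Omega phi (grad phi).
Proof.
move=> Cphi psi tpsi i.
have [M sM] := test_fun_supported tpsi.
have Cpsi := test_fun_C1 tpsi.
have cphi := C1_continuous Cphi; have cpsi := C1_continuous Cpsi.
have Cw : C1 (fun x => phi x * psi x) by apply/C1_Ck; apply: CkM; exact/C1_Ck.
have sw : supported_in M (fun x => phi x * psi x).
  by move=> x j h; rewrite (sM _ _ h) mulr0.
have s1 : supported_in M (fun x => phi x * partial i psi x).
  by move=> x j h; rewrite (partial_supported_in i sM h) mulr0.
have s2 : supported_in M (fun x => partial i phi x * psi x).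
  by move=> x j h; rewrite (sM _ _ h) mulr0.
have cM (f g : 'rV[R]_n -> R) : continuous f -> continuous g -> continuous (fun x : 'rV[R]_n => f x * g x).
  by move=> cf cg x; apply: (@continuousM _ _ f g); [exact: cf|exact: cg].
have i1 := continuous_bounded_integrable (cM _ _ cphi (proj1 Cpsi i)) s1.
have i2 := continuous_bounded_integrable (cM _ _ (proj1 Cphi i) cpsi) s2.
have wE x : partial i (fun x => phi x * psi x) x =
    phi x * partial i psi x + partial i phi x * psi x.
  have D1 := is_derive_partial Cphi x i; have D2 := is_derive_partial Cpsi x i.
  have [_ DE] : is_derive x (delta_mx ord0 i) (fun x => phi x * psi x) _ := is_deriveM D1 D2.
  by rewrite [partial i phi x * _]mulrC; exact: DE.
have := integral_partial_eq0 i Cw sw.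
under eq_integral do rewrite wE EFinD.
rewrite (integralD measurableT i1 i2) /Rintegral.
have E (h : 'rV[R]_n -> R) : (forall x, ~ Omega x -> h x = 0) ->
    (\int[leb R n]_(x in Omega) (h x)%:E = \int[leb R n]_x (h x)%:E)%E.
  move=> h0; rewrite integral_mkcond; apply: eq_integral => x _.
  rewrite patchE; case: ifPn => //; rewrite notin_setE => /h0 ->//.
rewrite (E (fun x => phi x * partial i psi x)); last first.
  by move=> x /(test_fun_out tpsi)[_ ->]; rewrite mulr0.
rewrite (E (fun x => grad phi x ord0 i * psi x)); last first.
  by move=> x /(test_fun_out tpsi)[-> _]; rewrite mulr0.
rewrite (_ : (\int[leb R n]_x (grad phi x ord0 i * psi x)%:E)%E =
  (\int[leb R n]_x (partial i phi x * psi x)%:E)%E); last first.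
  by apply: eq_integral => x _; rewrite mxE.
have f1 := integrable_fin_num measurableT i1.
have f2 := integrable_fin_num measurableT i2.
move: f1 f2 => /=; case: (integral _ _ _) => // a _; case: (integral _ _ _) => // b _ [] /=.
by move/eqP; rewrite addr_eq0 => /eqP.
Qed.

End test_function_facts.

Section weak_gradient_uniqueness.
Context (R : realType) (n : nat) (p : R).
Hypothesis p1 : 1 <= p.
Local Notation H := (@half_space R n.+1).

Let p0 : 0 < p. Proof. exact: lt_le_trans p1. Qed.

Lemma test_box_bump (a b : 'I_n.+1 -> R) k : 0 <= a ord_max -> test_fun H (box_bump a b k).
Proof.
move=> a0; have k0 : 0 < k.+1%:R^-1 :> R by rewrite invr_gt0 ltr0n.
split; first exact: smooth_box_bump.
- apply: (@compact_closure_bounded _ _ _ (\sum_i (`|a i| + `|b i|))) => x /box_bump_neq0 h i.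
  have /andP[h1 h2] := h i.
  apply: (@le_trans _ _ (`|a i| + `|b i|)); last first.
    by rewrite (bigD1 i)//= lerDl sumr_ge0// => j _; rewrite addr_ge0.
  rewrite ler_norml; apply/andP; split.
    rewrite opprD lerBlDr; apply: (@le_trans _ _ (a i)).
      by rewrite lerNl -normrN ler_norm.
    by apply: (@le_trans _ _ (x ord0 i)); rewrite ?lerDl//; apply: le_trans h1; rewrite lerDl ltW.
  apply: (le_trans h2); rewrite lerBlDr; apply: (@le_trans _ _ `|b i|); first exact: ler_norm.
  by rewrite -addrA addrCA lerDl addr_ge0// ltW.
- pose B := (fun x : 'rV[R]_n.+1 => x ord0 ord_max) @^-1` [set s | a ord_max + k.+1%:R^-1 <= s].
  have cB : closed B.
    apply: closed_comp; last exact: closed_ge.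
    by move=> x _; exact: coord_continuous.
  apply: (@subset_trans _ B).
    rewrite [X in _ `<=` X](closure_id B).1//; apply: closure_subset => x /box_bump_neq0 /(_ ord_max).
    by case/andP.
  move=> x Bx; apply/set_mem; rewrite inE => i iE.
  have -> : i = ord_max by apply/val_inj; case: iE.
  by apply: lt_le_trans Bx; rewrite ltr_wpDl.
Qed.

Lemma ae_eq0_half_space (f : 'rV[R]_n.+1 -> R) : measurable_fun setT f ->
  (\int[leb R n.+1]_x (`|f x| `^ p)%:E < +oo)%E -> (forall x, ~ H x -> f x = 0) ->
  (forall phi, test_fun H phi -> \int[leb R n.+1]_x (f x * phi x)%:E = 0)%E ->
  ae_eq (leb R n.+1) setT f (cst 0).
Proof.
move=> mf fp fH f0; apply: (ae_eq0_open_box p1 mf fp) => a b.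
(* Where f can be nonzero the last coordinate is positive, so cutting the box at height 0 changes
   nothing, and the bumps of the cut box are test functions of the half-space. *)
pose a' i := if i == ord_max then Num.max (a i) 0 else a i.
transitivity (\int[leb R n.+1]_x (f x * \1_(open_box a' b) x)%:E)%E.
  apply: eq_integral => x _; rewrite !indicE.
  have [xH|xH] := pselect (H x); last by rewrite fH// !mul0r.
  suff -> : (x \in open_box a b) = (x \in open_box a' b) by [].
  have x0 : 0 < x ord0 ord_max by exact: xH.
  by apply/idP/idP; rewrite !inE => h i; have := h i; rewrite /a';
    case: eqP => // ->; rewrite gt_max x0 andbT.
apply: (integral_box_bump_cvg p1 mf fp) => k; apply: f0; apply: test_box_bump.
by rewrite /a' eqxx le_max lexx orbT.
Qed.

(** The infimum ranges over arbitrary weak gradients G of u, while convergence of approximations to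
    u comes with a weak gradient of its own. This identifies the two. *)
Lemma weak_grad_unique u G G' :
  W1p_grad H p u G -> W1p_grad H p u G' -> forall i,
  {ae leb R n.+1, forall x, H x -> G x ord0 i = G' x ord0 i}.
Proof.
move=> [_ LG wG] [_ LG' wG'] i.
have /(Lfun_integralP _ _ p0)[mG iG] := LG i.
have /(Lfun_integralP _ _ p0)[mG' iG'] := LG' i.
set g := (fun x => G x ord0 i) \_ H in mG iG.
set g' := (fun x => G' x ord0 i) \_ H in mG' iG'.
suff : ae_eq (leb R n.+1) setT (fun x => g x - g' x) (cst 0).
  apply: filterS => x /(_ Logic.I) /= /eqP; rewrite subr_eq0 => /eqP + Hx.
  by rewrite /g /g' !patchE mem_set.
have /(Lfun_integralP _ _ p0)[mf fp] :
    (fun x => g x - g' x) \in Lfun (leb R n.+1) p%:E.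
  have p1E : (1 <= p%:E)%E by rewrite lee_fin.
  have [_ hD] := Lfun_addr_closed (leb R n.+1) p1E.
  apply: (hD g (- g')).
    by apply/(Lfun_integralP _ _ p0).
  apply: (Lfun_oppr_closed (mu := leb R n.+1)).
  by apply/(Lfun_integralP _ _ p0).
apply: ae_eq0_half_space => //.
  by move=> x xH; rewrite /g /g' !patchE memNset// subr0.
move=> phi tphi; have [M sM] := test_fun_supported tphi.
have cphi := C1_continuous (test_fun_C1 tphi).
have I1 := integrable_Lp_mul p1 mG iG cphi sM.
have I2 := integrable_Lp_mul p1 mG' iG' cphi sM.
under eq_integral do rewrite mulrBl EFinB.
rewrite integralB//.
have : fine (\int[leb R n.+1]_x (g x * phi x)%:E)%E =
       fine (\int[leb R n.+1]_x (g' x * phi x)%:E)%E.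
  rewrite -(Rintegral_patch H (fun x => G x ord0 i)) -(Rintegral_patch H (fun x => G' x ord0 i)).
  by apply: oppr_inj; rewrite -wG// -wG'.
have f1 := integrable_fin_num measurableT I1.
have f2 := integrable_fin_num measurableT I2.
by move=> E; rewrite -(fineK f1) -(fineK f2) E subee.
Qed.

End weak_gradient_uniqueness.

(** * The trace inequality on W^{1,p} *)

Section Lp_limits.
Context d (T : measurableType d) (R : realType) (mu : {measure set T -> \bar R}).
Local Open Scope ereal_scope.

(** Along the subsequence the integrals are at most 2^(-k - 1). The sum of the p-th powers is
    therefore integrable, hence finite almost everywhere, and its terms tend to 0. *)
Lemma ae_subsequence (D : set T) (f : nat -> T -> R) (p : R) : (0 < p)%R ->
  measurable D -> (forall k, measurable_fun D (f k)) ->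
  (forall e : R, (0 < e)%R ->
     \forall k \near \oo, \int[mu]_(x in D) (`|f k x| `^ p)%:E <= e%:E) ->
  exists2 s : nat -> nat, forall k, (k <= s k)%N &
    {ae mu, forall x, D x -> f (s k) x @[k --> \oo] --> 0%R}.
Proof.
move=> p0 mD mf h.
have [s hs] : {s : nat -> nat & forall k, (k <= s k)%N /\
    \int[mu]_(x in D) (`|f (s k) x| `^ p)%:E <= (1 / (2 ^ k.+1)%:R)%:E}.
  apply: (@choice _ _ (fun k m => (k <= m)%N /\
    \int[mu]_(x in D) (`|f m x| `^ p)%:E <= (1 / (2 ^ k.+1)%:R)%:E)) => k.
  have e0 : (0 < 1 / (2 ^ k.+1)%:R :> R)%R by rewrite divr_gt0// ltr0n expn_gt0.
  have [m [hm1 hm2]] := @filter_ex _ _ _ _ (filterI (nbhs_infty_ge k) (h _ e0)).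
  by exists m.
exists s => [k|]; first by case: (hs k).
pose v k x := (`|f (s k) x| `^ p)%:E.
have mv k : measurable_fun D (v k).
  apply/measurable_EFinP; apply: (measurableT_comp (measurable_powR _)).
  by apply: measurableT_comp => //; exact: mf.
have v0 k x : D x -> 0 <= v k x by move=> _; rewrite lee_fin powR_ge0.
have iv : mu.-integrable D (fun x => \sum_(k <oo) v k x).
  apply/integrableP; split.
    by apply: ge0_emeasurable_sum => // k x Dx _; exact: v0.
  rewrite (_ : \int[mu]_(x in D) _ = \int[mu]_(x in D) \sum_(k <oo) v k x); last first.
    by apply: eq_integral => x /set_mem Dx; rewrite gee0_abs// nneseries_ge0// => k _ _; exact: v0.
  rewrite integral_nneseries//.
  apply: (@le_lt_trans _ _ (\sum_(k <oo) (1 / (2 ^ k.+1)%:R)%:E)); last first.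
    by apply: (le_lt_trans (epsilon_trick0 _ ler01)); rewrite ltry.
  apply: lee_nneseries => k _ => [_|].
    by apply: integral_ge0 => x Dx; exact: v0.
  by case: (hs k).
apply: filterS (integrable_ae mD iv) => x + Dx => /(_ Dx) fin.
pose u k : R := (`|f (s k) x| `^ p)%R.
have u0 : u k @[k --> \oo] --> 0%R.
  apply: cvg_series_cvg_0; apply: nondecreasing_is_cvgn.
    apply: nondecreasing_series => k _ _; exact: powR_ge0.
  exists (fine (\sum_(k <oo) v k x)) => _ [k _ <-].
  rewrite -lee_fin fineK// -sumEFin.
  by apply: (nneseries_lim_ge k) => i _ _; exact: v0.
apply/cvgrPdist_lt => e e0.
have ep : (0 < e `^ p)%R by rewrite powR_gt0.
move/cvgrPdist_lt : u0 => /(_ _ ep); apply: filterS => k.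
rewrite !sub0r !normrN [X in (X < _)%R]ger0_norm ?powR_ge0// => hk.
rewrite ltNge; apply/negP => ek; move: hk; rewrite ltNge => /negP; apply.
by apply: ge0_ler_powR; rewrite ?nnegrE// ltW.
Qed.

Lemma fatou_le (D : set T) (f : nat -> T -> R) (g : T -> R) (B : \bar R) :
  measurable D -> (forall k, measurable_fun D (f k)) -> measurable_fun D g ->
  (forall k x, D x -> (0 <= f k x)%R) -> (forall x, D x -> (0 <= g x)%R) ->
  {ae mu, forall x, D x -> f k x @[k --> \oo] --> g x} ->
  (\forall k \near \oo, \int[mu]_(x in D) (f k x)%:E <= B) ->
  \int[mu]_(x in D) (g x)%:E <= B.
Proof.
move=> mD mf mg f0 g0 [N [mN N0 hN]] [m _ hm].
have mE (h : T -> R) : measurable_fun D h -> measurable_fun D (EFin \o h).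
  by move=> mh; apply/measurable_EFinP.
rewrite (@ge0_negligible_integral _ _ _ mu D N)//; last exact: mE.
rewrite (_ : \int[mu]_(x in D `\` N) _ =
    \int[mu]_(x in D `\` N) limn_einf (fun k => (f (k + m)%N x)%:E)); last first.
  apply: eq_integral => x /set_mem[Dx Nx].
  have cx : f k x @[k --> \oo] --> g x.
    by apply: contrapT => h; apply: Nx; apply: hN => /(_ Dx).
  have : (f (k + m)%N x)%:E @[k --> \oo] --> (g x)%:E.
    apply: cvg_EFin; first by apply: nearW.
    by apply: (@cvg_comp _ _ _ (fun k => (k + m)%N) (fun k => f k x) _ _ _ (@cvg_addnr m)); exact: cx.
  by move/cvg_limn_einf_sup => [-> _].
have mDN : measurable (D `\` N) by exact: measurableD.
apply: le_trans (fatou mu mDN _ _) _.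
- move=> k; apply: (measurable_funS mD); first exact: subDsetl.
  exact: mE.
- by move=> k x [Dx _]; rewrite lee_fin; exact: f0.
rewrite limn_einf_lim; apply: lime_le; first exact: is_cvg_einfs.
apply: nearW => k; apply: ereal_inf_le; exists (\int[mu]_(x in D `\` N) (f (k + m)%N x)%:E).
  by exists k => /=.
apply: le_trans (hm (k + m)%N _); last by rewrite /= leq_addl.
apply: ge0_subset_integral => //.
- exact: mE.
- by move=> x Dx; rewrite lee_fin; exact: f0.
Qed.

(** Either b <= s a or a < b/s. The constant in front of the main term is as close to 1 as desired,
    at the expense of the small term; this is what [Lp_perturb] needs in order not to lose the sharp
    constant. *)
Lemma powRD_le (a b s p : R) : (0 <= p -> 0 <= a -> 0 <= b -> 0 < s ->
  (a + b) `^ p <= (1 + s) `^ p * a `^ p + (1 + s^-1) `^ p * b `^ p)%R.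
Proof.
move=> p0 a0 b0 s0; have [h|h] := leP b (s * a)%R.
  apply: (@le_trans _ _ ((1 + s) `^ p * a `^ p)%R); last by rewrite lerDl mulr_ge0 ?powR_ge0.
  rewrite -powRM ?addr_ge0 ?(ltW s0)//; apply: ge0_ler_powR => //;
    by rewrite ?nnegrE ?addr_ge0 ?mulr_ge0 ?addr_ge0 ?(ltW s0)// mulrDl mul1r lerD2l.
apply: (@le_trans _ _ ((1 + s^-1) `^ p * b `^ p)%R); last by rewrite lerDr mulr_ge0 ?powR_ge0.
have s1 : (0 <= s^-1)%R by rewrite invr_ge0 ltW.
rewrite -powRM ?addr_ge0//; apply: ge0_ler_powR => //; rewrite ?nnegrE ?addr_ge0 ?mulr_ge0 ?addr_ge0//.
by rewrite mulrDl mul1r addrC lerD2l mulrC ler_pdivlMr// mulrC ltW.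
Qed.

Lemma Lp_perturb (D : set T) (F : T -> R) (f h : nat -> T -> R) (p e eta : R) :
  (0 < p)%R -> measurable D -> measurable_fun D F ->
  (forall k, measurable_fun D (f k)) -> (forall k, measurable_fun D (h k)) ->
  (forall x, D x -> (0 <= F x)%R) -> (forall k x, D x -> (0 <= f k x)%R) ->
  (forall k x, D x -> (0 <= h k x)%R) -> (forall k x, D x -> (f k x <= F x + h k x)%R) ->
  \int[mu]_(x in D) (F x `^ p)%:E = e%:E -> (e < eta)%R ->
  (forall c : R, (0 < c)%R ->
     \forall k \near \oo, \int[mu]_(x in D) (h k x `^ p)%:E <= c%:E) ->
  \forall k \near \oo, \int[mu]_(x in D) (f k x `^ p)%:E <= eta%:E.
Proof.
move=> p0 mD mF mf mh F0 f0 h0 fFh Fe ee hh.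
have e0 : (0 <= e)%R.
  by rewrite -lee_fin -Fe; apply: integral_ge0 => x _; rewrite lee_fin powR_ge0.
have mp (g : T -> R) : measurable_fun D g -> measurable_fun D (fun x => (g x `^ p)%:E).
  by move=> mg; apply/measurable_EFinP; apply: (measurableT_comp (measurable_powR _)).
(* The room left between (1 + s)^p e and eta is spent on the error term through the choice of [c]
   below. *)
have [s s0 hs] : exists2 s : R, (0 < s)%R & ((1 + s) `^ p * e < eta)%R.
  have [->|ne] := eqVneq e 0%R; first by exists 1%R => //; rewrite mulr0; exact: le_lt_trans ee.
  have e1 : (0 < e)%R by rewrite lt_neqAle eq_sym ne.
  pose m := ((e + eta) / 2)%R.
  have me : (e < m)%R by rewrite /m ltr_pdivlMr// mulr_natr mulr2n ltrD2l.
  have m2 : (m < eta)%R by rewrite /m ltr_pdivrMr// mulr_natr mulr2n ltrD2r.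
  have r1 : (1 < m / e)%R by rewrite ltr_pdivlMr// mul1r.
  exists ((m / e) `^ p^-1 - 1)%R.
    rewrite subr_gt0; have := @gt0_ltr_powR R p^-1%R; rewrite invr_gt0 p0 => /(_ isT) inc.
    have := inc 1%R (m / e)%R; rewrite powR1; apply=> //;
      by rewrite ?invr_gt0 ?nnegrE// ltW// (lt_trans ltr01).
  rewrite addrC subrK -powRrM mulVf ?gt_eqF// powRr1; last first.
    by apply: ltW; exact: lt_trans r1.
  by rewrite divfK.
pose c := ((eta - (1 + s) `^ p * e) / (1 + s^-1) `^ p)%R.
have s1 : (0 < (1 + s^-1) `^ p)%R by rewrite powR_gt0// addr_gt0 ?invr_gt0.
have c0 : (0 < c)%R by rewrite divr_gt0// subr_gt0.
apply: filterS (hh _ c0) => k hk.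
apply: (@le_trans _ _ (\int[mu]_(x in D) (((1 + s) `^ p)%:E * (F x `^ p)%:E +
    ((1 + s^-1) `^ p)%:E * (h k x `^ p)%:E))).
  apply: ge0_le_integral => //.
  - by move=> x _; rewrite lee_fin powR_ge0.
  - exact: mp.
  - apply: emeasurable_funD; apply: emeasurable_funM;
      by [exact: measurable_cst|exact: mp].
  - move=> x Dx; rewrite -!EFinM -EFinD lee_fin.
    apply: le_trans (powRD_le (ltW p0) (F0 _ Dx) (h0 k _ Dx) s0).
    apply: ge0_ler_powR; rewrite ?nnegrE ?(ltW p0) ?addr_ge0 ?F0 ?f0 ?h0//.
    exact: fFh.
rewrite ge0_integralD//; last 4 first.
- by move=> x _; rewrite mule_ge0// lee_fin powR_ge0.
- by apply: emeasurable_funM; [exact: measurable_cst|exact: mp].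
- by move=> x _; rewrite mule_ge0// lee_fin powR_ge0.
- by apply: emeasurable_funM; [exact: measurable_cst|exact: mp].
rewrite !ge0_integralZl//; try (by rewrite lee_fin powR_ge0); try exact: mp;
  try (by move=> x _; rewrite lee_fin powR_ge0).
rewrite Fe; apply: (@le_trans _ _ (((1 + s) `^ p)%:E * e%:E + ((1 + s^-1) `^ p)%:E * c%:E)).
  by rewrite leeD2l// lee_wpmul2l// lee_fin powR_ge0.
by rewrite -!EFinM -EFinD lee_fin /c mulrC [X in (_ + X)%R]mulrC divfK ?gt_eqF// mulrC addrC subrK.
Qed.

Lemma nearle_poweR (x y : nat -> \bar R) (q : R) : (0 < q)%R ->
  (forall k, 0 <= x k) -> (forall k, 0 <= y k) -> (forall k, y k <= x k) ->
  x k `^ q @[k --> \oo] --> 0 ->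
  forall e : R, (0 < e)%R -> \forall k \near \oo, y k <= e%:E.
Proof.
move=> q0 x0 y0 yx cx e e0.
have ep : 0 < (e `^ q)%:E by rewrite lte_fin powR_gt0.
have cx' : \forall k \near \oo, x k `^ q < (e `^ q)%:E.
  exact: (cx _ (open_ereal_lt' ep)).
apply: filterS cx' => k hk.
apply: (le_trans (yx k)); rewrite leNgt; apply/negP => ek.
move: hk; rewrite ltNge => /negP; apply.
rewrite -poweR_EFin; apply: gt0_ler_poweR; rewrite ?in_itv/= ?leey ?andbT ?(ltW q0)//.
  by rewrite lee_fin ltW.
exact: ltW.
Qed.

End Lp_limits.

(** * Upward translations and approximation in W^{1,p} *)

Section half_space_shift.
Context (R : realType) (n : nat).
Local Notation H := (@half_space R n.+1).
Local Notation mu := (@lebesgue_measure R).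

Lemma snoc_rV_shift (y : 'rV[R]_n) (t tau : R) :
  snoc_rV y t + snoc_rV 0 tau = snoc_rV y (t + tau).
Proof.
apply/rowP => i; rewrite !mxE; case: insubP => [j _ _|_] //=.
by rewrite mxE addr0.
Qed.

Lemma integral_shift_le (K : R -> \bar R) (tau : R) : measurable_fun setT K ->
  (forall t, 0 <= K t)%E -> 0 <= tau ->
  (\int[mu]_(t in `[0%R, +oo[) K (t + tau)%R <= \int[mu]_(t in `[0%R, +oo[) K t)%E.
Proof.
move=> mK K0 tau0.
have mS : measurable_fun setT (fun t : measurableTypeR R => (t + tau : measurableTypeR R)).
  by apply: (@measurable_funD _ _ R setT (fun t : measurableTypeR R => t) (fun=> tau)).
have Dt (t : R) : is_derive t 1 (fun t : R => t + tau) (1 : R).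
  have := is_deriveD (is_derive_id t (1 : R)) (is_derive_cst tau t (1 : R)).
  by rewrite addr0.
have P0 t : (0 <= (K \_ `[0%R, +oo[) t)%E by rewrite patchE; case: ifP.
have mP : measurable_fun setT (K \_ `[0%R, +oo[) by apply: measurable_patch0.
rewrite integral_mkcond [leRHS]integral_mkcond.
rewrite (@ge0_integral_line_substitution R (fun t => t + tau) (fun=> 1) (K \_ `[0%R, +oo[)) => //.
- apply: ge0_le_integral => //.
  + by move=> t _; rewrite patchE; case: ifP.
  + by apply: measurable_patch0 => //; exact: (measurableT_comp mK mS).
  + apply: emeasurable_funM; last exact: measurable_cst.
    exact: (measurableT_comp mP mS).
  + move=> t _; rewrite mule1 !patchE.
    case: ifPn => [|_]; last by case: ifP.
    rewrite inE /= in_itv/= andbT => t0.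
    by rewrite mem_set//= in_itv/= andbT addr_ge0.
- by move=> x; exact: cst_continuous.
- by move=> M; exists (M - tau); rewrite subrK.
- by move=> M; exists (M - tau); rewrite subrK.
Qed.

Lemma integral_half_space_shift (F : 'rV[R]_n.+1 -> \bar R) (tau : R) :
  measurable_fun setT F -> (forall x, 0 <= F x)%E -> 0 <= tau ->
  (\int[leb R n.+1]_(x in H) F (x + snoc_rV (0 : 'rV[R]_n) tau)%R <=
   \int[leb R n.+1]_(x in H) F x)%E.
Proof.
move=> mF F0 tau0.
pose Fe (x : 'rV[R]_n.+1) := F (x + snoc_rV (0 : 'rV[R]_n) tau).
have mS : measurable_fun setT (fun x : 'rV[R]_n.+1 => x + snoc_rV (0 : 'rV[R]_n) tau).
  apply: measurable_fun_coordP => i; under eq_fun do rewrite mxE.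
  by apply: measurable_funD => //; exact: measurable_coord.
have mFe : measurable_fun setT Fe by exact: (measurableT_comp mF mS).
rewrite (@ge0_integral_half_space R n Fe mFe (fun x => F0 _)) (@ge0_integral_half_space R n F mF F0).
pose K (t : R) : \bar R := (\int[leb R n]_y F (snoc_rV y t))%E.
have mK : measurable_fun setT K.
  apply: (@measurable_integral_section _ _ _ _ _ (leb R n) (fun t y => F (snoc_rV y t))).
    apply: (measurableT_comp mF).
    by apply: measurable_snoc_rVP; [exact: measurable_snd|exact: measurable_fst].
  by move=> t y; exact: F0.
have K0 (t : R) : (0 <= K t)%E by apply: integral_ge0.
apply: le_trans (integral_shift_le mK K0 tau0).
rewrite le_eqVlt; apply/orP; left; apply/eqP; apply: eq_integral => t _.
by apply: eq_integral => y _; rewrite /Fe snoc_rV_shift.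
Qed.

End half_space_shift.

Section trace_inequality.
Context (R : realType) (n : nat) (p : R).
Hypotheses (n0 : (0 < n)%N) (p1 : 1 < p) (pN : p < n.+1%:R).
Local Notation H := (@half_space R n.+1).
Local Notation ps := (pstar n.+1 p).
Local Notation c := (trace_const n p).

Let p0 : 0 < p. Proof. exact: lt_trans p1. Qed.
Let p1' : 1 <= p. Proof. exact: ltW. Qed.
Let ps0 : 0 < ps. Proof. exact: pstar_gt0. Qed.
Let c0 : 0 < c. Proof. exact: trace_const_gt0. Qed.
Let mH : measurable H. Proof. exact: measurable_half_space. Qed.

Lemma measurable_enorm_in (D : set 'rV[R]_n.+1) (G : 'rV[R]_n.+1 -> 'rV[R]_n.+1) :
  measurable D -> (forall i, measurable_fun D (fun x => G x ord0 i)) ->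
  measurable_fun D (fun x => enorm (G x)).
Proof.
move=> mD mG.
pose G' x : 'rV[R]_n.+1 := \row_i ((fun x => G x ord0 i) \_ D) x.
have mG' : measurable_fun setT G'.
  apply: measurable_fun_coordP => i; under eq_fun do rewrite mxE.
  by apply/(measurable_restrictT _ mD).
apply: (eq_measurable_fun (fun x => enorm (G' x))).
  move=> x xD; congr enorm; apply/rowP => i.
  by rewrite mxE patchE xD.
apply: measurable_funTS; apply: (measurableT_comp _ mG').
exact: measurable_enorm.
Qed.

Lemma Lp_measurable (D : set 'rV[R]_n.+1) (f : 'rV[R]_n.+1 -> R) :
  measurable D -> Lp D p f -> measurable_fun D f.
Proof.
move=> mD /(Lfun_integralP _ _ p0)[mf _].
by apply/(measurable_restrictT _ mD).
Qed.

Lemma Lp_integral (D : set 'rV[R]_n.+1) (f : 'rV[R]_n.+1 -> R) :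
  Lp D p f -> (\int[leb R n.+1]_(x in D) (`|f x| `^ p)%:E < +oo)%E.
Proof.
move=> /(Lfun_integralP _ _ p0)[_]; apply: le_lt_trans.
rewrite [leLHS]integral_mkcond le_eqVlt; apply/orP; left; apply/eqP.
apply: eq_integral => x _; rewrite !patchE; case: ifP => // _.
by rewrite normr0 powR0// gt_eqF.
Qed.

Lemma C1_measurable_grad (phi : 'rV[R]_n.+1 -> R) : C1 phi ->
  forall i, measurable_fun setT (fun x => grad phi x ord0 i).
Proof.
move=> [cp _] i; under eq_fun do rewrite mxE.
exact: continuous_measurable_rV.
Qed.

Variables (u : 'rV[R]_n.+1 -> R) (phi : nat -> 'rV[R]_n.+1 -> R).
Hypothesis tphi : forall k, test_fun setT (phi k).
Hypothesis cphi : W1p_cvg H p phi u.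

Let C1phi k : C1 (phi k). Proof. exact: test_fun_C1 (tphi k). Qed.
Let bphi k : bounded_support (phi k). Proof. exact: test_fun_supported (tphi k). Qed.

Variable G : 'rV[R]_n.+1 -> 'rV[R]_n.+1.
Hypothesis uG : W1p_grad H p u G.

Let mG i : measurable_fun H (fun x => G x ord0 i).
Proof. by case: uG => _ h _; exact: Lp_measurable (h i). Qed.

Let mgphi k i : measurable_fun H (fun x => grad (phi k) x ord0 i).
Proof. by apply: measurable_funTS; exact: C1_measurable_grad. Qed.

Let mGphi k i : measurable_fun H (fun x => (G x - grad (phi k) x) ord0 i).
Proof. by under eq_fun do rewrite mxE [X in _ + X]mxE; exact: measurable_funB. Qed.

Lemma W1p_cvg_near : (forall e : R, 0 < e -> \forall k \near \oo,
     (\int[leb R n.+1]_(x in H) (`|u x - phi k x| `^ p)%:E <= e%:E)%E) /\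
  (forall e : R, 0 < e -> \forall k \near \oo,
     (\int[leb R n.+1]_(x in H) (enorm (G x - grad (phi k) x) `^ p)%:E <= e%:E)%E).
Proof.
have [G' uG' cv] := cphi.
have i0 (h : 'rV[R]_n.+1 -> R) : (0 <= \int[leb R n.+1]_(x in H) (h x `^ p)%:E)%E.
  by apply: integral_ge0 => x _; rewrite lee_fin powR_ge0.
have pV : 0 < p^-1 by rewrite invr_gt0.
have GE : {ae leb R n.+1, forall x, H x -> G x = G' x}.
  have h : \forall x \near almost_everywhere (leb R n.+1), forall i, H x -> G x ord0 i = G' x ord0 i.
    apply: (@filter_forall _ _ (fun i x => H x -> G x ord0 i = G' x ord0 i) (almost_everywhere (leb R n.+1))).
    exact: weak_grad_unique p1' _ _ _ uG uG'.
  by apply: filterS h => x h Hx; apply/rowP => i; exact: h.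
split.
  apply: (nearle_poweR pV _ _ _ cv) => k; [|exact: i0|].
    by apply: adde_ge0; exact: i0.
  by apply: leeDl; exact: i0.
have Ek k : (\int[leb R n.+1]_(x in H) (enorm (G x - grad (phi k) x) `^ p)%:E =
    \int[leb R n.+1]_(x in H) (enorm (G' x - grad (phi k) x) `^ p)%:E)%E.
  apply: ge0_ae_eq_integral => //.
  - apply/measurable_EFinP; apply: (measurableT_comp (measurable_powR _)).
    exact: measurable_enorm_in.
  - apply/measurable_EFinP; apply: (measurableT_comp (measurable_powR _)).
    apply: measurable_enorm_in => // i.
    under eq_fun do rewrite mxE [X in _ + X]mxE; apply: measurable_funB => //.
    by case: uG' => _ h _; exact: Lp_measurable (h i).
  - by move=> x _; rewrite lee_fin powR_ge0.
  - by move=> x _; rewrite lee_fin powR_ge0.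
  - by apply: filterS GE => x h Hx; rewrite h.
move=> e e0; suff : \forall k \near \oo,
    (\int[leb R n.+1]_(x in H) (enorm (G' x - grad (phi k) x) `^ p)%:E <= e%:E)%E.
  by apply: filterS => k; rewrite Ek.
move: e e0; apply: (nearle_poweR pV _ _ _ cv) => k; [|exact: i0|].
  by apply: adde_ge0; exact: i0.
by apply: leeDr; exact: i0.
Qed.

Lemma energy_fin : (\int[leb R n.+1]_(x in H) (enorm (G x) `^ p)%:E)%E \is a fin_num.
Proof.
rewrite ge0_fin_numE; last by apply: integral_ge0 => x _; rewrite lee_fin powR_ge0.
have mp i : measurable_fun H (fun x => (`|G x ord0 i| `^ p)%:E).
  apply/measurable_EFinP; apply: (measurableT_comp (measurable_powR _)).
  exact: measurableT_comp.
have m0 : (0 : R) <= n.+1%:R `^ p by exact: powR_ge0.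
apply: (@le_lt_trans _ _ (\int[leb R n.+1]_(x in H)
  ((n.+1%:R `^ p)%:E * \sum_(i < n.+1) (`|G x ord0 i| `^ p)%:E))%E).
  apply: ge0_le_integral => //.
  - by move=> x _; rewrite lee_fin powR_ge0.
  - apply/measurable_EFinP; apply: (measurableT_comp (measurable_powR _)).
    exact: measurable_enorm_in.
  - by apply: emeasurable_funM; [exact: measurable_cst|exact: emeasurable_sum].
  - move=> x _; rewrite sumEFin -EFinM lee_fin.
    have [i hi] : exists i, forall j, `|G x ord0 j| <= `|G x ord0 i|.
      have [i _ hi] := @arg_maxP _ _ _ ord0 xpredT (fun j => `|G x ord0 j|) isT.
      by exists i => j; exact: hi.
    apply: (@le_trans _ _ ((n.+1%:R * `|G x ord0 i|) `^ p)).
      apply: ge0_ler_powR; rewrite ?nnegrE ?(ltW p0) ?mulr_ge0 ?enorm_ge0//.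
      apply: (le_trans (enorm_le_sum _)).
      apply: (@le_trans _ _ (\sum_(j < n.+1) `|G x ord0 i|)); first by apply: ler_sum => j _; exact: hi.
      by rewrite sumr_const card_ord mulr_natl.
    rewrite powRM// ler_wpM2l//.
    by rewrite (bigD1 i)//= lerDl; apply: sumr_ge0 => j _; exact: powR_ge0.
rewrite ge0_integralZl//; last 2 first.
- exact: emeasurable_sum.
- by move=> x _; apply: sume_ge0 => i _; rewrite lee_fin powR_ge0.
rewrite lte_mul_pinfty//.
rewrite ge0_integral_sum//.
apply: lte_sum_pinfty => i _; apply: Lp_integral.
by case: uG.
Qed.

Lemma energy_near (eta : R) :
  (\int[leb R n.+1]_(x in H) (enorm (G x) `^ p)%:E < eta%:E)%E ->
  \forall k \near \oo, (\int[leb R n.+1]_(x in H) (enorm (grad (phi k) x) `^ p)%:E <= eta%:E)%E.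
Proof.
have := energy_fin; set E := (\int[leb R n.+1]_(x in H) (enorm (G x) `^ p)%:E)%E.
move=> /fineK EE; rewrite -EE lte_fin => eeta.
apply: (@Lp_perturb _ _ _ (leb R n.+1) H (fun x => enorm (G x)) (fun k x => enorm (grad (phi k) x))
  (fun k x => enorm (G x - grad (phi k) x)) p (fine E) eta p0 mH) => //.
- exact: measurable_enorm_in.
- by move=> k; apply: measurable_enorm_in.
- by move=> k; apply: measurable_enorm_in.
- by move=> x _; exact: enorm_ge0.
- by move=> k x _; exact: enorm_ge0.
- by move=> k x _; exact: enorm_ge0.
- move=> k x _; have nE (z : 'rV[R]_n.+1) : enorm (- z) = enorm z.
    by rewrite /enorm; congr Num.sqrt; apply: eq_bigr => i _; rewrite mxE sqrrN.
  rewrite -[enorm (G x - _)]nE; apply: le_trans (enormD _ _).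
  by rewrite opprB addrCA subrr addr0.
- by have [_] := W1p_cvg_near.
Qed.

(** The sharp inequality is applied to phi_k translated by tau: the half-space is moved into itself,
    so the energy does not grow and the trace becomes the slice at height tau. The case tau = 0
    gives the trace inequality; uniformity in tau serves the case of zero energy. *)
Lemma trace_le_near (eta : R) :
  (\int[leb R n.+1]_(x in H) (enorm (G x) `^ p)%:E < eta%:E)%E ->
  \forall k \near \oo, forall tau : R, 0 <= tau ->
  (\int[leb R n]_y (`|phi k (snoc_rV y tau)| `^ ps)%:E <= ((eta / c) `^ (ps / p))%:E)%E.
Proof.
move=> Eeta; apply: filterS (energy_near Eeta) => k hk tau tau0.
pose e := snoc_rV (0 : 'rV[R]_n) tau.
pose v (x : 'rV[R]_n.+1) := phi k (x + e).
have Dv x i : is_derive x (delta_mx ord0 i) v (partial i (phi k) (x + e)).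
  have [h1 h2] := is_derive_partial (C1phi k) (x + e) i.
  have E : (fun h : R => h^-1 *: ((v \o shift x) (h *: delta_mx ord0 i) - v x)) =
    (fun h : R => h^-1 *: ((phi k \o shift (x + e)) (h *: delta_mx ord0 i) - phi k (x + e))).
    by apply/funext => h /=; rewrite /v addrA.
  by split; move: h1 h2; rewrite /derivable /derive E.
have Ev i : partial i v = (fun x => partial i (phi k) (x + e)).
  by apply/funext => x; rewrite /partial; case: (Dv x i).
have ce : continuous (fun x : 'rV[R]_n.+1 => x + e).
  move=> x; apply: (@continuousD _ _ _ (fun x : 'rV[R]_n.+1 => x) (fun=> e)).
    by move=> ?; exact: cvg_id.
  exact: cst_continuous.
have C1v : C1 v.
  split=> [i|i x]; last by case: (Dv x i).
  rewrite Ev => x; apply: (@continuous_comp _ _ _ (fun x : 'rV[R]_n.+1 => x + e) (partial i (phi k))).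
    exact: ce.
  by case: (C1phi k) => + _; exact.
have bv : bounded_support v.
  have [M hM] := bphi k; exists (M + tau) => x i xM; apply: (hM _ i).
  rewrite mxE.
  have ei : `|e ord0 i| <= tau.
    rewrite /e; have [h|h] := ltnP i n.
      by rewrite snoc_rV_lt mxE normr0.
    rewrite snoc_rV_last ?ger0_norm//.
    by apply/eqP; rewrite eqSS eqn_leq h -ltnS ltn_ord.
  rewrite -(ltrD2r tau); apply: (lt_le_trans xM).
  rewrite -{1}[x ord0 i](addrK (e ord0 i)).
  apply: (le_trans (ler_normB _ _)); by rewrite lerD2l.
have := sharp_trace n0 p1 pN C1v bv.
have fv := trace_integral_fin n0 p1 pN C1v bv.
rewrite (_ : (\int[leb R n]_y (`|v (snoc_rV y 0)| `^ ps)%:E =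
  \int[leb R n]_y (`|phi k (snoc_rV y tau)| `^ ps)%:E)%E) in fv *; last first.
  by apply: eq_integral => y _; rewrite /v snoc_rV_shift add0r.
set I := (\int[leb R n]_y (`|phi k (snoc_rV y tau)| `^ ps)%:E)%E in fv *.
move=> h; have {}h : (c%:E * I `^ (p / ps) <= eta%:E)%E.
  apply: (le_trans h); apply: le_trans hk.
  pose F x : \bar R := (enorm (grad (phi k) x) `^ p)%:E.
  have F0 x : (0 <= F x)%E by rewrite lee_fin powR_ge0.
  have mF : measurable_fun setT F.
    apply/measurable_EFinP; apply: (measurableT_comp (measurable_powR _)).
    apply: measurable_enorm_in; first exact: measurableT.
    exact: C1_measurable_grad (C1phi k).
  apply: le_trans (@integral_half_space_shift R n F tau mF F0 tau0).
  rewrite le_eqVlt; apply/orP; left; apply/eqP.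
  apply: eq_integral => x _; congr ((enorm _ `^ p)%:E); apply/rowP => i.
  by rewrite !mxE Ev.
have I0 : (0 <= I)%E by apply: integral_ge0 => y _; rewrite lee_fin powR_ge0.
move: fv I0 h => /fineK <-; rewrite lee_fin poweR_EFin -EFinM !lee_fin => I0 h.
have h' : fine I `^ (p / ps) <= eta / c by rewrite ler_pdivlMr// mulrC.
rewrite -[leLHS](powRr1 I0).
have -> : 1 = (p / ps) * (ps / p) by field; rewrite !gt_eqF.
rewrite powRrM; apply: ge0_ler_powR; rewrite ?nnegrE ?powR_ge0//.
  by rewrite divr_ge0 ?ltW.
by apply: le_trans h'; exact: powR_ge0.
Qed.

End trace_inequality.

Section trace_inequality_W1p.
Context (R : realType) (n : nat) (p : R).
Hypotheses (n0 : (0 < n)%N) (p1 : 1 < p) (pN : p < n.+1%:R).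
Local Notation H := (@half_space R n.+1).
Local Notation ps := (pstar n.+1 p).
Local Notation c := (trace_const n p).

Let p0 : 0 < p. Proof. exact: lt_trans p1. Qed.
Let ps0 : 0 < ps. Proof. exact: pstar_gt0. Qed.
Let c0 : 0 < c. Proof. exact: trace_const_gt0. Qed.
Let mH : measurable H. Proof. exact: measurable_half_space. Qed.

Variables (u : 'rV[R]_n.+1 -> R) (G : 'rV[R]_n.+1 -> 'rV[R]_n.+1) (g : 'rV[R]_n -> R).
Hypotheses (uG : W1p_grad H p u G) (ug : @is_trace R n.+1 p u g).
Local Notation E := (\int[leb R n.+1]_(x in H) (enorm (G x) `^ p)%:E)%E.

Let continuous_norm_powR : continuous (fun z : R => `|z| `^ ps).
Proof. by apply: continuous_powR_ge0 => //; exact: norm_continuous. Qed.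

Let cvg_norm_powR (f : nat -> R) (l : R) : l - f k @[k --> \oo] --> (0 : R) ->
  `|f k| `^ ps @[k --> \oo] --> `|l| `^ ps.
Proof.
move=> h; have hf : f k @[k --> \oo] --> l.
  have : l - (l - f k) @[k --> \oo] --> (l - 0 : R) by apply: cvgB => //; exact: cvg_cst.
  by rewrite subr0; under eq_fun do rewrite opprB addrC subrK.
by apply: (@cvg_comp _ _ _ f (fun z : R => `|z| `^ ps) _ _ _ hf); exact: continuous_norm_powR.
Qed.

Let near_sub (s : nat -> nat) (P : nat -> Prop) : (forall k, (k <= s k)%N) ->
  (\forall k \near \oo, P k) -> \forall k \near \oo, P (s k).
Proof.
by move=> ks [m _ hm]; exists m => // k /= mk; apply: hm => /=; exact: leq_trans (ks k).
Qed.

Theorem trace_inequality :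
  (c%:E * (\int[leb R n]_y (`|g y| `^ ps)%:E) `^ (p / ps) <= E)%E.
Proof.
have [Lg [phi [tphi cphi cN]]] := ug.
have /(Lfun_integralP _ _ p0)[mg _] := Lg.
have mphi k : measurable_fun setT (fun y : 'rV[R]_n => phi k (snoc_rV y 0)).
  apply: continuous_measurable_rV; apply: continuous_trace.
  exact: test_fun_C1 (tphi k).
pose I k : \bar R := (\int[leb R n]_y (`|g y - phi k (snoc_rV y 0)| `^ p)%:E)%E.
have I0 k : (0 <= I k)%E by apply: integral_ge0 => y _; rewrite lee_fin powR_ge0.
have cI : (I k `^ p^-1)%E @[k --> \oo] --> (0 : \bar R).
  (* [snoc_rV] is modelled on [bdry], so that [snoc_rV y 0] and [bdry y] are convertible. *)
  rewrite (_ : (fun k => I k `^ p^-1)%E = (fun k =>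
    'N[leb R n]_(p%:E)[EFin \o (fun y => g y - phi k (bdry (y : 'rV[R]_n.+1.-1)))%R]%E)).
    exact: cN.
  by apply/funext => k; rewrite LnormE.
have pV : 0 < p^-1 by rewrite invr_gt0.
have nI := nearle_poweR pV I0 I0 (fun k => lexx (I k)) cI.
have [s ks hs] := @ae_subsequence _ _ _ (leb R n) setT
  (fun k y => g y - phi k (snoc_rV y 0)) p p0 measurableT
  (fun k => measurable_funB mg (mphi k)) nI.
have := energy_fin p1 uG; set e := E => /fineK eE.
apply/lee_addgt0Pr => d d0; rewrite -eE -EFinD.
have ed : (E < (fine e + d)%:E)%E by rewrite -/e -{1}eE lte_fin ltrDl.
have e0 : 0 <= fine e.
  by apply: fine_ge0; apply: integral_ge0 => x _; rewrite lee_fin powR_ge0.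
set eta := fine e + d in ed *.
have eta0 : 0 < eta by rewrite ltr_wpDl.
set b := (eta / c) `^ (ps / p).
have Db : (\int[leb R n]_y (`|g y| `^ ps)%:E <= b%:E)%E.
  apply: (@fatou_le _ _ _ (leb R n) setT (fun k y => `|phi (s k) (snoc_rV y 0)| `^ ps)) => //.
  - move=> k; apply: (measurableT_comp (measurable_powR _)).
    by apply: measurableT_comp => //; exact: mphi.
  - by apply: (measurableT_comp (measurable_powR _)); apply: measurableT_comp.
  - by move: hs; apply: filterS => y h _; apply: cvg_norm_powR; exact: (h Logic.I).
  - apply: (@near_sub s (fun k => \int[leb R n]_y (`|phi k (snoc_rV y 0)| `^ ps)%:E <= b%:E)%E ks).
    by apply: filterS (trace_le_near n0 p1 pN tphi cphi uG ed) => k; exact.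
have D0 : (0 <= \int[leb R n]_y (`|g y| `^ ps)%:E)%E.
  by apply: integral_ge0 => y _; rewrite lee_fin powR_ge0.
apply: (@le_trans _ _ (c%:E * b%:E `^ (p / ps))%E).
  apply: lee_wpmul2l; first by rewrite lee_fin ltW.
  apply: gt0_ler_poweR; rewrite ?in_itv/= ?leey ?andbT//.
  - by rewrite divr_ge0 ?ltW.
  - by rewrite lee_fin powR_ge0.
rewrite poweR_EFin -EFinM lee_fin /b -powRrM.
have -> : ps / p * (p / ps) = 1 by field; rewrite !gt_eqF.
rewrite powRr1; last by rewrite divr_ge0 ?ltW.
by rewrite mulrCA mulfV ?mulr1 ?gt_eqF.
Qed.

Lemma test_fun0 : @test_fun R n.+1 H (fun=> 0).
Proof.
rewrite /test_fun (_ : [set x : 'rV[R]_n.+1 | _] = set0); last first.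
  by apply/seteqP; split => x //=; rewrite eqxx.
rewrite closure0; split => //; last exact: compact0.
by apply: Ck_smooth => k; exact: Ck_cst.
Qed.

(** With zero energy, [trace_le_near] applies for every eta > 0, so the slices of the approximations
    are eventually small in L^pstar, uniformly in the height. Integration over the height and
    Fatou's lemma give u = 0 almost everywhere. *)
Theorem energy_eq0_W1p0 : E = 0%E -> W1p0 H p u.
Proof.
move=> E0.
have [Lg [phi [tphi cphi _]]] := ug.
have cphi' k : continuous (phi k) := C1_continuous (test_fun_C1 (tphi k)).
have mphi k : measurable_fun setT (phi k) by apply: continuous_measurable_rV.
have mu_ : measurable_fun H u by case: uG => Lu _ _; apply: Lp_measurable Lu.
have [nu _] := W1p_cvg_near p1 tphi cphi uG.
have mf k : measurable_fun H (fun x => u x - phi k x).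
  by apply: measurable_funB => //; exact: measurable_funTS.
have [s ks hs] := @ae_subsequence _ _ _ (leb R n.+1) H
  (fun k x => u x - phi k x) p p0 mH mf nu.
(* The heights have infinite total measure; an integrable weight in the last coordinate turns a
   uniform bound on the slices into a bound on the integral. *)
pose w (x : 'rV[R]_n.+1) : R := profile 2 (x ord0 ord_max).
have w0 x : 0 < w x by exact: profile_gt0.
have mprof : measurable_fun setT (fun t : measurableTypeR R => profile 2 t : R).
  exact: continuous_measurable_fun (@continuous_profile _ _).
have mw : measurable_fun setT w.
  apply: (measurableT_comp mprof); exact: (@measurable_coord _ _ n.+1 ord_max).
have mnp (D : set 'rV[R]_n.+1) (f : 'rV[R]_n.+1 -> R) : measurable D -> measurable_fun D f ->
    measurable_fun D (fun x => `|f x| `^ ps * w x).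
  move=> mD mf'; apply: measurable_funM; last exact: measurable_funTS.
  by apply: (measurableT_comp (measurable_powR _)); apply: measurableT_comp.
have pm0 : 0 < profile_mass (2 : R) by apply: profile_mass_gt0; rewrite ltr1n.
have small (d : R) : 0 < d -> (\int[leb R n.+1]_(x in H) (`|u x| `^ ps * w x)%:E <= d%:E)%E.
  move=> d0; pose del := d / profile_mass (2 : R).
  have del0 : 0 < del by rewrite divr_gt0.
  pose eta := c * del `^ (p / ps).
  have eta0 : 0 < eta by rewrite mulr_gt0// powR_gt0.
  have Eeta : (E < eta%:E)%E by rewrite E0 lte_fin.
  have etaE : (eta / c) `^ (ps / p) = del.
    rewrite /eta mulrAC mulfV ?gt_eqF// mul1r -powRrM.
    have -> : p / ps * (ps / p) = 1 by field; rewrite !gt_eqF.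
    by rewrite powRr1 ?ltW.
  apply: (@fatou_le _ _ _ (leb R n.+1) H (fun k x => `|phi (s k) x| `^ ps * w x)) => //.
  - by move=> k; apply: mnp => //; exact: measurable_funTS.
  - exact: mnp.
  - by move=> k x _; rewrite mulr_ge0 ?powR_ge0// ltW.
  - by move=> x _; rewrite mulr_ge0 ?powR_ge0// ltW.
  - apply: filterS hs => x h Hx; apply: cvgMl; apply: cvg_norm_powR; exact: h.
  apply: (@near_sub s (fun k => \int[leb R n.+1]_(x in H) (`|phi k x| `^ ps * w x)%:E <= d%:E)%E ks).
  apply: filterS (trace_le_near n0 p1 pN tphi cphi uG Eeta) => k hk.
  pose F (x : 'rV[R]_n.+1) : \bar R := (`|phi k x| `^ ps * w x)%:E.
  have mF : measurable_fun setT F by apply/measurable_EFinP; exact: mnp.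
  have F0 x : (0 <= F x)%E by rewrite lee_fin mulr_ge0 ?powR_ge0// ltW.
  rewrite -/(F _) (@ge0_integral_half_space R n F mF F0).
  have mps (t : R) : measurable_fun setT (fun y : 'rV[R]_n => (`|phi k (snoc_rV y t)| `^ ps)%:E).
    apply/measurable_EFinP; apply: (measurableT_comp (measurable_powR _)).
    apply: measurableT_comp => //; apply: (measurableT_comp (mphi k)).
    by apply: measurable_snoc_rVP; [exact: measurable_id|exact: measurable_cst].
  pose K (t : R) : \bar R := (\int[leb R n]_y F (snoc_rV y t))%E.
  have mK : measurable_fun setT K.
    apply: (@measurable_integral_section _ _ _ _ _ (leb R n) (fun t y => F (snoc_rV y t))).
      apply: (measurableT_comp mF).
      by apply: measurable_snoc_rVP; [exact: measurable_snd|exact: measurable_fst].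
    by move=> t y; exact: F0.
  have K0 (t : R) : (0 <= K t)%E by apply: integral_ge0.
  have mdp : measurable_fun setT (fun t : measurableTypeR R => (del * profile 2 t)%:E).
    by apply/measurable_EFinP; apply: measurable_funM => //; exact: measurable_cst.
  apply: (@le_trans _ _ (\int[lebesgue_measure]_(t in `[0%R, +oo[) (del * profile 2 t)%:E)%E).
    apply: ge0_le_integral => //.
    - by move=> t _; exact: K0.
    - exact: measurable_funTS mK.
    - exact: measurable_funTS mdp.
    move=> t; rewrite /= in_itv/= andbT => t0.
    rewrite (_ : (\int[leb R n]_y F (snoc_rV y t))%E =
      (\int[leb R n]_y ((`|phi k (snoc_rV y t)| `^ ps)%:E * (profile 2 t)%:E))%E); last first.
      by apply: eq_integral => y _; rewrite /F /w snoc_rV_max EFinM.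
    rewrite ge0_integralZr//; last by rewrite lee_fin ltW// profile_gt0.
    rewrite EFinM; apply: lee_wpmul2r; first by rewrite lee_fin ltW// profile_gt0.
    by rewrite -etaE; exact: hk.
  apply: (@le_trans _ _ (\int[lebesgue_measure]_(t in setT) (del * profile 2 t)%:E)%E).
    apply: ge0_subset_integral => //.
    by move=> t _; rewrite lee_fin mulr_ge0 ?(ltW del0)// ltW// profile_gt0.
  under eq_integral do rewrite EFinM.
  rewrite ge0_integralZl//; first last.
  - by rewrite lee_fin ltW.
  - by move=> t _; rewrite lee_fin ltW// profile_gt0.
  - by apply/measurable_EFinP.
  by rewrite integral_profile ?ltr1n// -EFinM lee_fin /del divfK// gt_eqF.
have mup : measurable_fun H (fun x => (`|u x| `^ ps * w x)%:E).
  by apply/measurable_EFinP; exact: mnp.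
have z : (\int[leb R n.+1]_(x in H) `|(`|u x| `^ ps * w x)%:E| = 0)%E.
  under eq_integral do rewrite gee0_abs ?lee_fin ?mulr_ge0 ?powR_ge0 ?(ltW (w0 _))//.
  apply/eqP; rewrite eq_le; apply/andP; split; last first.
    by apply: integral_ge0 => x _; rewrite lee_fin mulr_ge0 ?powR_ge0// ltW.
  by apply/lee_addgt0Pr => d d0; rewrite add0e; exact: small.
have {z} u0 : {ae leb R n.+1, forall x, H x -> u x = 0}.
  have := (ae_eq_integral_abs (leb R n.+1) mH mup).1 z.
  apply: filterS => x h /h [] /eqP; rewrite mulf_eq0 (gt_eqF (w0 x)) orbF.
  by rewrite powR_eq0 normr_eq0 => /andP[/eqP].
(* Both u and the energy of G vanish, so the zero sequence already converges to u. *)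
exists (fun _ _ => 0); first by move=> _; exact: test_fun0.
exists G => //.
have g0 : grad (fun _ : 'rV[R]_n.+1 => (0 : R)) = fun=> 0.
  by apply/funext => x; apply/rowP => i; rewrite !mxE /partial; exact: derive_cst.
rewrite /W1p_norm g0.
have -> : (\int[leb R n.+1]_(x in H) (`|u x - 0| `^ p)%:E = 0)%E.
  transitivity (\int[leb R n.+1]_(x in H) (0 : \bar R))%E; last exact: integral0.
  apply: ge0_ae_eq_integral => //.
  - apply/measurable_EFinP; apply: (measurableT_comp (measurable_powR _)).
    by apply: measurableT_comp => //; under eq_fun do rewrite subr0.
  - by apply: filterS u0 => x h Hx; rewrite h// subr0 normr0 powR0// gt_eqF.
under eq_integral do rewrite subr0.
rewrite E0 adde0 -[(0 `^ _)%E]/((0 : R)%:E `^ p^-1)%E poweR_EFin powR0 ?invr_eq0 ?gt_eqF//.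
exact: cvg_cst.
Qed.

End trace_inequality_W1p.

(** * Truncated fundamental solutions *)

Section radial_integral.
Context (R : realType).

Lemma continuous_sum_sqr n (A : R) :
  continuous (fun y : 'rV[R]_n => A + \sum_i y ord0 i ^+ 2).
Proof.
move=> y; apply: (@continuousD _ _ _ (fun=> A) (fun y : 'rV[R]_n => \sum_i y ord0 i ^+ 2)).
  exact: cst_continuous.
apply: (@continuous_sum_ord _ _ _ (fun i (y : 'rV[R]_n) => y ord0 i ^+ 2)) => i z.
apply: (@continuousM _ _ (fun y : 'rV[R]_n => y ord0 i) (fun y => y ord0 i));
  exact: coord_continuous.
Qed.

(** With the first coordinate fixed at z, the others see the same integrand with A replaced by the
    root of A^2 + z^2; what remains in z is a profile of exponent a - n. *)
Lemma integral_radial n (a A : R) : n%:R < a -> 0 < A ->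
  (\int[leb R n]_y ((A ^+ 2 + \sum_i y ord0 i ^+ 2) `^ (- (a / 2)))%:E =
   (A `^ (n%:R - a) * profile_masses n a)%:E)%E.
Proof.
elim: n A => [|n IH] A na A0.
  rewrite ge0_integral_leb0; last 2 first.
  - by move=> x; rewrite lee_fin powR_ge0.
  - apply/measurable_EFinP; apply: continuous_measurable_rV.
    by under eq_fun do rewrite big_ord0; exact: cst_continuous.
  rewrite big_ord0 addr0 /profile_masses big_ord0 mulr1 -powR_mulrn ?(ltW A0)// -powRrM.
  by congr (_ `^ _)%:E; rewrite sub0r; field.
have na' : n%:R < a by apply: lt_trans na; rewrite ltr_nat.
have na1 : 1 < a - n%:R by move: na; rewrite -natr1; lra.
have s0 m (y : 'rV[R]_m) : 0 <= \sum_i y ord0 i ^+ 2.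
  by apply: sumr_ge0 => i _; exact: sqr_ge0.
rewrite ge0_integral_cons; last 2 first.
- apply/measurable_EFinP; apply: continuous_measurable_rV => y.
  apply: (@continuous_powR_comp _ _ (fun y : 'rV[R]_n.+1 => A ^+ 2 + \sum_i y ord0 i ^+ 2)).
    by rewrite ltr_wpDr// exprn_gt0.
  exact: continuous_sum_sqr.
- by move=> y; rewrite lee_fin powR_ge0.
transitivity (\int[@lebesgue_measure R]_z ((profile_masses n a)%:E *
    ((A ^+ 2 + z ^+ 2) `^ (- ((a - n%:R) / 2)))%:E))%E.
  apply: eq_integral => z _.
  have Az : 0 < A ^+ 2 + z ^+ 2 by rewrite ltr_wpDr ?sqr_ge0// exprn_gt0.
  have As : 0 < Num.sqrt (A ^+ 2 + z ^+ 2) by rewrite sqrtr_gt0.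
  transitivity (\int[leb R n]_y
      ((Num.sqrt (A ^+ 2 + z ^+ 2) ^+ 2 + \sum_i y ord0 i ^+ 2) `^ (- (a / 2)))%:E)%E.
    apply: eq_integral => y _; congr (_ `^ _)%:E.
    rewrite sqr_sqrtr ?(ltW Az)// big_ord_recl cons_rV0 addrA; congr (_ + _).
    by apply: eq_bigr => i _; rewrite cons_rV_lift.
  rewrite IH// -EFinM mulrC; congr (_ * _)%:E.
  rewrite -powR12_sqrt ?(ltW Az)// -powRrM; by congr (_ `^ _); field.
have mq : measurable_fun setT (fun z : measurableTypeR R =>
    ((A ^+ 2 + z ^+ 2) `^ (- ((a - n%:R) / 2)))%:E).
  apply/measurable_EFinP; apply: (measurableT_comp (measurable_powR _)).
  by apply: measurable_funD => //; exact: measurable_funX.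
have K0 : (0 <= (profile_masses n a)%:E)%E.
  rewrite lee_fin; apply: prodr_ge0 => j _; apply/ltW/profile_mass_gt0.
  have : (j : nat).+1%:R <= n%:R :> R by rewrite ler_nat.
  by rewrite -natr1; move: na1; lra.
have q0 (z : R) : (0 <= ((A ^+ 2 + z ^+ 2) `^ (- ((a - n%:R) / 2)))%:E)%E.
  by rewrite lee_fin powR_ge0.
rewrite (@ge0_integralZl _ _ _ (@lebesgue_measure R) setT measurableT _ mq _ (fun z _ => q0 z) K0).
rewrite integral_scaled_profile// -EFinM; congr (_%:E).
rewrite /profile_masses big_ord_recr /= mulrCA; congr (_ `^ _ * _).
by rewrite -natr1; ring.
Qed.

End radial_integral.

Section bubble.
Context (R : realType) (n : nat).
Local Notation rV := 'rV[R]_n.+1.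

(** The squared distance from x to the pole -e_N. *)
Definition pole_sqr (x : rV) : R := \sum_i (x ord0 i + (i == ord_max)%:R) ^+ 2.

(* Equal to pole_sqr where it is at least 1, in particular on the half-space. *)
Definition pole_reg (x : rV) : R := pole_sqr x + flat 0 (1 - pole_sqr x).

(** A smooth substitute for the positive part of s - d: it equals (s - d) exp(-d/(s - d)) for s > d
    and 0 otherwise. *)
Definition soft_cut (d s : R) : R := d * flat 1 (s / d - 1).

Definition bubble (b d : R) (x : rV) : R := soft_cut d (pole_reg x `^ (- (b / 2))).

Lemma pole_sqr_ge0 x : 0 <= pole_sqr x.
Proof. by apply: sumr_ge0 => i _; exact: sqr_ge0. Qed.

Lemma pole_reg_gt0 x : 0 < pole_reg x.
Proof.
rewrite /pole_reg; have [h|h] := leP 1 (pole_sqr x).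
  by rewrite ltr_wpDr ?flat_ge0// (lt_le_trans ltr01).
by rewrite ltr_wpDl ?pole_sqr_ge0// flat_gt0// subr_gt0.
Qed.

Lemma pole_sqr_gt1 x : half_space x -> 1 < pole_sqr x.
Proof.
move=> /(_ ord_max erefl) x0; rewrite /pole_sqr (bigD1 ord_max)//= eqxx.
apply: (@lt_le_trans _ _ ((x ord0 ord_max + 1) ^+ 2)).
  by rewrite -[ltLHS](expr1n R 2) ltrXn2r ?nnegrE// ?ltrDr ?addr_ge0 ?(ltW x0).
by rewrite lerDl sumr_ge0// => i _; exact: sqr_ge0.
Qed.

Lemma Ck_pole_sqr k : Ck k pole_sqr.
Proof.
apply: Ck_sum => i; under eq_fun do rewrite expr2.
by apply: CkM; apply: CkD; first [exact: Ck_coord | exact: Ck_cst].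
Qed.

Lemma Ck_pole_reg k : Ck k pole_reg.
Proof.
apply: CkD; first exact: Ck_pole_sqr.
by apply: Ck_flat; apply: CkD; [exact: Ck_cst|apply: CkN; exact: Ck_pole_sqr].
Qed.

Lemma Ck_bubble k b d : Ck k (bubble b d).
Proof.
apply: CkM; first exact: Ck_cst.
apply: Ck_flat; apply: CkD; last exact: Ck_cst.
apply: CkM; last exact: Ck_cst.
by apply: Ck_powR; [exact: pole_reg_gt0|exact: Ck_pole_reg].
Qed.

Lemma bubble_supported b d : 0 < b -> 0 < d -> exists M, supported_in M (bubble b d).
Proof.
(* A is the squared distance at which the power -b/2 takes the value d. The margin 3 absorbs the
   shift by 1 in the last coordinate and leaves |x + e_N| >= A + 1, whose square is at least A. *)
move=> b0 d0; pose A := d `^ (- (2 / b)).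
exists (A + 3) => x j xj; rewrite /bubble /soft_cut flat_le0 ?mulr0//.
rewrite subr_le0 ler_pdivrMr// mul1r.
have dE : d = A `^ (- (b / 2)).
  rewrite /A -powRrM (_ : - (2 / b) * - (b / 2) = 1) ?powRr1 ?(ltW d0)//.
  by field; rewrite gt_eqF.
rewrite [leRHS]dE; apply: powR_lower; [exact: powR_gt0| |by rewrite divr_ge0// ltW].
rewrite /pole_reg; apply: (@le_trans _ _ (pole_sqr x)); last by rewrite lerDl flat_ge0.
rewrite /pole_sqr (bigD1 j)//=.
apply: (@le_trans _ _ ((x ord0 j + (j == ord_max)%:R) ^+ 2)); last first.
  by rewrite lerDl sumr_ge0// => i _; exact: sqr_ge0.
have A0 : 0 < A by exact: powR_gt0.
have h : A + 1 <= `|x ord0 j + (j == ord_max)%:R|.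
  have h1 : `|x ord0 j| <= `|x ord0 j + (j == ord_max)%:R| + 1.
    rewrite -{1}[x ord0 j](addrK (j == ord_max)%:R) (le_trans (ler_normB _ _))// lerD2l.
    by case: (j == _); rewrite ?normr1// normr0.
  by move: xj h1; lra.
rewrite -real_normK ?num_real//; apply: (@le_trans _ _ ((A + 1) ^+ 2)).
  by rewrite sqrrD mulr1 expr1n; have := sqr_ge0 A; lra.
by rewrite lerXn2r ?nnegrE ?addr_ge0 ?(ltW A0).
Qed.

Lemma test_bubble b d : 0 < b -> 0 < d -> test_fun setT (bubble b d).
Proof.
move=> b0 d0; split => //; first by apply: Ck_smooth => k; exact: Ck_bubble.
have [M sM] := bubble_supported b0 d0.
apply: (@compact_closure_bounded _ _ _ M) => x /= fx i.
by rewrite leNgt; apply/negP => /sM h; rewrite h eqxx in fx.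
Qed.

Lemma is_derive_pole_sqr x i :
  is_derive x (delta_mx ord0 i) pole_sqr (2 * (x ord0 i + (i == ord_max)%:R)).
Proof.
suff H : h^-1 *: ((pole_sqr \o shift x) (h *: delta_mx ord0 i) - pole_sqr x)
    @[h --> 0^'] --> (2 * (x ord0 i + (i == ord_max)%:R) : R).
  by split; [apply/cvg_ex; eexists; exact: H|exact/cvg_lim].
set l := 2 * _.
have nE : \forall h \near (0 : R)^', l + h =
    h^-1 *: ((pole_sqr \o shift x) (h *: delta_mx ord0 i) - pole_sqr x).
  near=> h; have h0 : h != 0 by near: h; exact: nbhs_dnbhs_neq.
  rewrite /pole_sqr /= (bigD1 i)//= [X in _ - X](bigD1 i)//=.
  rewrite (eq_bigr (fun j => (x ord0 j + (j == ord_max)%:R) ^+ 2)); last first.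
    by move=> j ji; rewrite !mxE eqxx (negbTE ji) mulr0 add0r.
  rewrite !mxE !eqxx mulr1 /l [RHS]mulrC.
  by field.
have : l + h @[h --> (0 : R)^'] --> (l + 0 : R).
  by apply: cvgD; [exact: cvg_cst|apply: cvg_within_filter; exact: cvg_id].
by rewrite addr0; apply: cvg_trans; exact: near_eq_cvg nE.
Unshelve. all: by end_near. Qed.

Lemma is_derive_pole_reg x i : half_space x ->
  is_derive x (delta_mx ord0 i) pole_reg (2 * (x ord0 i + (i == ord_max)%:R)).
Proof.
move=> Hx; have s1 := pole_sqr_gt1 Hx.
apply: (@near_eq_is_derive _ _ _ pole_sqr); last exact: is_derive_pole_sqr.
have cs : {for x, continuous pole_sqr} by exact: Ck_continuous (Ck_pole_sqr 0) x.
have : \forall y \near x, 1 < pole_sqr y by exact: (cvgr_gt _ cs).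
by apply: filterS => y y1; rewrite /pole_reg flat_le0 ?addr0// subr_le0 ltW.
Qed.

(** The slope is exp(-1/y) (1 + 1/y) for y > 0, and 1 + 1/y <= exp(1/y). So the truncation is
    nondecreasing with slope at most 1, and the gradient of the bubble is at most that of the
    untruncated power. *)
Lemma soft_cut_slope (y : R) : 0 <= 1 * flat (1 - 1) y + flat (1 - 2) y <= 1.
Proof.
rewrite mul1r addr_ge0 ?flat_ge0//= subrr /flat; case: ifP => [y0|]; last by rewrite addr0.
rewrite powRr0 mul1r (_ : 1 - 2 = -1 :> R); last by ring.
rewrite powR_inv1 ?(ltW y0)// -{1}[expR _]mul1r -mulrDl expRN.
by rewrite ler_pdivrMr ?expR_gt0// mul1r expR_ge1Dx.
Qed.

Lemma enormZ (k : R) (z : rV) : enorm (k *: z) = `|k| * enorm z.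
Proof.
rewrite /enorm -sqrtr_sqr -sqrtrM ?sqr_ge0//; congr Num.sqrt.
by rewrite mulr_sumr; apply: eq_bigr => i _; rewrite mxE exprMn.
Qed.

Lemma enorm_grad_bubble b d x : 0 < b -> 0 < d -> half_space x ->
  enorm (grad (bubble b d) x) <= b * pole_sqr x `^ (- ((b + 1) / 2)).
Proof.
move=> b0 d0 Hx; have s1 := pole_sqr_gt1 Hx.
have s0 : 0 < pole_sqr x := lt_trans ltr01 s1.
pose y := pole_reg x `^ (- (b / 2)) / d - 1.
pose k := 1 * flat (1 - 1) y + flat (1 - 2) y.
have rE : pole_reg x = pole_sqr x by rewrite /pole_reg flat_le0 ?addr0// subr_le0 ltW.
pose z : rV := \row_i (x ord0 i + (i == ord_max)%:R).
have gE : grad (bubble b d) x = (- (k * b * pole_sqr x `^ (- (b / 2) - 1))) *: z.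
  apply/rowP => i; rewrite !mxE.
  have D1 := is_derive_line_comp (is_derive_pole_reg i Hx) (is_derive1_powR (- (b / 2)) (pole_reg_gt0 x)).
  pose h (s : R) := d * flat 1 (s / d - 1).
  have Dh : is_derive (pole_reg x `^ (- (b / 2))) 1 h k.
    have Da : is_derive (pole_reg x `^ (- (b / 2))) 1 (fun s : R => s / d - 1) d^-1.
      have := is_deriveB (is_deriveM (is_derive_id (pole_reg x `^ (- (b / 2))) (1 : R))
        (is_derive_cst (d^-1) (pole_reg x `^ (- (b / 2))) (1 : R)))
        (is_derive_cst (1 : R) (pole_reg x `^ (- (b / 2))) (1 : R)).
      by move/is_derive_eq; apply; rewrite /GRing.scale/= mulr0 add0r mulr1 subr0.
    have := is_deriveZ d (@is_derive1_comp R (flat 1) (fun s => s / d - 1) _ _ _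
      (is_derive_flat 1 y) Da).
    move/is_derive_eq; apply.
    by rewrite /GRing.scale/= -/k mulrCA mulfV ?mulr1// gt_eqF.
  have [_ DE] := is_derive_line_comp D1 Dh.
  rewrite (_ : partial i (bubble b d) x = k * (- (b / 2) * pole_reg x `^ (- (b / 2) - 1) *
    (2 * (x ord0 i + (i == ord_max)%:R)))); last exact: DE.
  by rewrite rE; field.
have /andP[k0 k1] : 0 <= k <= 1 by exact: soft_cut_slope.
have zE : enorm z = pole_sqr x `^ (2^-1).
  rewrite powR12_sqrt ?(ltW s0)// /enorm; congr Num.sqrt.
  by apply: eq_bigr => i _; rewrite mxE.
rewrite gE enormZ normrN zE ger0_norm; last first.
  by rewrite !mulr_ge0 ?powR_ge0// ltW.
rewrite -!mulrA -powRD ?(gt_eqF s0) ?implybT//.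
rewrite (_ : - (b / 2) - 1 + 2^-1 = - ((b + 1) / 2)); last by field.
by rewrite -[leRHS]mul1r ler_wpM2r// mulr_ge0 ?powR_ge0// ltW.
Qed.

Lemma pole_sqr_snoc (y : 'rV[R]_n) (t : R) :
  pole_sqr (snoc_rV y t) = (1 + t) ^+ 2 + \sum_i y ord0 i ^+ 2.
Proof.
rewrite /pole_sqr big_ord_recr /= snoc_rV_max eqxx addrC [t + _]addrC; congr (_ + _).
apply: eq_bigr => i _; rewrite snoc_rV_widen (_ : (_ == _) = false) ?addr0//.
by apply/eqP => /(congr1 val) /= h; have := ltn_ord i; rewrite h ltnn.
Qed.

Lemma bubble_bdry b d (y : 'rV[R]_n) :
  bubble b d (snoc_rV y 0) = soft_cut d ((1 + \sum_i y ord0 i ^+ 2) `^ (- (b / 2))).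
Proof.
rewrite /bubble /pole_reg pole_sqr_snoc addr0 expr1n flat_le0 ?addr0//.
by rewrite subr_le0 lerDl sumr_ge0// => i _; exact: sqr_ge0.
Qed.

End bubble.

(** * The value of the infimum *)

Section optimal_constant.
Context (R : realType) (n : nat) (p : R).
Hypotheses (n0 : (0 < n)%N) (p1 : 1 < p) (pN : p < n.+1%:R).
Local Notation H := (@half_space R n.+1).
Local Notation ps := (pstar n.+1 p).
Local Notation c := (trace_const n p).
Local Notation a := (p * n%:R / (p - 1)).
Local Notation beta := (n%:R / (p - 1) - 1).
Local Notation K0 := (profile_masses n a).

Let p0 : 0 < p. Proof. exact: lt_trans p1. Qed.
Let p10 : 0 < p - 1. Proof. by rewrite subr_gt0. Qed.
Let nR : 0 < n%:R :> R. Proof. by rewrite ltr0n. Qed.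
Let ps0 : 0 < ps. Proof. exact: pstar_gt0. Qed.
Let c0 : 0 < c. Proof. exact: trace_const_gt0. Qed.
Let pn : p - 1 < n%:R. Proof. by rewrite ltrBlDr natr1. Qed.
Let K00 : 0 < K0. Proof. exact: profile_masses_gt0. Qed.
Let mH : measurable H. Proof. exact: measurable_half_space. Qed.
Let beta0 : 0 < beta.
Proof. by rewrite subr_gt0 ltr_pdivlMr// mul1r ltrBlDr natr1. Qed.
Let Np0 : 0 < n.+1%:R - p. Proof. by rewrite subr_gt0. Qed.

Let a_n : a - n%:R = beta + 1.
Proof. by field; rewrite gt_eqF. Qed.

Let na : n%:R < a.
Proof. by rewrite -subr_gt0 a_n addr_gt0. Qed.

(** If the trace vanishes, the quotient is E times the inverse of 0, which is +oo for E > 0 but 0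
    for E = 0. Excluding W^{1,p}_0 excludes the second case by [energy_eq0_W1p0]. *)
Lemma le_quotient (u : 'rV[R]_n.+1 -> R) (G : 'rV[R]_n.+1 -> 'rV[R]_n.+1) (g : 'rV[R]_n -> R) :
  ~ W1p0 H p u -> W1p_grad H p u G -> @is_trace R n.+1 p u g ->
  (c%:E <= @trace_quotient R n.+1 p G g)%E.
Proof.
move=> nu uG ug; have := trace_inequality n0 p1 pN uG ug.
have E0 : (\int[leb R n.+1]_(x in H) (enorm (G x) `^ p)%:E)%E <> 0%E.
  by move=> E0; apply: nu; exact: (energy_eq0_W1p0 n0 p1 pN uG ug E0).
have := energy_fin p1 uG.
rewrite /trace_quotient.
have Ege : (0 <= \int[leb R n.+1]_(x in H) (enorm (G x) `^ p)%:E)%E.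
  by apply: integral_ge0 => x _; rewrite lee_fin powR_ge0.
move: E0 Ege; move: (\int[leb R n.+1]_(x in H) _)%E => E E0 Ege Efin.
have D0 : (0 <= (\int[leb R n]_y (`|g y| `^ ps)%:E) `^ (p / ps))%E by exact: poweR_ge0.
move: D0; rewrite /=; move: ((\int[leb R n]_y _) `^ _)%E => D.
case: E E0 Ege Efin => // r E0 Ege _; case: D => [s| |]//.
- move=> s0 h; have [sz|sn] := eqVneq s 0.
    rewrite sz inve0 gt0_muley ?leey//.
    by rewrite lt_neqAle Ege andbT; apply/eqP => h'; apply: E0.
  have sp : 0 < s by rewrite lt_neqAle eq_sym sn -lee_fin.
  rewrite inver (negbTE sn) -EFinM lee_fin ler_pdivlMr//.
- by move=> _; rewrite gt0_muley ?lte_fin// leye_eq.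
Qed.

Lemma trace_const_le_Kp_inv : (c%:E <= Kp_inv R n.+1 p)%E.
Proof.
apply: le_ereal_inf_tmp => _ [u [G [g [[_ nu] uG ug ->]]]].
exact: le_quotient nu uG ug.
Qed.

(** The integrand is at most beta^p |x + e_N|^(-a), because (beta + 1) p = a. The slice at height t
    contributes (1 + t)^(n - a) K0 = (1 + t)^(-beta - 1) K0, and integration in t divides by
    beta. *)
Lemma energy_bubble (d : R) : 0 < d ->
  (\int[leb R n.+1]_(x in H) (enorm (grad (bubble beta d) x) `^ p)%:E <=
   (beta `^ (p - 1) * K0)%:E)%E.
Proof.
move=> d0.
have Cb : C1 (bubble (n := n) beta d) by apply/C1_Ck; exact: Ck_bubble.
pose F (x : 'rV[R]_n.+1) : \bar R := ((beta `^ p)%:E * (pole_sqr x `^ (- (a / 2)))%:E)%E.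
have bp0 : 0 <= beta `^ p by exact: powR_ge0.
have F0 x : (0 <= F x)%E by rewrite mule_ge0// lee_fin ?powR_ge0.
have mF : measurable_fun setT F.
  apply: emeasurable_funM; first exact: measurable_cst.
  apply/measurable_EFinP; apply: (measurableT_comp (measurable_powR _)).
  by apply: continuous_measurable_rV; exact: Ck_continuous (Ck_pole_sqr R n 0).
apply: (@le_trans _ _ (\int[leb R n.+1]_(x in H) F x)%E).
  apply: ge0_le_integral => //.
  - by move=> x _; rewrite lee_fin powR_ge0.
  - apply/measurable_EFinP; apply: (measurableT_comp (measurable_powR _)).
    by apply: measurable_funTS; exact: measurable_enorm_grad.
  - exact: measurable_funTS.
  - move=> x Hx; rewrite /F -EFinM lee_fin.
    have s0 : 0 < pole_sqr x := lt_trans ltr01 (pole_sqr_gt1 Hx).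
    rewrite (_ : - (a / 2) = - ((beta + 1) / 2) * p); last by field; rewrite gt_eqF.
    rewrite powRrM -powRM ?powR_ge0 ?(ltW beta0)//.
    apply: ge0_ler_powR; rewrite ?nnegrE ?enorm_ge0 ?(ltW p0)//.
      by rewrite mulr_ge0 ?powR_ge0 ?(ltW beta0).
    exact: enorm_grad_bubble.
rewrite (@ge0_integral_half_space R n F mF F0).
have mt : measurable_fun (`[0%R, +oo[ : set (measurableTypeR R))
    (fun t : measurableTypeR R => ((1 + 1 * t) `^ (- (a - n%:R)))%:E).
  apply: measurable_funTS; apply/measurable_EFinP; apply: (measurableT_comp (measurable_powR _)).
  by apply: measurable_funD => //; apply: measurable_funM => //; exact: measurable_cst.
have bK0 : (0 <= (beta `^ p * K0)%:E)%E by rewrite lee_fin mulr_ge0// ltW.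
rewrite (_ : (\int[_]_(t in _) _)%E = \int[@lebesgue_measure R]_(t in `[0%R, +oo[)
  ((beta `^ p * K0)%:E * ((1 + 1 * t) `^ (- (a - n%:R)))%:E))%E; last first.
  apply: eq_integral => t; rewrite inE /= in_itv/= andbT => t0.
  have t1 : 0 < 1 + t by rewrite ltr_wpDr.
  have my : measurable_fun setT (fun y : 'rV[R]_n =>
      (((1 + t) ^+ 2 + \sum_i y ord0 i ^+ 2) `^ (- (a / 2)))%:E).
    apply/measurable_EFinP; apply: (measurableT_comp (measurable_powR _)).
    by apply: continuous_measurable_rV; exact: continuous_sum_sqr.
  transitivity (\int[leb R n]_y ((beta `^ p)%:E *
      (((1 + t) ^+ 2 + \sum_i y ord0 i ^+ 2) `^ (- (a / 2)))%:E))%E.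
    by apply: eq_integral => y _; rewrite /F pole_sqr_snoc.
  have q0 (y : 'rV[R]_n) : (0 <= (((1 + t) ^+ 2 + \sum_i y ord0 i ^+ 2) `^ (- (a / 2)))%:E)%E.
    by rewrite lee_fin powR_ge0.
  have bpE : (0 <= (beta `^ p)%:E)%E by rewrite lee_fin.
  rewrite (@ge0_integralZl _ _ _ (leb R n) setT measurableT _ my _ (fun y _ => q0 y) bpE).
  by rewrite integral_radial// -!EFinM mul1r opprB mulrA mulrAC.
have t0 (t : R) : `[0%R, +oo[%classic t -> (0 <= ((1 + 1 * t) `^ (- (a - n%:R)))%:E)%E.
  by move=> _; rewrite lee_fin powR_ge0.
rewrite (@ge0_integralZl _ _ _ (@lebesgue_measure R) _ (measurable_itv _) _ mt _ t0 bK0).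
rewrite integral_affine_powR//; last by rewrite a_n ltrDr.
rewrite -EFinM lee_fin a_n mul1r addrK -(mulr_powRB1 (ltW beta0) p0).
rewrite le_eqVlt; apply/orP; left; apply/eqP.
rewrite -!mulrA mulrC -!mulrA; congr (_ * _).
by rewrite mulVf ?mulr1// gt_eqF.
Qed.

Lemma bubble_W1p_grad (d : R) : 0 < d ->
  W1p_grad H p (bubble beta d) (grad (bubble beta d)).
Proof.
move=> d0; have Cb : C1 (bubble (n := n) beta d) by apply/C1_Ck; exact: Ck_bubble.
have [M sM] := bubble_supported n beta0 d0.
split; last exact: weak_grad_C1.
  by apply: (continuous_bounded_Lp p0 mH _ sM); exact: C1_continuous.
move=> i; rewrite (_ : (fun _ => _) = partial i (bubble beta d)); last first.
  by apply/funext => x; rewrite mxE.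
apply: (continuous_bounded_Lp p0 mH _ (partial_supported_in i sM)).
by case: Cb.
Qed.

Let W1p_norm0 (u : 'rV[R]_n.+1 -> R) (G : 'rV[R]_n.+1 -> 'rV[R]_n.+1) :
  (W1p_norm H p (fun x => u x - u x)%R (fun x => G x - G x)%R = 0)%E.
Proof.
rewrite /W1p_norm.
have -> : (\int[leb R n.+1]_(x in H) (`|u x - u x| `^ p)%:E = 0)%E.
  by apply: integral0_eq => x _; rewrite subrr normr0 powR0// gt_eqF.
have -> : (\int[leb R n.+1]_(x in H) (enorm (G x - G x) `^ p)%:E = 0)%E.
  apply: integral0_eq => x _; rewrite subrr.
  have -> : enorm (0 : 'rV[R]_n.+1) = 0.
    by rewrite /enorm big1 ?sqrtr0// => i _; rewrite mxE expr0n.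
  by rewrite powR0// gt_eqF.
by rewrite adde0 -[(0 `^ _)%E]/((0 : R)%:E `^ p^-1)%E poweR_EFin powR0 ?invr_eq0 ?gt_eqF.
Qed.

Lemma bubble_is_trace (d : R) : 0 < d ->
  @is_trace R n.+1 p (bubble beta d) (fun y : 'rV[R]_n => bubble beta d (snoc_rV y 0)).
Proof.
move=> d0; have Cb : C1 (bubble (n := n) beta d) by apply/C1_Ck; exact: Ck_bubble.
have [M sM] := bubble_supported n beta0 d0.
split.
  have := @continuous_bounded_Lp R n setT p M (fun y : 'rV[R]_n => bubble beta d (snoc_rV y 0))
    p0 measurableT (continuous_trace Cb).
  rewrite /Lp patch_setT; apply => y j yj.
  by apply: (sM _ (widen_ord (leqnSn n) j)); rewrite snoc_rV_widen.
exists (fun=> bubble beta d); split; first by move=> _; exact: test_bubble.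
  exists (grad (bubble beta d)); first exact: bubble_W1p_grad.
  by under eq_fun do rewrite W1p_norm0; exact: cvg_cst.
rewrite (_ : (fun _ : nat => _) = cst 0%E); first exact: cvg_cst.
apply/funext => k; rewrite LnormE.
have -> : (\int[leb R n]_y (`|bubble beta d (snoc_rV y 0) -
    bubble beta d (bdry (y : 'rV[R]_n.+1.-1))| `^ p)%:E = 0)%E.
  by apply: integral0_eq => y _; rewrite subrr normr0 powR0// gt_eqF.
by rewrite -[(0 `^ _)%E]/((0 : R)%:E `^ p^-1)%E poweR_EFin powR0 ?invr_eq0 ?gt_eqF.
Qed.

(** Test functions of the open half-space vanish on the boundary, so subtracting them leaves the
    trace of the bubble unchanged. By the sharp inequality the energy of the difference stays above
    a positive constant. *)
Lemma bubble_not_W1p0 (d : R) : 0 < d ->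
  (0 < \int[leb R n]_y (`|bubble beta d (snoc_rV y 0)| `^ ps)%:E)%E ->
  ~ W1p0 H p (bubble beta d).
Proof.
move=> d0 D0 [phi tphi cphi].
have Cb : C1 (bubble (n := n) beta d) by apply/C1_Ck; exact: Ck_bubble.
have [M sM] := bubble_supported n beta0 d0.
have tphi' k : test_fun setT (phi k) by apply: test_fun_sub (tphi k).
have [_ nG] := W1p_cvg_near p1 tphi' cphi (bubble_W1p_grad d0).
pose v k x := bubble beta d x - phi k x.
have Cv k : C1 (v k).
  apply/C1_Ck; apply: CkD; first exact: Ck_bubble.
  by apply: CkN; apply: smooth_Ck; case: (tphi k).
have bv k : bounded_support (v k).
  have [M' sM'] := test_fun_supported (tphi k).
  exists (Num.max M M') => x i; rewrite gt_max => /andP[h1 h2].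
  by rewrite /v (sM _ _ h1) (sM' _ _ h2) subrr.
have vE k (y : 'rV[R]_n) : v k (snoc_rV y 0) = bubble beta d (snoc_rV y 0).
  have nH : ~ H (snoc_rV y 0) by move/mem_set; rewrite half_space_snoc ltxx.
  by have [z _] := test_fun_out (tphi k) nH; rewrite /v z subr0.
have gv k x : grad (v k) x = grad (bubble beta d) x - grad (phi k) x.
  apply/rowP => i; rewrite !mxE.
  have [_ DE] := is_deriveB (is_derive_partial Cb x i)
    (is_derive_partial (test_fun_C1 (tphi k)) x i).
  exact: DE.
have finD := trace_integral_fin n0 p1 pN Cb (ex_intro _ M sM).
have st k : (c%:E * (\int[leb R n]_y (`|bubble beta d (snoc_rV y 0)| `^ ps)%:E) `^ (p / ps) <=
    \int[leb R n.+1]_(x in H) (enorm (grad (bubble beta d) x - grad (phi k) x) `^ p)%:E)%E.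
  have := sharp_trace n0 p1 pN (Cv k) (bv k).
  under eq_integral do rewrite vE.
  by under [X in (_ <= X)%E -> _]eq_integral do rewrite gv.
move: finD D0 st; move: (\int[leb R n]_y _)%E => D; case: D => // r _.
rewrite lte_fin poweR_EFin => r0 st.
have e0 : 0 < c * r `^ (p / ps) / 2 by rewrite divr_gt0// mulr_gt0// powR_gt0.
have [k hk] := @filter_ex _ _ _ _ (nG _ e0).
have := le_trans (st k) hk; rewrite -EFinM lee_fin.
by move: e0; set z := c * _; lra.
Qed.

Lemma bubble_trace_le (d k : R) : 0 < d -> 0 < k -> (k%:E <= Kp_inv R n.+1 p)%E ->
  (\int[leb R n]_y (`|bubble beta d (snoc_rV y 0)| `^ ps)%:E <=
   ((beta `^ (p - 1) * K0 / k) `^ (ps / p))%:E)%E.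
Proof.
move=> d0 k0 kK.
have Cb : C1 (bubble (n := n) beta d) by apply/C1_Ck; exact: Ck_bubble.
have [M sM] := bubble_supported n beta0 d0.
have finD := trace_integral_fin n0 p1 pN Cb (ex_intro _ M sM).
have D0 : (0 <= \int[leb R n]_y (`|bubble beta d (snoc_rV y 0)| `^ ps)%:E)%E.
  by apply: integral_ge0 => y _; rewrite lee_fin powR_ge0.
(* A zero trace does occur, for instance when d >= 1. The bubble is then no competitor for the
   infimum, but the bound is trivial. *)
have [->|Dn] := eqVneq (\int[leb R n]_y (`|bubble beta d (snoc_rV y 0)| `^ ps)%:E)%E 0%E.
  by rewrite lee_fin powR_ge0.
have Dp : (0 < \int[leb R n]_y (`|bubble beta d (snoc_rV y 0)| `^ ps)%:E)%E.
  by rewrite lt_neqAle eq_sym Dn.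
have qk : (k%:E <= @trace_quotient R n.+1 p (grad (bubble beta d))
    (fun y : 'rV[R]_n => bubble beta d (snoc_rV y 0)))%E.
  apply: (le_trans kK); apply: ereal_inf_lbound.
  exists (bubble beta d), (grad (bubble beta d)), (fun y : 'rV[R]_n => bubble beta d (snoc_rV y 0)).
  split=> //; [split|exact: bubble_W1p_grad|exact: bubble_is_trace].
    by exists (grad (bubble beta d)); exact: bubble_W1p_grad.
  exact: bubble_not_W1p0.
have := energy_bubble d0; have := energy_fin p1 (bubble_W1p_grad d0).
move: qk; rewrite /trace_quotient /=.
move: (\int[leb R n.+1]_(x in H) _)%E => E.
move: finD Dp; move: (\int[leb R n]_y _)%E => D; case: D => // r _; rewrite lte_fin => r0.
rewrite poweR_EFin inver gt_eqF ?powR_gt0//; case: E => // e.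
rewrite -EFinM !lee_fin ler_pdivlMr ?powR_gt0// => h1 _ h2.
have h : r `^ (p / ps) <= beta `^ (p - 1) * K0 / k.
  by rewrite ler_pdivlMr// mulrC; exact: le_trans h2.
have -> : r = (r `^ (p / ps)) `^ (ps / p).
  rewrite -powRrM (_ : p / ps * (ps / p) = 1) ?powRr1 ?(ltW r0)//.
  by field; rewrite !gt_eqF.
apply: ge0_ler_powR; rewrite ?nnegrE ?powR_ge0//.
  by rewrite divr_ge0 ?ltW.
by apply: le_trans h; exact: powR_ge0.
Qed.

Lemma flat1E (y : R) : flat 1 y = y * flat 0 y.
Proof.
rewrite /flat; case: ifPn => y0; last by rewrite mulr0.
by rewrite powRr1 ?(ltW y0)// powRr0 mul1r.
Qed.

Lemma cvg_soft_cut (s : R) : 0 < s -> soft_cut k.+1%:R^-1 s @[k --> \oo] --> s.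
Proof.
move=> s0.
have E : (fun k => soft_cut k.+1%:R^-1 s) =
    (fun k => (s - k.+1%:R^-1) * flat 0 (k.+1%:R * s - 1)).
  apply/funext => k; rewrite /soft_cut flat1E invrK mulrA [s * _]mulrC mulrBr mulr1.
  by rewrite mulrA mulVf ?mul1r// pnatr_eq0.
rewrite E -[X in _ --> X]mulr1; apply: cvgM; last exact: cvg_flat0.
rewrite -[X in _ --> X]subr0; apply: cvgB; first exact: cvg_cst.
exact: cvg_harmonic.
Qed.

(** Since beta pstar = a, the untruncated boundary value to the power pstar integrates to K0. The
    bound on truncated traces does not depend on the height d, and Fatou's lemma carries it over as
    d = 1/(j + 1) tends to 0. *)
Lemma trace_le_of_Kp_inv (k : R) : 0 < k -> (k%:E <= Kp_inv R n.+1 p)%E ->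
  K0 <= (beta `^ (p - 1) * K0 / k) `^ (ps / p).
Proof.
move=> k0 kK.
pose s (y : 'rV[R]_n) := (1 + \sum_i y ord0 i ^+ 2) `^ (- (beta / 2)).
have sq0 (y : 'rV[R]_n) : 0 <= \sum_i y ord0 i ^+ 2 by apply: sumr_ge0 => i _; exact: sqr_ge0.
have s1 (y : 'rV[R]_n) : 0 < 1 + \sum_i y ord0 i ^+ 2 by rewrite ltr_wpDr.
have s0 y : 0 < s y by exact: powR_gt0.
have mabs (f : 'rV[R]_n -> R) : measurable_fun setT f ->
    measurable_fun setT (fun y => `|f y| `^ ps).
  by move=> mf; apply: (measurableT_comp (measurable_powR _)); exact: measurableT_comp.
have K0E : (\int[leb R n]_y (`|s y| `^ ps)%:E = K0%:E)%E.
  have := @integral_radial R n a 1 na ltr01; rewrite powR1 mul1r => <-.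
  apply: eq_integral => y _; rewrite ger0_norm ?(ltW (s0 y))// /s -powRrM expr1n.
  congr (_ `^ _)%:E; rewrite /pstar -natr1; field.
  by rewrite nat1r !gt_eqF.
rewrite -lee_fin -K0E.
apply: (@fatou_le _ _ _ (leb R n) setT
  (fun j y => `|bubble beta j.+1%:R^-1 (snoc_rV y 0)| `^ ps)) => //.
- move=> j; apply: mabs; apply: continuous_measurable_rV; apply: continuous_trace.
  by apply/C1_Ck; exact: Ck_bubble.
- apply: mabs; apply: (measurableT_comp (measurable_powR _)).
  by apply: continuous_measurable_rV; exact: continuous_sum_sqr.
- apply: aeW => y _; apply: (@cvg_comp _ _ _ (fun j : nat => bubble beta j.+1%:R^-1 (snoc_rV y 0))
    (fun z : R => `|z| `^ ps) _ (nbhs (s y))).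
    by under eq_fun do rewrite bubble_bdry; exact: cvg_soft_cut.
  have h : continuous (fun z : R => `|z| `^ ps).
    by apply: continuous_powR_ge0 => //; exact: norm_continuous.
  exact: h.
- by apply: nearW => j; apply: bubble_trace_le.
Qed.

Theorem Kp_invE : Kp_inv R n.+1 p = c%:E.
Proof.
apply/eqP; rewrite eq_le trace_const_le_Kp_inv andbT leNgt; apply/negP => cK.
have [k kc kK] : exists2 k : R, c < k & (k%:E <= Kp_inv R n.+1 p)%E.
  move: cK; case: (Kp_inv R n.+1 p) => [r| |]//; first by rewrite lte_fin; exists r.
  by move=> _; exists (c + 1); rewrite ?ltrDl ?leey.
have k0 : 0 < k by exact: lt_trans kc.
have := trace_le_of_Kp_inv k0 kK; rewrite leNgt => /negP; apply.
have b1 : 0 < beta `^ (p - 1) by exact: powR_gt0.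
have lt1 : beta `^ (p - 1) * K0 / k < beta `^ (p - 1) * K0 / c.
  by rewrite ltr_pM2l ?mulr_gt0// ltf_pV2.
apply: (@lt_le_trans _ _ ((beta `^ (p - 1) * K0 / c) `^ (ps / p))).
  have q1 : 0 < beta `^ (p - 1) * K0 / k by rewrite divr_gt0// mulr_gt0.
  apply: gt0_ltr_powR => //; rewrite ?nnegrE ?(ltW q1) ?(ltW (lt_trans q1 lt1))//.
  by rewrite divr_gt0.
(* For k equal to the trace constant the bound is an equality, because 1 - (p - 1)/n = p/pstar; any
   larger k therefore violates it. *)
rewrite (_ : beta `^ (p - 1) * K0 / c = K0 `^ (p / ps)).
  rewrite -powRrM (_ : p / ps * (ps / p) = 1) ?powRr1 ?(ltW K00)//.
  by field; rewrite !gt_eqF.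
rewrite /trace_const invfM mulrACA mulfV ?gt_eqF// mul1r -powRN.
rewrite -{1}[K0](powRr1 (ltW K00)) -powRD ?(gt_eqF K00) ?implybT//.
congr (_ `^ _); rewrite /pstar -natr1; field.
by rewrite natr1 !gt_eqF.
Qed.

End optimal_constant.

(** * The Gamma function *)

Section Gamma_identity.
Context (R : realType).
Local Notation mu := (@lebesgue_measure R).
Local Notation D := (`]0%R, +oo[%classic : set (measurableTypeR R)).

(** The Gamma integral with values in the extended reals, so that scaling and Tonelli apply before
    finiteness is known. *)
Let gam (x : R) : \bar R := (\int[mu]_(t in D) (t `^ (x - 1) * expR (- t))%:E)%E.

Let mD : measurable D. Proof. exact: measurable_itv. Qed.

Let mexp (A : R) : measurable_fun setT (fun t : measurableTypeR R => expR (- (A * t)) : R).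
Proof.
apply: (measurableT_comp (@measurable_expR R)); apply: measurable_funN.
by apply: measurable_funM => //; exact: measurable_cst.
Qed.

Let mgam (A x : R) : measurable_fun setT
  (fun t : measurableTypeR R => (t `^ (x - 1) * expR (- (A * t)))%:E).
Proof.
apply/measurable_EFinP; apply: measurable_funM; last exact: mexp.
exact: measurable_powR.
Qed.

Let gam_ge0 (A x t : R) : (0 <= (t `^ (x - 1) * expR (- (A * t)))%:E)%E.
Proof. by rewrite lee_fin mulr_ge0 ?powR_ge0 ?expR_ge0. Qed.

Lemma Gamma_scale (x A : R) : 0 < A ->
  (\int[mu]_(t in D) (t `^ (x - 1) * expR (- (A * t)))%:E = (A `^ (- x))%:E * gam x)%E.
Proof.
move=> A0.
have A1 : (0 <= (A `^ x)%:E)%E by rewrite lee_fin powR_ge0.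
suff -> : gam x = ((A `^ x)%:E *
    \int[mu]_(t in D) (t `^ (x - 1) * expR (- (A * t)))%:E)%E.
  rewrite muleA -EFinM -powRD ?(gt_eqF A0) ?implybT//.
  by rewrite addNr powRr0 mul1e.
have m1 := mgam 1 x; have g1 := gam_ge0 1 x.
have gE : gam x = (\int[mu]_(t in D) (t `^ (x - 1) * expR (- (1 * t)))%:E)%E.
  by apply: eq_integral => t _; rewrite mul1r.
rewrite gE integral_mkcond (ge0_integral_scale A0); last 2 first.
- exact: measurable_patch0.
- by move=> t; rewrite patchE; case: ifP.
rewrite -(@ge0_integralZl _ _ _ mu D mD _ (measurable_funTS (mgam A x)) _ (fun t _ => gam_ge0 A x t) A1).
rewrite [RHS]integral_mkcond; apply: eq_integral => t _.
have DE (s : R) : (s \in D) = (0 < s).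
  by apply/idP/idP; rewrite inE /= in_itv/= andbT.
rewrite !patchE !DE pmulr_rgt0//.
case: ifPn => t0; last by rewrite mul0e.
rewrite -!EFinM mul1r (powRM _ (ltW A0) (ltW t0)); congr (_%:E).
have -> : A `^ x = A * A `^ (x - 1).
  rewrite -{2}[A](powRr1 (ltW A0)) -powRD ?(gt_eqF A0) ?implybT//.
  by congr (_ `^ _); ring.
by ring.
Qed.

Lemma gauss_scale (t : R) : 0 < t ->
  (\int[mu]_z (expR (- ((1 + z ^+ 2) * t)))%:E =
   (Num.sqrt pi * t `^ (- 2^-1) * expR (- t))%:E)%E.
Proof.
move=> t0; have s0 : 0 < t `^ 2^-1 by exact: powR_gt0.
have mg (A : R) : measurable_fun setT (fun z : measurableTypeR R => (gauss_fun (A * z))%:E).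
  apply/measurable_EFinP; apply: (measurableT_comp (@measurable_gauss_fun R)).
  by apply: measurable_funM => //; exact: measurable_cst.
have g0 (A z : R) : (0 <= (gauss_fun (A * z))%:E)%E by rewrite lee_fin expR_ge0.
have := @integralT_gauss R.
rewrite (ge0_integral_scale s0); last 2 first.
- by apply/measurable_EFinP; exact: measurable_gauss_fun.
- by move=> z; rewrite lee_fin expR_ge0.
have s1 : (0 <= (t `^ 2^-1)%:E)%E by rewrite lee_fin ltW.
rewrite (@ge0_integralZr _ _ _ mu setT measurableT _ (mg _) _ (fun z _ => g0 _ z) s1).
move=> gE.
have e0 : (0 <= (expR (- t))%:E)%E by rewrite lee_fin expR_ge0.
transitivity ((expR (- t))%:E * \int[mu]_z (gauss_fun (t `^ 2^-1 * z))%:E)%E.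
  rewrite -(@ge0_integralZl _ _ _ mu setT measurableT _ (mg _) _ (fun z _ => g0 _ z) e0).
  apply: eq_integral => z _; rewrite -EFinM /gauss_fun -expRD; congr (expR _)%:E.
  have tE : (t `^ 2^-1) ^+ 2 = t.
    by rewrite -powR_mulrn ?powR_ge0// -powRrM mulVf ?powRr1 ?(ltW t0).
  by rewrite exprMn tE; ring.
rewrite EFinM [RHS]muleC; congr (_ * _)%E.
move: gE; set I := (\int[mu]_z _)%E => gE.
rewrite EFinM -gE -muleA -EFinM -powRD ?(gt_eqF t0) ?implybT//.
by rewrite subrr powRr0 mule1.
Qed.

(** By scaling, (1 + z^2)^(-b/2) Gamma(b/2) is the integral of t^(b/2 - 1) exp(-(1 + z^2) t) over t
    > 0. After exchanging the integrals, the one in z is Gaussian and yields sqrt(pi) t^(-1/2)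
    exp(-t). *)
Lemma profile_mass_gam (b : R) : 1 < b ->
  ((profile_mass b)%:E * gam (b / 2) = (Num.sqrt pi)%:E * gam ((b - 1) / 2))%E.
Proof.
move=> b1.
pose f (z t : R) : \bar R := (t `^ (b / 2 - 1) * expR (- ((1 + z ^+ 2) * t)))%:E.
have f0 z t : (0 <= f z t)%E by exact: gam_ge0.
have mf : measurable_fun setT (fun w : measurableTypeR R * measurableTypeR R => f w.1 w.2).
  apply/measurable_EFinP; apply: measurable_funM.
    by apply: (measurableT_comp (measurable_powR _)); exact: measurable_snd.
  apply: (measurableT_comp (@measurable_expR R)); apply: measurable_funN.
  apply: measurable_funM; last exact: measurable_snd.
  apply: measurable_funD; first exact: measurable_cst.
  by apply: measurable_funX; exact: measurable_fst.
have G0 : (0 <= gam (b / 2))%E.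
  by apply: integral_ge0 => t _; have := gam_ge0 1 (b / 2) t; rewrite mul1r.
have G1 : (0 <= gam ((b - 1) / 2))%E.
  by apply: integral_ge0 => t _; have := gam_ge0 1 ((b - 1) / 2) t; rewrite mul1r.
have mp : measurable_fun setT (fun z : measurableTypeR R => (profile b z)%:E).
  apply/measurable_EFinP; exact: continuous_measurable_fun (@continuous_profile _ _).
have pr0 (z : R) : (0 <= (profile b z)%:E)%E by rewrite lee_fin ltW ?profile_gt0.
transitivity (\int[mu]_z \int[mu]_(t in D) f z t)%E.
  rewrite -integral_profile//.
  rewrite -(@ge0_integralZr _ _ _ mu setT measurableT _ mp _ (fun z _ => pr0 z) G0).
  apply: eq_integral => z _; rewrite /f Gamma_scale; last exact: sqr1_gt0.
  by [].
rewrite (tonelli_swap_in mu mu mD mf (fun z t _ => f0 z t)).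
have sp0 : (0 <= (Num.sqrt pi : R)%:E)%E by rewrite lee_fin sqrtr_ge0.
have mg' := mgam 1 ((b - 1) / 2); have g0' := gam_ge0 1 ((b - 1) / 2).
have -> : gam ((b - 1) / 2) =
    (\int[mu]_(t in D) (t `^ ((b - 1) / 2 - 1) * expR (- (1 * t)))%:E)%E.
  by apply: eq_integral => t _; rewrite mul1r.
rewrite -(@ge0_integralZl _ _ _ mu D mD _ (measurable_funTS mg') _ (fun t _ => g0' t) sp0).
apply: eq_integral => t; rewrite inE /= in_itv/= andbT => t0.
have me : measurable_fun setT (fun z : measurableTypeR R => (expR (- ((1 + z ^+ 2) * t)))%:E).
  apply/measurable_EFinP; apply: (measurableT_comp (@measurable_expR R)); apply: measurable_funN.
  apply: measurable_funM; last exact: measurable_cst.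
  by apply: measurable_funD; [exact: measurable_cst|exact: measurable_funX].
have e0 (z : R) : (0 <= (expR (- ((1 + z ^+ 2) * t)))%:E)%E by rewrite lee_fin expR_ge0.
have t1 : (0 <= (t `^ (b / 2 - 1))%:E)%E by rewrite lee_fin powR_ge0.
transitivity (\int[mu]_z ((t `^ (b / 2 - 1))%:E * (expR (- ((1 + z ^+ 2) * t)))%:E))%E.
  by apply: eq_integral => z _; rewrite -EFinM.
rewrite (@ge0_integralZl _ _ _ mu setT measurableT _ me _ (fun z _ => e0 z) t1).
rewrite gauss_scale// -!EFinM mul1r; congr (_%:E).
have -> : t `^ ((b - 1) / 2 - 1) = t `^ (b / 2 - 1) * t `^ (- 2^-1).
  rewrite -powRD ?(gt_eqF t0) ?implybT//; congr (_ `^ _); by field.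
by ring.
Qed.

Lemma gam_lty (x : R) : 1 <= x -> (gam x < +oo)%E.
Proof.
(* With m > x + 1, the bound exp(-(1 + t)) <= m^m (1 + t)^(-m) makes the integrand at most a
   multiple of (1 + t)^(-2). *)
move=> x1; pose m := (Num.truncn (x + 1)).+1.
have mx : x + 1 < m%:R by exact: truncnS_gt.
pose C : R := expR 1 * m%:R ^+ m.
have C0 : 0 <= C by rewrite mulr_ge0 ?expR_ge0// exprn_ge0.
have ma : measurable_fun (`[0%R, +oo[%classic : set (measurableTypeR R))
    (fun t : measurableTypeR R => ((1 + 1 * t) `^ (- 2))%:E).
  apply: measurable_funTS; apply/measurable_EFinP; apply: (measurableT_comp (measurable_powR _)).
  by apply: measurable_funD => //; apply: measurable_funM => //; exact: measurable_cst.
have a0 (t : R) : (0 <= ((1 + 1 * t) `^ (- 2))%:E)%E by rewrite lee_fin powR_ge0.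
apply: (@le_lt_trans _ _ (\int[mu]_(t in `[0%R, +oo[) (C%:E * ((1 + 1 * t) `^ (- 2))%:E))%E); last first.
  rewrite (@ge0_integralZl _ _ _ mu _ (measurable_itv _) _ ma _ (fun t _ => a0 t)) ?lee_fin//.
  by rewrite integral_affine_powR ?ltr1n// -EFinM ltry.
apply: (@le_trans _ _ (\int[mu]_(t in D) (C%:E * ((1 + 1 * t) `^ (- 2))%:E))%E); last first.
  apply: ge0_subset_integral => //.
  - by apply: emeasurable_funM => //; exact: measurable_cst.
  - by move=> t _; rewrite mule_ge0 ?lee_fin ?powR_ge0.
  - by move=> t /=; rewrite !in_itv/= !andbT => /ltW.
apply: ge0_le_integral => //.
- by move=> t _; have := gam_ge0 1 x t; rewrite mul1r.
- by have := mgam 1 x; under eq_fun do rewrite mul1r; exact: measurable_funTS.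
- apply: emeasurable_funM; first exact: measurable_cst.
  by apply: measurable_funS ma => // t /=; rewrite !in_itv/= !andbT => /ltW.
- move=> t /=; rewrite in_itv/= andbT mul1r -EFinM lee_fin => t0.
  have s0 : 0 < 1 + t by rewrite ltr_wpDr// ltW.
  have h1 : t `^ (x - 1) <= (1 + t) `^ (x - 1).
    by apply: ge0_ler_powR; rewrite ?nnegrE ?subr_ge0 ?(ltW t0) ?(ltW s0)// lerDr.
  have h2 : expR (- t) <= C * (1 + t) `^ (- m%:R).
    have := @expRN_inv_le R m (1 + t)^-1 (ltn0Sn _); rewrite invr_gt0 invrK => /(_ s0) h.
    rewrite (_ : - t = 1 + - (1 + t)); last by ring.
    rewrite expRD /C -mulrA ler_wpM2l ?expR_ge0//; apply: (le_trans h).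
    by rewrite powRN powR_mulrn ?(ltW s0)// exprVn.
  apply: (@le_trans _ _ ((1 + t) `^ (x - 1) * (C * (1 + t) `^ (- m%:R)))).
    by rewrite ler_pM ?powR_ge0 ?expR_ge0.
  rewrite mulrCA ler_wpM2l// -powRD ?(gt_eqF s0) ?implybT//.
  apply: ler_powR; first by rewrite lerDl ltW.
  by move: mx; lra.
Qed.

Lemma gam_gt0 (x : R) : 1 <= x -> (0 < gam x)%E.
Proof.
move=> x1; apply: (@lt_le_trans _ _ (\int[mu]_(t in `[1%R, 2%R]) cst (expR (- 2 : R))%:E t)%E).
  rewrite integral_cst//; apply: mule_gt0; first by rewrite lte_fin expR_gt0.
  have E : (1%E : \bar R) = lebesgue_measure (`[1%R, 2%R]%classic : set R).
    by rewrite lebesgue_measure_itv/= lte_fin ltr1n -EFinB; congr (_%:E); ring.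
  exact: (eq_rect _ (fun z : \bar R => (0 < z)%E) lte01 _ E).
apply: (@le_trans _ _ (\int[mu]_(t in `[1%R, 2%R]) (t `^ (x - 1) * expR (- t))%:E)%E).
  have mg : measurable_fun setT (fun t : measurableTypeR R => (t `^ (x - 1) * expR (- t))%:E).
    by have := mgam 1 x; under eq_fun do rewrite mul1r.
  apply: ge0_le_integral => //.
  - by move=> t _; rewrite lee_fin expR_ge0.
  - exact: measurable_funTS.
  - move=> t /=; rewrite in_itv/= => /andP[t1 t2]; rewrite lee_fin -[leLHS]mul1r.
    apply: ler_pM; rewrite ?expR_ge0//; last by rewrite ler_expR lerN2.
    rewrite -[leLHS](powRr0 t); apply: ler_powR => //.
    by rewrite subr_ge0.
apply: ge0_subset_integral => //.
- by have := mgam 1 x; under eq_fun do rewrite mul1r; exact: measurable_funTS.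
- by move=> t _; have := gam_ge0 1 x t; rewrite mul1r.
- by move=> t /=; rewrite !in_itv/= andbT => /andP[t1 _]; exact: lt_le_trans t1.
Qed.

Lemma Gamma_gt0 (x : R) : 1 <= x -> 0 < Gamma x.
Proof. by move=> x1; apply: fine_gt0; rewrite gam_gt0// gam_lty. Qed.

(** The argument b/2 is at least 1, where Gamma is known to be finite, but (b - 1)/2 may be smaller;
    finiteness there is read off from the identity, whose left side is finite. *)
Lemma profile_mass_Gamma (b : R) : 2 <= b ->
  profile_mass b * Gamma (b / 2) = Num.sqrt pi * Gamma ((b - 1) / 2).
Proof.
move=> b2; have b1 : 1 < b by move: b2; lra.
have x1 : 1 <= b / 2 by rewrite ler_pdivlMr// mul1r.
have := profile_mass_gam b1.
have F1 : gam (b / 2) \is a fin_num by rewrite ge0_fin_numE ?gam_lty// ltW// gam_gt0.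
have sp0 : 0 < Num.sqrt pi :> R by rewrite sqrtr_gt0 pi_gt0.
have G0 : (0 <= gam ((b - 1) / 2))%E.
  by apply: integral_ge0 => t _; have := gam_ge0 1 ((b - 1) / 2) t; rewrite mul1r.
rewrite /Gamma /Rintegral -/(gam _) -/(gam _).
move: F1 G0; case: (gam (b / 2)) => // r _; case: (gam ((b - 1) / 2)) => [s| |]//= _.
  by rewrite -!EFinM => -[].
by rewrite gt0_muley ?lte_fin.
Qed.

Lemma profile_masses_Gamma (n : nat) (a : R) : n%:R + 1 <= a ->
  profile_masses n a * Gamma (a / 2) = Num.sqrt pi ^+ n * Gamma ((a - n%:R) / 2).
Proof.
elim: n => [_|n IH na]; first by rewrite /profile_masses big_ord0 expr0 !mul1r subr0.
have na' : n%:R + 1 <= a by apply: le_trans na; rewrite lerD2r ler_nat.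
have n2 : 2 <= a - n%:R by move: na; rewrite -natr1; lra.
have -> : profile_masses n.+1 a = profile_masses n a * profile_mass (a - n%:R).
  by rewrite /profile_masses big_ord_recr.
have -> : a - n.+1%:R = a - n%:R - 1 by rewrite -natr1; ring.
have := profile_mass_Gamma n2; have := IH na'.
move: (profile_masses n a) (profile_mass _) (Gamma (a / 2)) (Gamma ((a - n%:R) / 2)) (Gamma _).
move=> x y z v w E1 E2.
by rewrite mulrAC E1 exprSr -!mulrA; congr (_ * _); rewrite mulrC.
Qed.

End Gamma_identity.

(** * The constant in closed form *)

Theorem proposition1p1 (R : realType) (N : nat) (p : R) :
  (2 <= N)%N -> 1 < p -> p < N%:R ->
  Kp_inv R N p =
    (((N%:R - p) / (p - 1)) `^ (p - 1) * pi `^ ((p - 1) / 2) *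
     (Gamma ((N%:R - 1) / (2 * (p - 1))) /
      Gamma (p * (N%:R - 1) / (2 * (p - 1)))) `^ ((p - 1) / (N%:R - 1)))%:E.
Proof.
case: N => // n n0 p1 pN; rewrite (Kp_invE n0 p1 pN); congr (_%:E).
have p10 : 0 < p - 1 by rewrite subr_gt0.
have nR : 0 < n%:R :> R by rewrite ltr0n.
have pn : p - 1 < n%:R by rewrite ltrBlDr natr1.
have nE : n.+1%:R - 1 = n%:R :> R by rewrite -natr1 addrK.
have K0 := profile_masses_gt0 p1 pn.
have na : n%:R + 1 <= p * n%:R / (p - 1).
  rewrite -lerBrDl (_ : _ - n%:R = n%:R / (p - 1)); last by field; rewrite gt_eqF.
  by rewrite ler_pdivlMr// mul1r ltW.
have a2 : 1 <= p * n%:R / (p - 1) / 2.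
  rewrite ler_pdivlMr// mul1r; apply: le_trans na.
  by rewrite -[2]/(1 + 1) lerD2r ler1n.
have KG := profile_masses_Gamma na; have G0 := Gamma_gt0 a2.
have s0 : 0 < Num.sqrt pi ^+ n :> R by rewrite exprn_gt0// sqrtr_gt0 pi_gt0.
rewrite nE /trace_const -[RHS]mulrA; congr (_ * _).
  by congr (_ `^ _); rewrite -natr1; field; rewrite gt_eqF.
have -> : n%:R / (2 * (p - 1)) = (p * n%:R / (p - 1) - n%:R) / 2 by field; rewrite gt_eqF.
have -> : p * n%:R / (2 * (p - 1)) = p * n%:R / (p - 1) / 2 by field; rewrite gt_eqF.
move: KG G0 K0; set K := profile_masses _ _; set G := Gamma _; set G' := Gamma _.
move=> KG G0 K0.
have KE : K = Num.sqrt pi ^+ n * (G' / G) by rewrite mulrA -KG mulfK// gt_eqF.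
(* The argument of G' is only known to exceed 1/2, outside the range of [Gamma_gt0]; the sign of the
   ratio comes from K > 0. *)
have r0 : 0 <= G' / G by rewrite -(pmulr_rge0 _ s0) -KE ltW.
rewrite {}KE.
rewrite (powRM _ (ltW s0) r0); congr (_ * _).
rewrite -powR_mulrn ?sqrtr_ge0// -powR12_sqrt ?pi_ge0// -!powRrM.
by congr (_ `^ _); field; rewrite gt_eqF.
Qed.
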